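(* Let $(\Omega,\rho)$ be a geometric homogeneous space and let $\Theta$ be a bounded domain with $\overline\Theta\subset\Omega$. Assume that the local Poincaré inequality of order $p=2$ holds and that the global Sobolev inequality with gain $\sigma>1$ holds on $\Theta$. Let $Xu=-\mathrm{div}(P\nabla u)+\mathbf{H}\mathbf{R}u+\mathbf{S}'(\mathbf{G}u)+Fu$ be a second order linear degenerate elliptic operator with rough coefficients in $\Theta$ that satisfies negativity condition (2)-i). Assume that $F\in L^t(\Theta)$ with $t>\sigma'=\frac{\sigma}{\sigma-1}$ and that $\mathbf{G},\mathbf{H}\in[L^q(\Theta)]^N$ with $q>2\sigma'$. If $\mathbf{u}=(u,\nabla u)\in QH^1(\Theta)$ is a weak solution of $X\mathbf{u}\le0$ in $\Theta$, then $$\sup_\Theta u\le\sup_{\partial\Theta}u^+.$$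
   Context: Geometric homogeneous space: $\Omega\subset\mathbb{R}^n$ is a bounded open set and $\rho:\Omega\times\Omega\to[0,\infty)$ is a symmetric quasimetric, i.e. for some $\kappa\ge1$ and all $x,y,z\in\Omega$: $\rho(x,y)=0$ iff $x=y$; $\rho(x,y)=\rho(y,x)$; $\rho(x,y)\le\kappa[\rho(x,z)+\rho(z,y)]$. Put $B(x,r)=\{y\in\Omega:\rho(x,y)<r\}$. $(\Omega,\rho)$ is a geometric homogeneous space if: (a) every $B(x,r)$, $x\in\Omega$, $r>0$, is open in the Euclidean topology; (b) for $x,y\in\Omega$, $|x-y|\to0$ if $\rho(x,y)\to0$ (equivalently, for every $x\in\Omega$ and $\epsilon>0$ there is $\delta>0$ with $B(x,\delta)\subset\{y\in\Omega:|x-y|<\epsilon\}$); (c) the $\rho$-balls are locally geometrically doubling: for every compact $E\subset\Omega$ there is $\delta=\delta(E)>0$ such that for all $x\in E$ and $0<r'\le r<\delta$, $B(x,r)$ contains at most $C(r/r')$ disjoint $\rho$-balls of radius $r'$, where $C(r/r')$ is independent of $x$ and $E$. Degenerate Sobolev spaces: $Q=Q(x)$ is a nonnegative definite symmetric $n\times n$ matrix of measurable functions on $\Omega$ with $|Q|\in L^\infty_{loc}(\Omega)$. For open $\Theta$ with $\overline\Theta\subset\Omega$, $QH^1(\Theta)$ (respectively $QH^1_0(\Theta)$) is the completion, in the norm $\|\varphi\|_{QH^1(\Theta)}=\big(\int_\Theta|\varphi|^2dx+\int_\Theta|\sqrt{Q}\nabla\varphi|^2dx\big)^{1/2}$, of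 the set $Lip_Q(\Theta)$ of locally Lipschitz functions on $\Theta$ with finite norm (respectively of the set $Lip_0(\Theta)$ of Lipschitz functions with compact support in $\Theta$). Elements are identified with pairs $\mathbf{u}=(u,\nabla u)$ (limits of pairs $(\varphi_j,\nabla\varphi_j)$), where $u\in L^2(\Theta)$ and $\nabla u$ is a measurable $\mathbb{R}^n$-valued function with $\sqrt{Q}\nabla u\in L^2$, two such functions being identified if $\sqrt{Q}$ times their difference vanishes a.e.; $\nabla u$ need not be determined by $u$. Local Poincaré inequality of order $p$: a continuous function $r_1:\Omega\to(0,\infty)$ is fixed, and there are $C_2>0$, $\mathfrak{b}\ge1$ such that for every $y\in\Omega$ and $r>0$ with $\mathfrak{b}r\in(0,r_1(y))$, writing $B_r=B(y,r)$ and $f_{B_r}=\frac1{|B_r|}\int_{B_r}f\,dx$, $$\Big(\tfrac{1}{|B_r|}\int_{B_r}|f-f_{B_r}|^pdx\Big)^{1/p}\le C_2\,r\Big(\tfrac{1}{|B_{\mathfrak{b}r}|}\int_{B_{\mathfrak{b}r}}|\sqrt{Q}\nabla f|^pdx\Big)^{1/p}\quad\text{for all } f\in Lip_{loc}(\Omega).$$ Global Sobolev inequality with gain $\sigma>1$ on $\Theta$: there is $C_3>0$ with $\big(\int_\Theta|f|^{2\sigma}dx\big)^{1/(2\sigma)}\le C_3\big(\int_\Theta|\sqrt{Q}\nabla f|^2dx\big)^{1/2}$ for all $f\in Lip_0(\Theta)$. Subunit vector fields: a measurable vector field $W=(w_1,\dots,w_n)$ is subunit if $\big(\sum_iw_i(x)\xi_i\big)^2\le\langle\xi,Q(x)\xi\rangle$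 for all $\xi\in\mathbb{R}^n$ and a.e. $x\in\Theta$. For $\mathbf{u}\in QH^1(\Theta)$, $Wu=\sum_iw_i(\nabla u)_i\in L^2(\Theta)$; $W(uv)=uWv+vWu$. $W'u=-\sum_i\partial_{x_i}(w_iu)$ is the formal adjoint. For tuples, $\mathbf{G}\mathbf{W}u=\sum_ig_iW_iu$ and $\mathbf{W}'(\mathbf{G}u)=\sum_iW_i'(g_iu)$. Second order linear degenerate elliptic operator with rough coefficients: $Xu=-\mathrm{div}(P\nabla u)+\mathbf{H}\mathbf{R}u+\mathbf{S}'(\mathbf{G}u)+Fu$ in $\Theta$, where $P=P(x)$ is a bounded measurable nonnegative definite symmetric $n\times n$ matrix with $c_1\langle\xi,Q(x)\xi\rangle\le\langle\xi,P(x)\xi\rangle\le C_1\langle\xi,Q(x)\xi\rangle$ for some $c_1,C_1>0$, all $\xi\in\mathbb{R}^n$ and a.e. $x\in\Theta$; $\mathbf{R},\mathbf{S}$ are $N$-tuples of subunit vector fields; $\mathbf{G},\mathbf{H}$ are $\mathbb{R}^N$-valued measurable functions and $F$ is a real measurable function on $\Theta$. Its bilinear form is $$\mathcal{L}(\mathbf{u},\mathbf{v})=\int_\Theta\big[\langle\nabla v,P\nabla u\rangle+v\,\mathbf{H}\mathbf{R}u+u\,\mathbf{G}\mathbf{S}v+Fuv\big]dx .$$ Negativity condition (2)-i): $\int_\Theta Fuv+\mathbf{G}\mathbf{S}(uv)\,dx\ge0$ for all $(u,\nabla u),(v,\nabla v)\in QH^1_0(\Theta)$ with $uv\ge0$ a.e.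 in $\Theta$. Weak solution of $X\mathbf{u}\le0$ in $\Theta$: $\mathbf{u}\in QH^1(\Theta)$ such that $\mathcal{L}(\mathbf{u},\mathbf{v})\le0$ for every $\mathbf{v}=(v,\nabla v)\in QH^1_0(\Theta)$ with $v\ge0$ a.e. in $\Theta$ (the definition presupposes that the integral $\mathcal{L}(\mathbf{u},\mathbf{v})$ is defined). Boundary inequalities: for $\mathbf{u}=(u,\nabla u)\in QH^1(\Theta)$ one has $\mathbf{u}^+=(u^+,\chi_{\{u>0\}}\nabla u)\in QH^1(\Theta)$ with $u^+=\max\{u,0\}$. One says $u\le0$ on $\partial\Theta$ iff $\mathbf{u}^+\in QH^1_0(\Theta)$; for $\mathbf{u},\mathbf{v}\in QH^1(\Theta)$, $u\le v$ on $\partial\Theta$ iff $u-v\le0$ on $\partial\Theta$. A constant $k\in\mathbb{R}$ is identified with $(k,\mathbf{0})\in QH^1(\Theta)$, and $\sup_{\partial\Theta}u=\inf\{k\in\mathbb{R}: u\le k\text{ on }\partial\Theta\}$; $\sup_{\partial\Theta}u^+$ is this quantity for $\mathbf{u}^+$. $\sup_\Theta u$ is the essential supremum. *)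

(* Defs.v *)
From HB Require Import structures.
From mathcomp Require Import all_boot all_order all_algebra.
From mathcomp Require Import all_classical all_reals all_analysis.
From mathcomp Require Import ess_sup_inf.

Set Implicit Arguments.
Unset Strict Implicit.
Unset Printing Implicit Defensive.

Import Order.TTheory GRing.Theory Num.Theory.
Import numFieldNormedType.Exports.

Local Open Scope classical_set_scope.
Local Open Scope ring_scope.

(* Lebesgue measure on R^n. The library has it on R only, so it is obtained in
   three steps: the n-fold product of [lebesgue_measure] on Borel sets of
   n-tuples, the induced outer measure on row vectors, and its Caratheodory
   measurable sets. The measurable subsets of 'rV[R]_n are thus the Lebesgue
   measurable ones (null sets included), and not only the Borel ones. *)
Section tuple_product.
Context {R : realType} (n : nat).
Notation RT := (measurableTypeR R).
Variable m : {sigma_finite_measure set (n.-tuple RT) -> \bar R}.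

Definition tuple_cons (p : RT * n.-tuple RT) : n.+1.-tuple RT :=
  [tuple of p.1 :: p.2].

Lemma measurable_tuple_cons : measurable_fun setT tuple_cons.
Proof. exact: measurable_cons. Qed.

Definition lebesgue_cons : set (n.+1.-tuple RT) -> \bar R :=
  pushforward (@lebesgue_measure R \x m)%E tuple_cons.

Let lebesgue_cons0 : lebesgue_cons set0 = 0%E.
Proof. by rewrite /lebesgue_cons /pushforward preimage_set0 measure0. Qed.

Let lebesgue_cons_ge0 A : (0 <= lebesgue_cons A)%E.
Proof. by rewrite /lebesgue_cons /pushforward. Qed.

Let lebesgue_cons_sigma_additive : semi_sigma_additive lebesgue_cons.
Proof.
move=> F mF tF mUF; rewrite /lebesgue_cons /pushforward preimage_bigcup.
apply: measure_semi_sigma_additive.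
- by move=> k; rewrite -[X in measurable X]setTI; exact: measurable_tuple_cons.
- apply/trivIsetP => /= i j _ _ ij; rewrite -preimage_setI.
  by move/trivIsetP : tF => /(_ _ _ _ _ ij) ->//; rewrite preimage_set0.
- by rewrite -preimage_bigcup -[X in measurable X]setTI; exact: measurable_tuple_cons.
Qed.

HB.instance Definition _ := isMeasure.Build _ _ _ lebesgue_cons
  lebesgue_cons0 lebesgue_cons_ge0 lebesgue_cons_sigma_additive.

Let lebesgue_cons_sigma_finite : sigma_finite setT lebesgue_cons.
Proof.
pose hd (t : n.+1.-tuple RT) : RT := thead t.
pose bh (t : n.+1.-tuple RT) : n.-tuple RT := [tuple of behead t].
have /sigma_finiteP[F [TF ndF Foo]] := sigma_finiteT (@lebesgue_measure R).
have /sigma_finiteP[G [TG ndG Goo]] := sigma_finiteT m.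
exists (fun k => [set t | F k (hd t) /\ G k (bh t)]).
  apply/esym; rewrite -subTset => t _.
  have [i _ Fi] : (\bigcup_k F k) (hd t) by rewrite -TF.
  have [j _ Gj] : (\bigcup_k G k) (bh t) by rewrite -TG.
  exists (maxn i j) => //; split.
    by move: (hd t) Fi; exact/subsetPset/ndF/leq_maxl.
  by move: (bh t) Gj; exact/subsetPset/ndG/leq_maxr.
move=> k; have [mF Fk] := Foo k; have [mG Gk] := Goo k; split.
  have mhd : measurable_fun setT hd by exact: measurable_tnth.
  have mbh : measurable_fun setT bh by exact: measurable_behead.
  apply: (@measurableI _ _ (hd @^-1` F k) (bh @^-1` G k)).
    by rewrite -[X in measurable X]setTI; exact: mhd.
  by rewrite -[X in measurable X]setTI; exact: mbh.
rewrite [ltLHS](_ : _ = (@lebesgue_measure R \x m)%E (F k `*` G k)).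
  by rewrite product_measure1E// lte_mul_pinfty// ge0_fin_numE.
rewrite /lebesgue_cons /pushforward; congr (product_measure1 _ _ _).
apply/seteqP; split=> -[a t] /=; rewrite /hd theadE (_ : bh _ = t)//.
all: exact/val_inj.
Qed.

HB.instance Definition _ := Measure_isSigmaFinite.Build _ _ _ lebesgue_cons
  lebesgue_cons_sigma_finite.

End tuple_product.

Fixpoint lebesgue_tuple (R : realType) (n : nat) :
    {sigma_finite_measure set (n.-tuple (measurableTypeR R)) -> \bar R} :=
  if n is k.+1 then lebesgue_cons (lebesgue_tuple R k)
  else \d_([tuple of [::]] : 0.-tuple (measurableTypeR R)).

Section lebesgue_outer.
Context (R : realType) (n : nat).

Definition lebesgue_outer (A : set 'rV[R]_n) : \bar R :=
  (lebesgue_tuple R n)^*%mu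
    [set t : n.-tuple (measurableTypeR R) | A (\row_i tnth t i)].

Let lebesgue_outer0 : lebesgue_outer set0 = 0%E.
Proof. exact: outer_measure0. Qed.

Let lebesgue_outer_ge0 A : (0 <= lebesgue_outer A)%E.
Proof. exact: outer_measure_ge0. Qed.

Let le_lebesgue_outer : {homo lebesgue_outer : A B / A `<=` B >-> (A <= B)%E}.
Proof. by move=> A B AB; apply: le_outer_measure => t; exact: AB. Qed.

Let lebesgue_outer_sigma_subadditive : sigma_subadditive lebesgue_outer.
Proof. by move=> F; exact: (outer_measure_sigma_subadditive (_^*%mu)). Qed.

HB.instance Definition _ := isOuterMeasure.Build R 'rV[R]_n lebesgue_outer
  lebesgue_outer0 lebesgue_outer_ge0 le_lebesgue_outer
  lebesgue_outer_sigma_subadditive.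

End lebesgue_outer.

HB.instance Definition _ (R : realType) (n : nat) :=
  Measurable.copy 'rV[R]_n (caratheodory_type (@lebesgue_outer R n)).

Definition lebesgue_rV {R : realType} {n : nat} : set 'rV[R]_n -> \bar R :=
  @lebesgue_outer R n.

HB.instance Definition _ (R : realType) (n : nat) :=
  isMeasure.Build _ 'rV[R]_n R (@lebesgue_rV R n)
    (@caratheodory_measure0 _ _ (@lebesgue_outer R n))
    (@caratheodory_measure_ge0 _ _ (@lebesgue_outer R n))
    (@caratheodory_measure_sigma_additive _ _ (@lebesgue_outer R n)).

Lemma lebesgue_rV_box (R : realType) (n : nat)
    (A : 'I_n -> set (measurableTypeR R)) : (forall i, measurable (A i)) ->
  lebesgue_rV [set x : 'rV[R]_n | forall i, A i (x 0 i)] =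
  (\prod_(i < n) lebesgue_measure (A i))%E.
Proof.
move=> mA; rewrite /lebesgue_rV /lebesgue_outer.
pose box k (B : 'I_k -> set (measurableTypeR R)) :=
  [set t : k.-tuple (measurableTypeR R) | forall i, B i (tnth t i)].
have mbox k B : (forall i, measurable (B i)) -> measurable (@box k B).
  move=> mB; rewrite (_ : box k B = \big[setI/setT]_(i < k)
      ((fun t : k.-tuple (measurableTypeR R) => tnth t i) @^-1` B i)).
    apply: bigsetI_measurable => i _.
    by rewrite -[X in measurable X]setTI; exact: measurable_tnth.
  rewrite -bigcap_seq; apply/seteqP; split => t /= Bt i; first by move=> _; exact: Bt.
  by apply: Bt; rewrite /= mem_index_enum.
rewrite [X in ((lebesgue_tuple R n)^*)%mu X](_ : _ = box n A); last first.
  by apply/seteqP; split=> t /= At i; have := At i; rewrite mxE.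
rewrite measurable_mu_extE; last exact: mbox.
elim: n A mA => [|n IHn] A mA.
  rewrite big_ord0 /= diracE mem_set// => i; by case: i.
rewrite big_ord_recl -IHn; last by move=> i; exact: mA.
rewrite -product_measure1E//; last exact: mbox.
rewrite /= /lebesgue_cons /pushforward; congr (product_measure1 _ _ _).
apply/seteqP; split=> -[a t] /=.
  move=> At; split; first exact: (At ord0).
  by move=> i; have := At (lift ord0 i); rewrite tnthS.
move=> [Aa At] i; case: (unliftP ord0 i) => [j ->|->].
  by rewrite tnthS; exact: At.
exact: Aa.
Qed.

Section linear_algebra.
Context {R : realType} {n : nat}.
Implicit Types (x y : 'rV[R]_n) (A : 'M[R]_n).

(* Vectors of R^n are row vectors. The norm [`|x|] of the library is the
   sup norm; [enorm x] is the Euclidean one. *)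
Definition dotv x y : R := (x *m y^T) 0 0.
Definition enorm x : R := Num.sqrt (dotv x x).

(* The matrix A applied to x, as a row vector. *)
Definition mxact A x : 'rV[R]_n := x *m A^T.

Definition mx_nonneg A := A^T = A /\ forall x, 0 <= dotv x (mxact A x).

(* The nonnegative definite square root, which exists and is unique when
   [mx_nonneg A]. *)
Definition mx_sqrt A : 'M[R]_n := get [set S | mx_nonneg S /\ S *m S = A].

(* A partial derivative is a junk value at points where it does not exist; for
   a locally Lipschitz function these form a null set. *)
Definition grad (f : 'rV[R]_n -> R) x : 'rV[R]_n :=
  \row_i 'D_(delta_mx 0 i) f x.

End linear_algebra.

Section geometric_homogeneous_space.
Context {R : realType} {n : nat}.
Variables (Omega : set 'rV[R]_n) (rho : 'rV[R]_n -> 'rV[R]_n -> R).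

(* Only the values of rho on Omega x Omega are relevant. *)
Definition symmetric_quasimetric :=
  (forall x y, Omega x -> Omega y ->
    [/\ 0 <= rho x y, rho x y = 0 <-> x = y & rho x y = rho y x]) /\
  exists2 kappa : R, 1 <= kappa &
    forall x y z, Omega x -> Omega y -> Omega z ->
      rho x y <= kappa * (rho x z + rho z y).

Definition qball (x : 'rV[R]_n) (r : R) : set 'rV[R]_n :=
  [set y | Omega y /\ rho x y < r].

Definition locally_geometrically_doubling :=
  exists C : R -> R, forall E, compact E -> E `<=` Omega ->
    exists2 delta : R, 0 < delta &
      forall x r r', E x -> 0 < r' -> r' <= r -> r < delta ->
        forall (k : nat) (c : 'I_k -> 'rV[R]_n),
          (forall i, Omega (c i) /\ qball (c i) r' `<=` qball x r) ->
          trivIset setT (fun i => qball (c i) r') ->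
          k%:R <= C (r / r').

Definition geometric_homogeneous_space :=
  [/\ open Omega, bounded_set Omega & symmetric_quasimetric] /\
  [/\ forall x r, Omega x -> 0 < r -> open (qball x r),
      forall x eps, Omega x -> 0 < eps ->
        exists2 delta, 0 < delta &
          qball x delta `<=` [set y | Omega y /\ enorm (x - y) < eps] &
      locally_geometrically_doubling].

End geometric_homogeneous_space.

Section measurability.
Context {R : realType} {n : nat}.
Variable D : set 'rV[R]_n.

Definition vec_measurable (g : 'rV[R]_n -> 'rV[R]_n) :=
  forall i, measurable_fun D (fun x => g x 0 i).

Definition mx_measurable (A : 'rV[R]_n -> 'M[R]_n) :=
  forall i j, measurable_fun D (fun x => A x i j).

Definition in_Lp (p : \bar R) (f : 'rV[R]_n -> R) :=
  measurable_fun D f /\ ('N[lebesgue_rV]_p[EFin \o (f \_ D)] < +oo)%E.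

End measurability.

Definition degenerate_matrix {R : realType} {n : nat} (Omega : set 'rV[R]_n)
    (Q : 'rV[R]_n -> 'M[R]_n) :=
  [/\ forall x, Omega x -> mx_nonneg (Q x),
      mx_measurable Omega Q &
      forall K, compact K -> K `<=` Omega ->
        exists M : R, \forall x \ae lebesgue_rV, K x -> `|Q x| <= M].

Definition bounded_domain {R : realType} {n : nat} (Theta : set 'rV[R]_n) :=
  [/\ open Theta, connected Theta, Theta !=set0 & bounded_set Theta].

Section Lipschitz_functions.
Context {R : realType} {n : nat}.
Variable D : set 'rV[R]_n.

Definition Lip_loc (f : 'rV[R]_n -> R) := [locally [lipschitz f x | x in D]].

Definition Lip_0 (f : 'rV[R]_n -> R) :=
  let support := closure [set x | D x /\ f x != 0] in
  [/\ [lipschitz f x | x in D], compact support & support `<=` D].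

End Lipschitz_functions.

Section Sobolev_spaces.
Context {R : realType} {n : nat}.
Variables (Q : 'rV[R]_n -> 'M[R]_n) (Theta : set 'rV[R]_n).

(* A pair (u, grad u); the second component need not be determined by the
   first one. *)
Definition fpair : Type := (('rV[R]_n -> R) * ('rV[R]_n -> 'rV[R]_n))%type.

Definition fpair_sub (u v : fpair) : fpair :=
  (fun x => u.1 x - v.1 x, fun x => u.2 x - v.2 x).
Definition fpair_cst (k : R) : fpair := (fun=> k, fun=> 0).
Definition fpair_pos (u : fpair) : fpair :=
  (fun x => Num.max (u.1 x) 0, fun x => if 0 < u.1 x then u.2 x else 0).
Definition with_grad (f : 'rV[R]_n -> R) : fpair := (f, grad f).

Definition Qnorm (g : 'rV[R]_n -> 'rV[R]_n) (x : 'rV[R]_n) : R :=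
  enorm (mxact (mx_sqrt (Q x)) (g x)).

Definition QH1_norm (u : fpair) : \bar R :=
  ((\int[lebesgue_rV]_(x in Theta) (`|u.1 x| ^+ 2)%:E +
    \int[lebesgue_rV]_(x in Theta) (Qnorm u.2 x ^+ 2)%:E) `^ 2^-1)%E.

Definition Lip_Q (f : 'rV[R]_n -> R) :=
  Lip_loc Theta f /\ (QH1_norm (with_grad f) < +oo)%E.

(* The completion of a class S of functions: pairs which are limits of
   (phi_j, grad phi_j) with phi_j in S. Pairs at distance 0 represent the same
   element. *)
Definition QH1_completion (S : set ('rV[R]_n -> R)) (u : fpair) :=
  [/\ measurable_fun Theta u.1, vec_measurable Theta u.2,
      (QH1_norm u < +oo)%E &
      exists2 phi : nat -> 'rV[R]_n -> R, forall j, S (phi j) &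
        QH1_norm (fpair_sub u (with_grad (phi j))) @[j --> \oo] --> 0%E].

Definition QH1 : set fpair := QH1_completion Lip_Q.
Definition QH1_0 : set fpair := QH1_completion (Lip_0 Theta).

Definition nonpos_on_boundary (u : fpair) := QH1_0 (fpair_pos u).
Definition le_on_boundary (u v : fpair) := nonpos_on_boundary (fpair_sub u v).
Definition sup_boundary (u : fpair) : \bar R :=
  ereal_inf [set k%:E | k in [set k | le_on_boundary u (fpair_cst k)]].

(* The value -oo outside Theta does not contribute to the supremum. *)
Definition ess_sup_in (f : 'rV[R]_n -> R) : \bar R :=
  ess_sup lebesgue_rV (patch (fun=> -oo%E) Theta (EFin \o f)).

End Sobolev_spaces.

Section Poincare_Sobolev_inequalities.
Context {R : realType} {n : nat}.

(* The integral is 0 when f is not integrable on B, in which case the left-hand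
   side of the Poincare inequality below is +oo. *)
Definition average (B : set 'rV[R]_n) (f : 'rV[R]_n -> R) : R :=
  (fine (lebesgue_rV B))^-1 * \int[lebesgue_rV]_(x in B) f x.

(* ((1/|B|) \int_B |f|^p)^(1/p) for a nonnegative f *)
Definition pmean (p : R) (B : set 'rV[R]_n) (f : 'rV[R]_n -> R) : \bar R :=
  (((fine (lebesgue_rV B))^-1%:E *
    \int[lebesgue_rV]_(x in B) (f x `^ p)%:E) `^ p^-1)%E.

Definition local_Poincare (Omega : set 'rV[R]_n)
    (rho : 'rV[R]_n -> 'rV[R]_n -> R) (Q : 'rV[R]_n -> 'M[R]_n)
    (r1 : 'rV[R]_n -> R) (p : R) :=
  exists C2 b : R, [/\ 0 < C2, 1 <= b &
    forall y r, Omega y -> 0 < r -> b * r < r1 y ->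
    forall f, Lip_loc Omega f ->
      let B := qball Omega rho y r in
      let bB := qball Omega rho y (b * r) in
      (pmean p B (fun x => `|f x - average B f|%R) <=
       (C2 * r)%:E * pmean p bB (Qnorm Q (grad f)))%E].

Definition global_Sobolev (Q : 'rV[R]_n -> 'M[R]_n) (Theta : set 'rV[R]_n)
    (sigma : R) :=
  exists2 C3 : R, 0 < C3 & forall f, Lip_0 Theta f ->
    ((\int[lebesgue_rV]_(x in Theta) (`|f x| `^ (2 * sigma))%:E)
        `^ (2 * sigma)^-1 <=
     C3%:E * (\int[lebesgue_rV]_(x in Theta) (Qnorm Q (grad f) x ^+ 2)%:E)
        `^ 2^-1)%E.

End Poincare_Sobolev_inequalities.

(* The coefficients of
   X u = - div (P grad u) + H R u + S' (G u) + F u. *)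
Record operator_coefs (R : realType) (n N : nat) := OperatorCoefs {
  coefP : 'rV[R]_n -> 'M[R]_n;
  coefR : 'I_N -> 'rV[R]_n -> 'rV[R]_n;
  coefS : 'I_N -> 'rV[R]_n -> 'rV[R]_n;
  coefG : 'I_N -> 'rV[R]_n -> R;
  coefH : 'I_N -> 'rV[R]_n -> R;
  coefF : 'rV[R]_n -> R }.

Section operators.
Context {R : realType} {n N : nat}.
Variables (Q : 'rV[R]_n -> 'M[R]_n) (Theta : set 'rV[R]_n).
Variable X : operator_coefs R n N.

Definition subunit (W : 'rV[R]_n -> 'rV[R]_n) :=
  vec_measurable Theta W /\
  \forall x \ae lebesgue_rV, Theta x ->
    forall xi, (dotv (W x) xi) ^+ 2 <= dotv xi (mxact (Q x) xi).

Definition rough_elliptic_operator :=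
  [/\ [/\ mx_measurable Theta (coefP X),
          forall x, Theta x -> mx_nonneg (coefP X x),
          exists M : R, forall x, Theta x -> `|coefP X x| <= M &
          exists c1 C1 : R, [/\ 0 < c1, 0 < C1 &
            \forall x \ae lebesgue_rV, Theta x -> forall xi,
              c1 * dotv xi (mxact (Q x) xi) <= dotv xi (mxact (coefP X x) xi) /\
              dotv xi (mxact (coefP X x) xi) <= C1 * dotv xi (mxact (Q x) xi)]],
      forall i, subunit (coefR X i) /\ subunit (coefS X i),
      forall i, measurable_fun Theta (coefG X i) /\
                measurable_fun Theta (coefH X i) &
      measurable_fun Theta (coefF X)].

Definition vf_apply (W : 'rV[R]_n -> 'rV[R]_n) (u : fpair) (x : 'rV[R]_n) : R :=
  dotv (W x) (u.2 x).

Definition tuple_apply (K : 'I_N -> 'rV[R]_n -> R)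
    (W : 'I_N -> 'rV[R]_n -> 'rV[R]_n) (u : fpair) (x : 'rV[R]_n) : R :=
  \sum_i K i x * vf_apply (W i) u x.

(* G S (uv), with W(uv) = u W v + v W u for each vector field W of S *)
Definition GS_product (u v : fpair) (x : 'rV[R]_n) : R :=
  \sum_i coefG X i x *
    (u.1 x * vf_apply (coefS X i) v x + v.1 x * vf_apply (coefS X i) u x).

Definition form_integrand (u v : fpair) (x : 'rV[R]_n) : R :=
  dotv (v.2 x) (mxact (coefP X x) (u.2 x)) +
  v.1 x * tuple_apply (coefH X) (coefR X) u x +
  u.1 x * tuple_apply (coefG X) (coefS X) v x +
  coefF X x * u.1 x * v.1 x.

Definition bilinear_form (u v : fpair) : \bar R :=
  (\int[lebesgue_rV]_(x in Theta) (form_integrand u v x)%:E)%E.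

Definition negativity_condition :=
  forall u v : fpair, QH1_0 Q Theta u -> QH1_0 Q Theta v ->
    (\forall x \ae lebesgue_rV, Theta x -> 0 <= u.1 x * v.1 x) ->
    (0 <= \int[lebesgue_rV]_(x in Theta)
            (coefF X x * u.1 x * v.1 x + GS_product u v x)%:E)%E.

(* The integrability clause states that the form is defined at (u, v): for a
   general u in QH^1 the term u G S v need not be integrable. *)
Definition weak_subsolution (u : fpair) :=
  QH1 Q Theta u /\
  forall v : fpair, QH1_0 Q Theta v ->
    (\forall x \ae lebesgue_rV, Theta x -> 0 <= v.1 x) ->
    lebesgue_rV.-integrable Theta (EFin \o form_integrand u v) /\
    (bilinear_form u v <= 0)%E.

End operators.

(* Main.v *)
Require Import Defs.
From HB Require Import structures.
From mathcomp Require Import all_boot all_order all_algebra.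
From mathcomp Require Import all_classical all_reals all_analysis.
From mathcomp Require Import measurable_realfun ess_sup_inf spectral complex.
From mathcomp Require Import ring lra.

Set Implicit Arguments.
Unset Strict Implicit.
Unset Printing Implicit Defensive.

Import Order.TTheory GRing.Theory Num.Theory.
Import numFieldNormedType.Exports.

Local Open Scope classical_set_scope.
Local Open Scope ring_scope.

(** Why the maximum principle holds. For a level [k] let [v = (u - k)^+], with
gradient that of [u] where [u > k] and [0] elsewhere; this pair is
[truncate k u]. If [k >= 0] bounds [u^+] on the boundary, then [v] belongs to
[QH^1_0] and is a legitimate test function. As [u = v + k] where [v > 0],
testing the inequality [X u <= 0] with [v] gives
  [\int <Dv, P Dv> + v (H R v - G S v)]
    [+ \int (F v^2 + 2 v G S v) + k \int (F v + G S v) <= 0].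
The second integral is nonnegative by the negativity condition for the pair
[(v, v)]. So is the third one: apply the condition to [v] and to a
regularization of the indicator of [v > 0], and let the regularization tend to
that indicator ([negativity_cone]). With [w] the length of [sqrt Q Dv] and
[b] the sum of the absolute values of the coefficients [G], [H], subunitarity
leaves [c1 \int w^2 <= \int 2 b v w], hence ([energy_estimate])
  [\int w^2 <= C \int_(w <> 0) b^2 v^2].
By the inequalities of Hoelder and Sobolev the right-hand side is at most
[C' a^(1/sigma') \int w^2], where [a] is the integral of [b^(2 sigma')] over
the set where [u > k] and [w <> 0]. If [a] is small, then [w = 0], and Sobolev
once more gives [v = 0], that is [u <= k] ([small_activity_ae_le]).

Let now [k0 >= 0] be a level that bounds [u^+] on the boundary, suppose that
[u <= k0] fails, and let [M] be the infimum of the levels [k >= k0] with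
[u <= k]. When [k < M] increases to [M], the integral [a] tends to the integral
over the set where [u >= M] and [w <> 0]. This set is empty if [M] is infinite.
It is null if [M] is finite, for then [v <= M - k] and the energy estimate
bounds [\int w^2] by a multiple of [(M - k)^2] ([slope_eq0_at_max]). So [a] is
small for some [k < M], and [u <= k] contradicts the choice of [M]
([ae_le_boundary_level]).

A level [k < 0] never bounds [u^+] on the boundary: otherwise [QH^1_0] would
contain an element that is at least [- k], hence also its composition with a
function equal to [0] at [0] and to [1] beyond [- k], which has value [1] and
zero gradient, against the Sobolev inequality ([completion_value_lt]).

The argument composes elements of [QH^1_0] with functions of one variable.
These are affine images of a single function with Lipschitz derivative, and
for such an [h] the difference quotients of [h \o f] and of [h' (f x) * f]
have the same limits, so that [grad (h \o f) = h' (f x) *: grad f] at every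
point, including those where the partial derivatives do not exist
([derive_comp_C11]). Energies that involve gradients of approximants, with their
default values where there is no derivative, are estimated as lower integrals,
so that the measurability of these gradients is not an issue
([lower_integral_le_add]). Truncations are limits of such compositions
([completion_truncate]).

The energy argument is carried out on a measure space, for the completion of a
class of pairs that is stable under these compositions and satisfies a Sobolev
inequality. *)

(** * Nonnegative matrices have square roots *)

Lemma dotv_mxact {R : realType} {n} (A : 'M[R]_n) (x y : 'rV[R]_n) :
  dotv x (mxact A y) = (x *m A *m y^T) 0 0.
Proof. by rewrite /dotv /mxact trmx_mul trmxK mulmxA. Qed.

Lemma dotvv_ge0 {R : realType} {n} (x : 'rV[R]_n) : 0 <= dotv x x.
Proof. by rewrite /dotv mxE sumr_ge0// => i _; rewrite mxE -expr2 sqr_ge0. Qed.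

Lemma dotvv_gt0 {R : realType} {n} (x : 'rV[R]_n) : x != 0 -> 0 < dotv x x.
Proof.
move=> x0; rewrite lt_neqAle dotvv_ge0 andbT eq_sym; apply: contra x0.
rewrite /dotv mxE psumr_eq0 => [|i _]; last by rewrite mxE -expr2 sqr_ge0.
move=> /allP x0; apply/eqP/rowP => i; rewrite mxE.
by have := x0 i (mem_index_enum i); rewrite mxE -expr2 sqrf_eq0 => /eqP.
Qed.

Lemma exists_poly_interpolation {R : fieldType} (f : R -> R) (s : seq R) :
  exists p : {poly R}, forall x, x \in s -> p.[x] = f x.
Proof.
elim: s => [|y s [p ps]]; first by exists 0.
have [ys|ys] := boolP (y \in s).
  by exists p => x; rewrite inE => /orP[/eqP ->|]; exact: ps.
pose w := \prod_(z <- s) ('X - z%:P).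
exists (p + ((f y - p.[y]) / w.[y]) *: w) => x.
rewrite inE hornerD hornerZ => /orP[/eqP ->|xs].
  rewrite divfK; first by rewrite subrKC.
  by rewrite -/(root w y) root_prod_XsubC.
have : root w x by rewrite root_prod_XsubC.
by rewrite /root => /eqP ->; rewrite mulr0 addr0 ps.
Qed.

Lemma horner_mx_sym {R : comNzRingType} {n} (A : 'M[R]_n.+1) (p : {poly R}) :
  A^T = A -> (horner_mx A p)^T = horner_mx A p.
Proof.
move=> sA; elim/poly_ind: p => [|p c IH]; first by rewrite rmorph0 trmx0.
rewrite !rmorphD !rmorphM /= horner_mx_X horner_mx_C.
rewrite linearD /= tr_scalar_mx; congr (_ + _).
rewrite -[_ * A]/(_ *m A) trmx_mul IH sA.
by have /(congr1 (horner_mx A)) := mulrC p 'X;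
  rewrite !rmorphM /= horner_mx_X -!mulmxE => ->.
Qed.

Local Notation Rc := (real_complex _).

(** The complexified matrix is Hermitian, so the spectral theorem applies. Its
    eigenvalues are real, hence roots of the real characteristic polynomial;
    each of them then has a real eigenvector, on which the form is
    nonnegative. *)
Lemma nonneg_mx_diagonalizable {R : realType} {n} (A : 'M[R]_n.+1) :
  mx_nonneg A -> exists (P : 'M[R[i]]_n.+1) (e : 'rV[R]_n.+1),
  [/\ P \is a GRing.unit, forall i, 0 <= e 0 i &
  map_mx Rc A = invmx P *m diag_mx (map_mx Rc e) *m P].
Proof.
move=> [sA pA]; set A' := map_mx _ A.
have hA' : A' \is hermsymmx.
  apply: realsym_hermsym.
    by apply/is_hermitianmxP; rewrite scale1r map_mx_id// map_trmx sA.
  apply/mxOverP => i j; rewrite mxE complex_real//.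
have [P [d [Pu dr dA]]] : exists (P : 'M[R[i]]_n.+1) (d : 'rV[R[i]]_n.+1),
    [/\ P \is a GRing.unit, d \is a mxOver Num.real &
    A' = invmx P *m diag_mx d *m P].
  exists (spectralmx A'), (spectral_diag A'); split.
  - exact: spectral_unit.
  - exact: hermitian_spectral_diag_real.
  - by apply/orthomx_spectralP; exact: hermitian_normalmx.
pose e : 'rV[R]_n.+1 := \row_i complex.Re (d 0 i).
have de : d = map_mx Rc e.
  apply/rowP => i; rewrite !mxE; have /mxOverP/(_ 0 i) := dr.
  by move=> /complex_realP[x ->].
exists P, e; split; [exact: Pu|move=> i|by rewrite -de].
have : eigenvalue A' (Rc (e 0 i)).
  apply/eigenvalueP; exists (row i P); last first.
    apply/negP => /eqP r0.
    have /(congr1 (row i)) := mulmxV (Pu : P \in unitmx).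
    rewrite row_mul r0 mul0mx => /rowP/(_ i); rewrite !mxE eqxx => /eqP.
    by rewrite eq_sym oner_eq0.
  rewrite -row_mul dA !mulmxA mulmxV// mul1mx row_mul row_diag_mx.
  by rewrite -scalemxAl -rowE; congr (_ *: _); rewrite de mxE.
rewrite eigenvalue_root_char -map_char_poly fmorph_root -eigenvalue_root_char.
move=> /eigenvalueP[x xA x0]; have := pA x.
rewrite dotv_mxact xA -scalemxAl mxE -/(dotv x x).
by rewrite pmulr_lge0// dotvv_gt0.
Qed.

(** The root is real although the diagonalization is complex, because it is a
    polynomial in [A]. Interpolating the fourth root on the spectrum makes it
    the square of a symmetric matrix, hence nonnegative. *)
Lemma nonneg_mx_sqrt_exists {R : realType} {n} (A : 'M[R]_n.+1) :
  mx_nonneg A -> exists S : 'M[R]_n.+1, mx_nonneg S /\ S *m S = A.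
Proof.
move=> nA; have [sA pA] := nA.
have [P [e [Pu e0 dA]]] := nonneg_mx_diagonalizable nA.
have [p pe] := exists_poly_interpolation (fun x => Num.sqrt (Num.sqrt x))
  [seq e 0 i | i <- enum 'I_n.+1].
pose T := horner_mx A p; have sT : T^T = T by exact: horner_mx_sym.
exists (T *m T); split.
  split=> [|x]; first by rewrite trmx_mul sT.
  rewrite dotv_mxact mulmxA -(mulmxA (x *m T)) -{2}sT -trmx_mul.
  exact: dotvv_ge0.
have -> : T *m T *m (T *m T) = horner_mx A (p ^+ 4).
  by rewrite rmorphXn /= -/T !exprS expr0 mulr1 -!mulmxE !mulmxA.
apply: (@map_mx_inj _ _ Rc); rewrite map_horner_mx /= dA.
rewrite horner_mx_uconjC; last exact: Pu.
congr (_ *m _ *m _); rewrite horner_mx_diag; congr diag_mx.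
apply/rowP => i; rewrite !mxE horner_map /=; congr (Rc _).
rewrite horner_exp pe; last by apply: map_f; rewrite mem_enum.
by rewrite (exprM _ 2 2) !sqr_sqrtr// sqrtr_ge0.
Qed.

Definition sqrt_norm {R : realType} {n} (A : 'M[R]_n) (xi : 'rV[R]_n) : R :=
  enorm (mxact (mx_sqrt A) xi).

Section sqrt_norm.
Context {R : realType} {n : nat}.
Implicit Types (A : 'M[R]_n) (x y : 'rV[R]_n).

Lemma dotvDl x y z : dotv (x + y) z = dotv x z + dotv y z.
Proof. by rewrite /dotv mulmxDl mxE. Qed.

Lemma dotvC x y : dotv x y = dotv y x.
Proof. by rewrite /dotv -{1}(trmxK x) -trmx_mul mxE. Qed.

Lemma dotvZl a x y : dotv (a *: x) y = a * dotv x y.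
Proof. by rewrite /dotv -scalemxAl mxE. Qed.

Lemma dotvDr x y z : dotv z (x + y) = dotv z x + dotv z y.
Proof. by rewrite !(dotvC z) dotvDl. Qed.

Lemma dotvZr a x y : dotv x (a *: y) = a * dotv x y.
Proof. by rewrite !(dotvC x) dotvZl. Qed.

Lemma mxactD A x y : mxact A (x + y) = mxact A x + mxact A y.
Proof. exact: mulmxDl. Qed.

Lemma mxactZ A a x : mxact A (a *: x) = a *: mxact A x.
Proof. by rewrite /mxact -scalemxAl. Qed.

Lemma sqrt_norm_ge0 A x : 0 <= sqrt_norm A x.
Proof. exact: sqrtr_ge0. Qed.

Lemma sqr_sqrt_normE A x :
  sqrt_norm A x ^+ 2 = dotv (mxact (mx_sqrt A) x) (mxact (mx_sqrt A) x).
Proof. by rewrite sqr_sqrtr// dotvv_ge0. Qed.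

Lemma sqr_sqrt_normZ A a x :
  sqrt_norm A (a *: x) ^+ 2 = a ^+ 2 * sqrt_norm A x ^+ 2.
Proof. by rewrite !sqr_sqrt_normE mxactZ dotvZl dotvZr; ring. Qed.

Lemma sqr_sqrt_normD A x y (e : R) : 0 < e ->
  sqrt_norm A (x + y) ^+ 2 <=
  (1 + e) * sqrt_norm A x ^+ 2 + (1 + e^-1) * sqrt_norm A y ^+ 2.
Proof.
move=> e0; rewrite !sqr_sqrt_normE mxactD; set a := mxact _ x; set b := mxact _ y.
have : 0 <= e^-1 * dotv (e *: a - b) (e *: a - b).
  by apply: mulr_ge0 (dotvv_ge0 _); rewrite invr_ge0 ltW.
rewrite -(scaleN1r b) !(dotvDl, dotvDr, dotvZl, dotvZr) (dotvC b a).
have -> : e^-1 * (e * (e * dotv a a + -1 * dotv a b) +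
    (e * (-1 * dotv a b) + -1 * (-1 * dotv b b))) =
    e * dotv a a - 2 * dotv a b + e^-1 * dotv b b by field; rewrite gt_eqF.
by lra.
Qed.
End sqrt_norm.

Lemma sqr_sqrt_norm {R : realType} {n} (A : 'M[R]_n) (x : 'rV[R]_n) :
  mx_nonneg A -> sqrt_norm A x ^+ 2 = dotv x (mxact A x).
Proof.
(* square matrices form a ring only in positive dimension *)
case: n A x => [|n] A x nA.
  by rewrite sqr_sqrt_normE /dotv !mxE !big_ord0.
have [[sS _] SS] : [set S | mx_nonneg S /\ S *m S = A] (mx_sqrt A).
  by apply: getPex; exact: nonneg_mx_sqrt_exists.
by rewrite sqr_sqrt_normE !dotv_mxact /mxact sS -(mulmxA x) SS.
Qed.

(** * Lebesgue measure of open and of bounded sets *)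

(** The outer measure of row vectors is that of tuples read through a
    bijection, so the Caratheodory criterion can be transported. *)
Lemma measurable_rV {R : realType} {n} (A : set 'rV[R]_n) :
  measurable [set t : n.-tuple (measurableTypeR R) | A (\row_i tnth t i)] ->
  measurable A.
Proof.
move=> mA.
suff : (@lebesgue_outer R n).-cara.-measurable A by [].
move=> X.
exact: (caratheodory_measurable_mu_ext (lebesgue_tuple R n) mA
  [set t : n.-tuple (measurableTypeR R) | X (\row_i tnth t i)]).
Qed.

Lemma measurable_box {R : realType} {n} (A : 'I_n -> set (measurableTypeR R)) :
  (forall i, measurable (A i)) ->
  measurable [set x : 'rV[R]_n | forall i, A i (x 0 i)].
Proof.
move=> mA; apply: measurable_rV.
rewrite [X in measurable X](_ : _ = \bigcap_(i in [set: 'I_n])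
    ((fun t : n.-tuple (measurableTypeR R) => tnth t i) @^-1` A i)).
  apply: fin_bigcap_measurable => // i _.
  by rewrite -[X in measurable X]setTI; exact: measurable_tnth.
apply/seteqP; split => t /= At i; last by have := At i I; rewrite mxE.
by move=> _; have := At i; rewrite mxE.
Qed.

(** An open set is the union of the rational cubes that it contains, and there
    are countably many of them. *)
Lemma measurable_open_rV {R : realType} {n} (U : set 'rV[R]_n) :
  open U -> measurable U.
Proof.
move=> oU.
pose box (p : 'rV[rat]_n * nat) : set 'rV[R]_n := [set y | forall i,
  `]ratr (p.1 0 i) - p.2.+1%:R^-1, ratr (p.1 0 i) + p.2.+1%:R^-1[%classic
  (y 0 i)].
rewrite (_ : U = \bigcup_p (if `[< box p `<=` U >] then box p else set0)).
  apply: countable_bigcupT_measurable => [|p]; first exact: countableP.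
  case: asboolP => // _; apply: (@measurable_box _ _ (fun i =>
    `]ratr (p.1 0 i) - p.2.+1%:R^-1, ratr (p.1 0 i) + p.2.+1%:R^-1[%classic)).
  by move=> i; exact: measurable_itv.
apply/seteqP; split => [x Ux|x [p _]]; last by case: asboolP => //; apply.
have /nbhs_ballP[e /= e0 xU] := open_nbhs_nbhs (conj oU Ux).
have [k _ ke] : exists2 k, True & (k.+1%:R^-1 < e / 2).
  have := near_infty_natSinv_lt (PosNum (divr_gt0 e0 (ltr0Sn R 1))).
  by move=> [k _ /(_ k (leqnn k))]; exists k.
have xq i : exists q : rat, x 0 i - k.+1%:R^-1 < ratr q < x 0 i + k.+1%:R^-1.
  have [|q] := @rat_in_itvoo R (x 0 i - k.+1%:R^-1) (x 0 i + k.+1%:R^-1).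
    by rewrite ltrD2l gt0_cp// invr_gt0.
  by rewrite in_itv/= => ?; exists q.
have /choice[q qx] := xq.
exists (\row_i q i, k) => //; case: asboolP => [_ i|].
  rewrite /= mxE in_itv/=; move: (qx i); set d := _^-1 => /andP[? ?].
  by apply/andP; split; lra.
case=> y yq; apply: xU; split=> // j i; rewrite ord1 => {j}.
rewrite /ball/= ltr_norml; move: (yq i) (qx i); rewrite /= !mxE in_itv/=.
move: ke; set d := _^-1 => ? /andP[? ?] /andP[? ?].
by apply/andP; split; lra.
Qed.

Lemma lebesgue_rV_cube {R : realType} {n} (c : 'rV[R]_n) (r : R) : 0 < r ->
  lebesgue_rV [set x : 'rV[R]_n |
    forall i, `[c 0 i - r, c 0 i + r]%classic (x 0 i)] = ((2 * r) ^+ n)%:E.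
Proof.
move=> r0; rewrite (@lebesgue_rV_box _ _
  (fun i => `[c 0 i - r, c 0 i + r]%classic))//.
under eq_bigr => i _.
  rewrite lebesgue_measure_itv/= ifT; last by rewrite lte_fin; lra.
  rewrite -EFinD (_ : _ - _ = 2 * r); last by ring.
  over.
by rewrite prodEFin prodr_const card_ord.
Qed.

Lemma measurable_cube {R : realType} {n} (c : 'rV[R]_n) (r : R) :
  measurable [set x : 'rV[R]_n |
    forall i, `[c 0 i - r, c 0 i + r]%classic (x 0 i)].
Proof.
by apply: (@measurable_box _ _ (fun i => `[c 0 i - r, c 0 i + r]%classic)).
Qed.

Lemma lebesgue_rV_bounded {R : realType} {n} (A : set 'rV[R]_n) :
  bounded_set A -> measurable A -> (lebesgue_rV A < +oo)%E.
Proof.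
move=> [M [_ /(_ (`|M| + 1))]] AM mA.
have {}AM : globally A [set x | `|x| <= `|M| + 1].
  by apply: AM; rewrite (le_lt_trans (ler_norm _))// ltrDl.
set r : R := `|M| + 1 in AM.
have r0 : 0 < r by rewrite ltr_wpDl.
apply: le_lt_trans (ltry ((2 * r) ^+ n)); rewrite -(lebesgue_rV_cube 0 r0).
apply: le_measure; rewrite ?inE//; first exact: measurable_cube.
move=> x /AM /= xr i; rewrite /= in_itv/= mxE !add0r -ler_norml.
apply: le_trans xr; rewrite [leRHS]mx_normrE.
exact: (@le_bigmax _ _ _ _ (fun p => `|x p.1 p.2|) (0, i)).
Qed.

Lemma lebesgue_rV_open_gt0 {R : realType} {n} (A : set 'rV[R]_n) :
  open A -> A !=set0 -> (0 < lebesgue_rV A)%E.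
Proof.
move=> oA [x Ax].
have /nbhs_ballP[e /= e0 xA] := open_nbhs_nbhs (conj oA Ax).
have e20 : 0 < e / 2 by rewrite divr_gt0.
apply: (@lt_le_trans _ _ ((2 * (e / 2)) ^+ n)%:E).
  by rewrite lte_fin exprn_gt0// mulr_gt0.
rewrite -(lebesgue_rV_cube x e20).
apply: le_measure; rewrite ?inE//.
- exact: measurable_cube.
- exact: measurable_open_rV.
- move=> y By; apply: xA; split=> // j i; rewrite ord1 => {j}.
  rewrite /ball/= ltr_norml; have := By i; rewrite /= in_itv/= => /andP[? ?].
  by apply/andP; split; lra.
Qed.

Lemma lipschitz_inP {R : realType} {V : normedModType R} (D : set V) (f : V -> R) :
  [lipschitz f x | x in D] <->
  exists2 M : R, 0 < M & forall x y, D x -> D y -> `|f x - f y| <= M * `|x - y|.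
Proof.
split=> [[M [_ MD]]|[M M0 MD]].
  exists (`|M| + 1); first by rewrite ltr_wpDl.
  move=> x y Dx Dy; apply: (MD (`|M| + 1) _ (x, y)) => //.
  by rewrite (le_lt_trans (ler_norm _))// ltrDl.
exists M; split; first by rewrite num_real.
move=> N MN [x y] [/= Dx Dy]; apply: le_trans (MD _ _ Dx Dy) _.
by rewrite ler_wpM2r// ltW.
Qed.

Lemma open_lipschitz_gt {R : realType} {V : normedModType R} (D : set V)
    (f : V -> R) (a : R) :
  open D -> [lipschitz f x | x in D] -> open (D `&` f @^-1` `]a, +oo[).
Proof.
move=> oD /lipschitz_inP[M M0 fM]; rewrite openE => x [Dx /=].
rewrite in_itv/= andbT => ax.
have fx0 : 0 < (f x - a) / M by rewrite divr_gt0// subr_gt0.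
near=> y; have Dy : D y by near: y; exact: open_nbhs_nbhs.
split=> //=; rewrite in_itv/= andbT.
have : `|x - y| < (f x - a) / M.
  by near: y; apply/nbhs_normP; exists ((f x - a) / M).
rewrite ltr_pdivlMr// mulrC => xy; have := fM _ _ Dx Dy.
by have := ler_norm (f x - f y); lra.
Unshelve. all: by end_near. Qed.

Lemma measurable_lipschitz {R : realType} {n} (D : set 'rV[R]_n)
    (f : 'rV[R]_n -> R) :
  open D -> [lipschitz f x | x in D] -> measurable_fun D f.
Proof.
move=> oD fL mD.
apply: (measurability _ (RGenOInfty.measurableE R)) => // _ [_ [a ->] <-].
by apply: measurable_open_rV; exact: open_lipschitz_gt.
Qed.

(** * The chain rule for functions with Lipschitz derivative *)

(** Functions of one variable that act on Sobolev pairs. The Taylor estimate is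
    what makes the chain rule hold even at points where the inner function has
    no derivative. *)
Record C11_bounded {R : realType} (h h' : R -> R) (L K : R) : Prop := C11Bounded {
  C11_ge0 : 0 <= K;
  C11_lip : forall s t, `|h s - h t| <= L * `|s - t|;
  C11_bound : forall s, `|h' s| <= L;
  C11_lip' : forall s t, `|h' s - h' t| <= K * `|s - t|;
  C11_taylor : forall s t, `|h t - h s - h' s * (t - s)| <= K * (t - s) ^+ 2 }.

Lemma near0_shift {R : realType} {V : normedModType R} (D : set V) (x v : V) :
  open D -> D x -> exists2 k : R, 0 < k & forall t : R, `|t| < k -> D (t *: v + x).
Proof.
move=> oD Dx; have /nbhs_ballP[e /= e0 xD] := open_nbhs_nbhs (conj oD Dx).
exists (e / (`|v| + 1)) => [|t]; first by rewrite divr_gt0// ltr_wpDl.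
rewrite ltr_pdivlMr ?ltr_wpDl// => te; apply: xD; rewrite -ball_normE /=.
rewrite opprD addrCA subrr addr0 normrN normrZ; apply: le_lt_trans te.
by rewrite ler_wpM2l// lerDl.
Qed.

(** By the Taylor estimate and the Lipschitz bound on [f], the difference
    quotients [p] of [h \o f] and [q] of [f] satisfy [p t - h' (f x) * q t =
    O(t)]. So they converge together when [h' (f x) != 0], and [p] tends to [0]
    when [h' (f x) = 0]; a limit that does not exist has the default value [0]
    on both sides. *)
Lemma derive_comp_C11 {R : realType} {V : normedModType R} (D : set V)
    (f : V -> R) (x v : V) (h h' : R -> R) (L K : R) :
  C11_bounded h h' L K -> open D -> D x -> [lipschitz f y | y in D] ->
  'D_v (h \o f) x = h' (f x) * 'D_v f x.
Proof.
move=> hC oD Dx /lipschitz_inP[M M0 fM].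
have [k k0 kD] := near0_shift v oD Dx.
set a := h' (f x).
pose q (t : R) : R := t^-1 * (f (t *: v + x) - f x).
pose p (t : R) : R := t^-1 * (h (f (t *: v + x)) - h (f x)).
have qp : p t - a * q t @[t --> 0^'] --> (0 : R).
  apply: (@cvg_to_0_linear _ _ (K * (M * `|v|) ^+ 2) k) => // t /andP[t0 tk].
  have -> : p t - a * q t = t^-1 *
      (h (f (t *: v + x)) - h (f x) - a * (f (t *: v + x) - f x)).
    by rewrite /p /q; ring.
  rewrite normrM normfV ler_pdivrMl//.
  apply: le_trans (C11_taylor hC _ _) _.
  have -> : `|t| * (K * (M * `|v|) ^+ 2 * `|t|) = K * (M * (`|t| * `|v|)) ^+ 2.
    by ring.
  apply: ler_wpM2l; first exact: (C11_ge0 hC).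
  rewrite -real_normK ?num_real// ler_pXn2r ?nnegrE//.
    by have := fM _ _ (kD _ tk) Dx; rewrite addrK normrZ.
  by rewrite mulr_ge0// ?ltW// mulr_ge0.
have qE : 'D_v f x = lim (q t @[t --> 0^']) by [].
have pE : 'D_v (h \o f) x = lim (p t @[t --> 0^']) by [].
have [/cvg_ex[l ql]|nq] := pselect (cvg (q t @[t --> 0^'])).
  rewrite pE qE (cvg_lim _ ql)//; apply: cvg_lim => //.
  have -> : p = (fun t => (p t - a * q t) + a * q t).
    by apply/funext => t; rewrite subrK.
  rewrite -[X in _ --> X]add0r; apply: cvgD => //; exact: cvgMr.
have q0 : 'D_v f x = 0 by rewrite qE dvgP.
rewrite q0 mulr0 pE; have [a0|a0] := eqVneq a 0.
  apply: cvg_lim => //.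
  by under eq_fun => t do rewrite -[p t]subr0 -(mul0r (q t)) -a0.
apply: dvgP => /cvg_ex[l pl]; apply: nq; apply/cvg_ex; exists (a^-1 * (l - 0)).
have -> : q = (fun t => a^-1 * (p t - (p t - a * q t))).
  by apply/funext => t; rewrite subKr mulKf.
by apply: cvgMr; exact: cvgB.
Qed.

Lemma grad_comp_C11 {R : realType} {n} (D : set 'rV[R]_n)
    (f : 'rV[R]_n -> R) (x : 'rV[R]_n) (h h' : R -> R) (L K : R) :
  C11_bounded h h' L K -> open D -> D x -> [lipschitz f y | y in D] ->
  grad (h \o f) x = h' (f x) *: grad f x.
Proof.
move=> hC oD Dx fL; apply/rowP => i; rewrite !mxE.
exact: (derive_comp_C11 _ hC oD).
Qed.

(** The condition [h 0 = 0] keeps the support from growing. *)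
Lemma Lip_0_comp_C11 {R : realType} {n} (D : set 'rV[R]_n)
    (f : 'rV[R]_n -> R) (h h' : R -> R) (L K : R) :
  C11_bounded h h' L K -> h 0 = 0 -> Lip_0 D f -> Lip_0 D (h \o f).
Proof.
move=> hC h0 [fL cf fD].
have sub : closure [set x | D x /\ (h \o f) x != 0] `<=`
           closure [set x | D x /\ f x != 0].
  apply: closure_subset => x [Dx /= hf]; split=> //.
  by apply: contra_neq hf => ->.
split.
- have /lipschitz_inP[M M0 fM] := fL.
  apply/lipschitz_inP; exists ((L + 1) * M).
    rewrite mulr_gt0// ltr_wpDl//.
    exact: le_trans (normr_ge0 _) (C11_bound hC 0).
  move=> x y Dx Dy /=; apply: le_trans (C11_lip hC _ _) _.
  have L0 : 0 <= L by exact: le_trans (normr_ge0 _) (C11_bound hC 0).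
  rewrite -mulrA; apply: ler_pM => //; first by rewrite lerDl.
  exact: fM.
- by apply: subclosed_compact cf sub; exact: closed_closure.
- exact: subset_trans sub fD.
Qed.

Lemma C11_affine {R : realType} (h h' : R -> R) (L K k a b c : R) :
  C11_bounded h h' L K ->
  C11_bounded (fun s => k * h (a * s + b) + c) (fun s => k * a * h' (a * s + b))
    (`|k * a| * L) (`|k| * a ^+ 2 * K).
Proof.
move=> hC; have K0 := C11_ge0 hC; have L0 := le_trans (normr_ge0 _) (C11_bound hC 0).
have sub s t : a * s + b - (a * t + b) = a * (s - t) by ring.
split=> [|s t|s|s t|s t].
- by apply: mulr_ge0 K0; apply: mulr_ge0 (sqr_ge0 a).
- rewrite (_ : _ - _ = k * (h (a * s + b) - h (a * t + b))); last by ring.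
  rewrite !normrM -mulrA -mulrA; apply: ler_wpM2l => //.
  by apply: le_trans (C11_lip hC _ _) _; rewrite sub normrM mulrCA.
- by rewrite normrM ler_wpM2l//; exact: C11_bound hC _.
- rewrite -mulrBr !normrM -(real_normK (num_real a)) expr2 -!mulrA.
  apply: ler_wpM2l => //.
  apply: ler_wpM2l => //; apply: le_trans (C11_lip' hC _ _) _.
  by rewrite sub normrM mulrCA.
- have -> : k * h (a * t + b) + c - (k * h (a * s + b) + c) -
      k * a * h' (a * s + b) * (t - s) = k * (h (a * t + b) - h (a * s + b) -
      h' (a * s + b) * ((a * t + b) - (a * s + b))) by ring.
  rewrite normrM -!mulrA; apply: ler_wpM2l => //.
  apply: le_trans (C11_taylor hC _ _) _.
  by rewrite sub exprMn expr2 mulrCA -!mulrA.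
Qed.

Lemma ler_sqr_norm {R : realType} (a b : R) : `|a| <= b -> a ^+ 2 <= b ^+ 2.
Proof.
move=> ab; rewrite -real_normK ?num_real// ler_pXn2r ?nnegrE//.
exact: le_trans ab.
Qed.

Lemma sqr_C11_le {R : realType} (h h' : R -> R) (L K s : R) : C11_bounded h h' L K -> h 0 = 0 ->
  h s ^+ 2 <= L ^+ 2 * s ^+ 2.
Proof.
move=> hC h0; have L0 : 0 <= L := le_trans (normr_ge0 _) (C11_bound hC 0).
rewrite -exprMn -(real_normK (num_real (L * s))) normrM (ger0_norm L0).
by apply: ler_sqr_norm; have := C11_lip hC s 0; rewrite h0 !subr0.
Qed.

(** The antiderivative of the projection onto [[0, 1]]: a smoothing of the
    positive part whose derivative is Lipschitz. The functions used to
    truncate and to approximate indicators are affine images of it. *)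
Definition ramp {R : realType} (s : R) : R :=
  if s <= 0 then 0 else if s <= 1 then s ^+ 2 / 2 else s - 2^-1.

Definition ramp' {R : realType} (s : R) : R :=
  if s <= 0 then 0 else if s <= 1 then s else 1.

Lemma C11_ramp {R : realType} : C11_bounded (@ramp R) ramp' 1 1.
Proof.
have nle (a b : R) : - b <= a -> a <= b -> `|a| <= b.
  by move=> ? ?; rewrite ler_norml; apply/andP.
split=> // [s t|s|s t|s t].
- wlog st : s t / s <= t.
    move=> H; have [/H//|/ltW/H] := leP s t.
    by rewrite distrC [X in _ -> _ <= _ * X]distrC.
  rewrite mul1r [X in _ <= X]ler0_norm ?subr_le0//.
  by rewrite /ramp; case: (leP s 0) => ?; [|case: (leP s 1) => ?];
    (case: (leP t 0) => ?; [|case: (leP t 1) => ?]); apply: nle; nra.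
- by rewrite /ramp'; case: (leP s 0) => ?; [|case: (leP s 1) => ?]; apply: nle; lra.
- wlog st : s t / s <= t.
    move=> H; have [/H//|/ltW/H] := leP s t.
    by rewrite distrC [X in _ -> _ <= _ * X]distrC.
  rewrite mul1r [X in _ <= X]ler0_norm ?subr_le0//.
  by rewrite /ramp'; case: (leP s 0) => ?; [|case: (leP s 1) => ?];
    (case: (leP t 0) => ?; [|case: (leP t 1) => ?]); apply: nle; lra.
- have t1 := sqr_ge0 (t - 1); have ts := sqr_ge0 (t - s).
  have s2 := sqr_ge0 s; have t2 := sqr_ge0 t.
  rewrite /ramp /ramp'; case: (leP s 0) => s0; [|case: (leP s 1) => s1];
    (case: (leP t 0) => t0; [|case: (leP t 1) => t3]); apply: nle; nra.
Qed.

Lemma ramp_close {R : realType} (s : R) :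
  0 <= Num.max s 0 - ramp s <= 1 /\ ramp s <= Num.max s 0 /\ 0 <= ramp s.
Proof.
have [s0|s0] := leP s 0; rewrite /ramp ?s0 ?(ltNge, s0)/=.
  by rewrite subrr lexx ler01.
have [s1|s1] := leP s 1; rewrite ?s1 ?(ltNge, s1)/= ?(leNgt s 0) ?s0/= ?s1.
  by split; [apply/andP|]; split; nra.
by split; [apply/andP|]; split; lra.
Qed.

Lemma scaled_ramp_close {R : realType} (N r : R) : 0 < N ->
  0 <= Num.max r 0 - N^-1 * ramp (N * r) <= N^-1 /\ 0 <= N^-1 * ramp (N * r).
Proof.
move=> N0; have [/andP[ge0 le1] [_ r0]] := ramp_close (N * r).
have E : Num.max r 0 = N^-1 * Num.max (N * r) 0.
  by rewrite -{2}(mulr0 N) -maxr_pMr ?ltW// mulKf ?gt_eqF.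
have V0 : 0 <= N^-1 by rewrite invr_ge0 ltW.
rewrite E -mulrBr; split; last exact: mulr_ge0.
by rewrite mulr_ge0//= -[leRHS]mulr1 ler_wpM2l.
Qed.

Lemma ramp'_01 {R : realType} (s : R) : 0 <= ramp' s <= 1.
Proof.
rewrite /ramp'; case: (leP s 0) => ?; [|case: (leP s 1) => ?];
  by apply/andP; split; lra.
Qed.

Lemma ramp'_eq0 {R : realType} (s : R) : s <= 0 -> ramp' s = 0.
Proof. by rewrite /ramp' => ->. Qed.

Lemma ramp'_eq1 {R : realType} (s : R) : 1 <= s -> ramp' s = 1.
Proof.
rewrite /ramp' => s1; case: (leP s 0) => [?|_]; first lra.
by case: (leP s 1) => // ?; apply/eqP; rewrite eq_le s1 andbT.
Qed.

(** For [N > 0] this rises from [0] at [0] to [1] on [[N^-1, +oo[], so that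
    [plateau N] tends to the indicator of []0, +oo[] on nonnegative reals. *)
Definition plateau {R : realType} (N s : R) : R := -2 * ramp (- N * s + 1) + 1.

Definition plateau' {R : realType} (N s : R) : R := -2 * - N * ramp' (- N * s + 1).

Lemma C11_plateau {R : realType} (N : R) :
  C11_bounded (plateau N) (plateau' N) (`|-2 * - N| * 1) (`|-2| * (- N) ^+ 2 * 1).
Proof. exact: C11_affine C11_ramp. Qed.

Lemma plateau0 {R : realType} (N : R) : plateau N 0 = 0.
Proof.
rewrite /plateau mulr0 add0r /ramp leNgt ltr01/= lexx expr1n; lra.
Qed.

Lemma plateau_eq1 {R : realType} (N s : R) :
  1 <= N * s -> plateau N s = 1 /\ plateau' N s = 0.
Proof.
move=> Ns; have r0 : - N * s + 1 <= 0 by lra.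
by rewrite /plateau /plateau' /ramp ramp'_eq0// r0 !mulr0 add0r.
Qed.

(** Although [plateau' N] has size [N], the product with [s] stays bounded,
    because [plateau' N] lives where [s <= N^-1]. This gives the domination
    needed in the limit [N -> +oo]. *)
Lemma plateau_01 {R : realType} (N s : R) : 0 <= N * s ->
  0 <= plateau N s <= 1 /\ 0 <= s * plateau' N s <= 2.
Proof.
move=> Ns; have [/plateau_eq1[-> ->]|Ns1] := leP 1 (N * s).
  by rewrite mulr0 !lexx ler01 ler0n.
rewrite /plateau /plateau' /ramp /ramp'; set r := - N * s + 1.
case: (leP r 0) => [|_]; first by rewrite /r; lra.
case: (leP r 1) => [_|]; last by rewrite /r; lra.
rewrite /r; split; first by apply/andP; split; nra.
have -> : s * (-2 * - N * (- N * s + 1)) = 2 * (N * s) * (1 - N * s) by ring.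
by apply/andP; split; nra.
Qed.

(** * Real powers and extended reals *)

Lemma powRV {R : realType} (s p : R) : 0 < s -> s^-1 `^ p = (s `^ p)^-1.
Proof.
move=> s0; have sp0 : s `^ p != 0 by rewrite gt_eqF// powR_gt0.
apply: (mulIf sp0); rewrite -powRM ?invr_ge0 ?ltW//.
by rewrite !mulVf// ?gt_eqF// powR1.
Qed.

Lemma powRK {R : realType} (p s : R) : 0 < p -> 0 < s -> (s `^ p) `^ p^-1 = s.
Proof. by move=> p0 s0; rewrite -powRrM mulfV ?gt_eqF// powRr1// ltW. Qed.

Lemma le_1D_powR {R : realType} (a p : R) : 1 <= p -> 0 <= a -> a <= 1 + a `^ p.
Proof.
move=> p1 a0; have [a1|a1] := leP a 1.
  by rewrite (le_trans a1)// lerDl powR_ge0.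
by rewrite (le_trans (le1r_powR (ltW a1) p1))// lerDr.
Qed.

Lemma sqr_powR {R : realType} (a p : R) : (a ^+ 2) `^ p = `|a| `^ (2 * p).
Proof. by rewrite powRrM powR_mulrn// real_normK ?num_real. Qed.

Lemma powR_norm_cvg {R : realType} (a : nat -> R) (l p : R) : 0 < p ->
  a k @[k --> \oo] --> l -> `|a k| `^ p @[k --> \oo] --> `|l| `^ p.
Proof.
move=> p0 al; have {al} : `|a k| @[k --> \oo] --> `|l| by exact: cvg_norm.
have [->|l0] := eqVneq l 0.
  rewrite normr0 powR0 ?gt_eqF// => a0; apply/cvgrPdist_le => e e0.
  have e0' : 0 < e `^ p^-1 by rewrite powR_gt0.
  near=> k; rewrite sub0r normrN ger0_norm ?powR_ge0//.
  have ak : `|a k| <= e `^ p^-1.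
    near: k; have /cvgrPdist_le/(_ _ e0')[N _ NP] := a0.
    by exists N => // k /NP; rewrite sub0r normrN normr_id.
  have -> : e = (e `^ p^-1) `^ p by rewrite -powRrM mulVf ?gt_eqF// powRr1// ltW.
  by apply: ge0_ler_powR; rewrite ?nnegrE ?powR_ge0// ltW.
move=> a_l; have L0 : 0 < `|l| by rewrite normr_gt0.
rewrite [X in _ --> X]/powR gt_eqF//.
apply: (@cvg_trans _ (expR (p * ln `|a k|) @[k --> \oo])).
  apply: near_eq_cvg; near=> k; rewrite /powR gt_eqF//.
  near: k; have /cvgrPdist_lt/(_ _ L0)[N _ NP] := a_l.
  exists N => // k /NP; rewrite ltr_norml; lra.
apply: continuous_cvg; first exact: continuous_expR.
apply: cvgMr; apply: continuous_cvg a_l; exact: continuous_ln.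
Unshelve. all: by end_near. Qed.

Lemma cvge_near_lt {R : realType} {T : Type} {F : set_system T} {FF : Filter F}
    (f : T -> \bar R) (l c : \bar R) :
  f x @[x --> F] --> l -> (l < c)%E -> \forall x \near F, (f x < c)%E.
Proof.
move=> fl lc; apply: (fl [set y | (y < c)%E]).
by apply: open_nbhs_nbhs; split=> //; exact: open_ereal_lt_ereal.
Qed.

(** The arithmetic by which two approximations compose: [a] and [b] are the
    parts of a squared distance, [a1], [b1] and [a2], [b2] those of the squared
    distances to and from an intermediate point. *)
Lemma ge0_adde_lt_le {R : realType} (a b a1 a2 b1 b2 : \bar R) (c e : R) :
  (0 < c)%R -> (0 <= a1 -> 0 <= a2 -> 0 <= b1 -> 0 <= b2 ->
   a <= c%:E * a1 + c%:E * a2 -> b <= c%:E * b1 + c%:E * b2 ->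
   a1 + b1 < (e / (2 * c))%:E -> a2 + b2 < (e / (2 * c))%:E -> a + b < e%:E)%E.
Proof.
move=> c0; case: a1 a2 b1 b2 => [a1||] [a2||] [b1||] [b2||] //=; rewrite ?lee_fin//.
case: a b => [a||] [b||] //=; rewrite ?ltNyr//.
rewrite -!EFinM -!EFinD !lee_fin !lte_fin !ltr_pdivlMr ?mulr_gt0//; nra.
Qed.

(** Collects the estimates of the proof that composition is continuous
    ([C11_energy_dist]) when the quantities may be infinite. *)
Lemma energy_arith {R : realType} (V S I x y t : \bar R) (a b c m : R) :
  (V <= a%:E * x -> S <= m%:E * t + 1%:E * I -> I <= c%:E * x + b%:E * y ->
   0 <= x -> 0 <= y -> 0 <= t -> (0 <= a)%R -> (0 < b)%R -> (0 <= c)%R ->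
   V + S <= (a + c + b)%:E * (x + y) + m%:E * t)%E.
Proof.
move=> VE SE IE x0 y0 t0 a0 b0 c0.
apply: le_trans (leeD VE (le_trans SE (leeD (lexx _) _))) _.
  by rewrite mul1e; exact: IE.
rewrite [X in (_ + X)%E]addeC addeA leeD2r//.
have abc0 : 0 < a + c + b by lra.
case: x y x0 y0 {VE SE IE} => [x||] [y||] //= x0 y0; last 3 first.
- by rewrite [leRHS](_ : _ = +oo)%E ?leey//= gt0_muley ?lte_fin.
- by rewrite [leRHS](_ : _ = +oo)%E ?leey//= gt0_muley ?lte_fin.
- by rewrite [leRHS](_ : _ = +oo)%E ?leey//= gt0_muley ?lte_fin.
rewrite -!(EFinM, EFinD) lee_fin; move: x0 y0; rewrite !lee_fin => x0 y0.
have := mulr_ge0 a0 y0; have := mulr_ge0 c0 y0; have := mulr_ge0 (ltW b0) x0.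
lra.
Qed.

Lemma natr_gt_near {R : realType} (a b : R) : 0 < b ->
  \forall k \near \oo, a <= k.+1%:R * b.
Proof.
move=> b0; near=> k; rewrite -ler_pdivrMr//; apply: (@le_trans _ _ k%:R).
  by near: k; exact: nbhs_infty_ger.
by rewrite ler_nat.
Unshelve. all: by end_near. Qed.

(** * Integration *)

Import HBNNSimple.

(** The integral of a nonnegative function is the supremum of the integrals of
    the simple functions below it; this makes it monotone on all nonnegative
    functions, measurable or not. *)
Lemma le_lower_integral {d} {T : measurableType d} {R : realType}
    (mu : {measure set T -> \bar R}) (D : set T) (f g : T -> \bar R) :
  (forall x, D x -> 0 <= f x)%E -> (forall x, D x -> f x <= g x)%E ->
  (\int[mu]_(x in D) f x <= \int[mu]_(x in D) g x)%E.
Proof.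
move=> f0 fg; have g0 x : D x -> (0 <= g x)%E.
  by move=> Dx; apply: le_trans (fg _ Dx); exact: f0.
rewrite !ge0_integralE//; apply: le_ereal_sup => _ [s /= sf <-].
exists s => //= x; apply: le_trans (sf x) _; rewrite !patchE.
by case: ifPn => //; rewrite inE; exact: fg.
Qed.

(** A simple function [s] below [g + c * h] leaves the measurable remainder
    [(s - g)^+ / c] below [h]. For energies, [f] and [h] involve gradients of
    approximants, and [g] does not. *)
Lemma lower_integral_le_add {d} {T : measurableType d} {R : realType}
    (mu : {measure set T -> \bar R}) (D : set T) (f g h : T -> R) (c : R) :
  measurable D -> measurable_fun D g -> 0 < c ->
  (forall x, D x -> 0 <= f x) -> (forall x, D x -> 0 <= g x) ->
  (forall x, D x -> 0 <= h x) -> (forall x, D x -> f x <= g x + c * h x) ->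
  (\int[mu]_(x in D) (f x)%:E <=
   \int[mu]_(x in D) (g x)%:E + c%:E * \int[mu]_(x in D) (h x)%:E)%E.
Proof.
move=> mD mg c0 f0 g0 h0 fgh.
rewrite (@ge0_integralE _ _ _ _ D (fun x => (f x)%:E)); last first.
  by move=> x Dx; rewrite lee_fin f0.
apply: ge_ereal_sup => _ [s /= sf <-].
have sD x : D x -> s x <= f x.
  by move=> Dx; have := sf x; rewrite patchE mem_set.
have sDC x : ~ D x -> s x = 0.
  move=> nDx; have := sf x; rewrite patchE memNset// lee_fin => sx.
  by apply/eqP; rewrite eq_le sx; exact: fun_ge0.
pose k x : R := Num.max (c^-1 * (s x - g x)) 0.
have k0 x : 0 <= k x by rewrite le_max lexx orbT.
have ms : measurable_fun D s by exact: measurable_funTS.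
have mk : measurable_fun D k.
  apply: measurable_maxr => //; apply: measurable_funM => //.
  exact: measurable_funB.
have kh x : D x -> k x <= h x.
  move=> Dx; rewrite ge_max h0// andbT mulrC ler_pdivrMr// mulrC.
  by have := sD x Dx; have := fgh x Dx; lra.
rewrite -integralT_nnsfun.
rewrite (_ : \int[mu]_x _ = \int[mu]_(x in D) (s x)%:E)%E; last first.
  rewrite [RHS]integral_mkcond; apply: eq_integral => x _; rewrite patchE.
  by case: ifPn => //; rewrite notin_setE => /sDC ->.
apply: (@le_trans _ _ (\int[mu]_(x in D) ((g x)%:E + c%:E * (k x)%:E))%E).
  apply: le_lower_integral => x Dx; first by rewrite lee_fin; exact: fun_ge0.
  rewrite -EFinM -EFinD lee_fin.
  have : c * (c^-1 * (s x - g x)) <= c * k x by rewrite ler_pM2l// le_max lexx.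
  by rewrite mulVKf ?gt_eqF//; lra.
rewrite ge0_integralD//=.
- rewrite ge0_integralZl_EFin//; last first.
  + exact: ltW.
  + exact/measurable_EFinP.
  + by move=> x _; rewrite lee_fin.
  apply: leeD => //; apply: lee_wpmul2l; first by rewrite lee_fin ltW.
  by apply: le_lower_integral => x Dx; rewrite lee_fin// kh.
- exact/measurable_EFinP.
- by move=> x _; rewrite -EFinM lee_fin mulr_ge0// ltW.
- by apply: measurable_funeM; exact/measurable_EFinP.
Qed.

Lemma lower_integral_le {d} {T : measurableType d} {R : realType}
    (mu : {measure set T -> \bar R}) (D : set T) (f g h : T -> R) (a c : R) :
  measurable D -> measurable_fun D g -> 0 <= a -> 0 < c ->
  (forall x, D x -> 0 <= f x) -> (forall x, D x -> 0 <= g x) ->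
  (forall x, D x -> 0 <= h x) -> (forall x, D x -> f x <= a * g x + c * h x) ->
  (\int[mu]_(x in D) (f x)%:E <=
   a%:E * \int[mu]_(x in D) (g x)%:E + c%:E * \int[mu]_(x in D) (h x)%:E)%E.
Proof.
move=> mD mg a0 c0 f0 g0 h0 fgh.
have -> : (a%:E * \int[mu]_(x in D) (g x)%:E =
           \int[mu]_(x in D) (a * g x)%:E)%E.
  rewrite -ge0_integralZl_EFin//; last exact/measurable_EFinP.
apply: lower_integral_le_add => //; first exact: measurable_funM.
by move=> x Dx; rewrite mulr_ge0// g0.
Qed.

(** Hoelder's inequality with strictly positive bounds in place of the norms, so
    that Young's inequality applies after division by them. *)
Lemma holder_bound {d} {T : measurableType d} {R : realType}
    (mu : {measure set T -> \bar R}) (D : set T) (f g : T -> R) (p q a c : R) :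
  measurable D -> measurable_fun D f -> measurable_fun D g ->
  (forall x, D x -> 0 <= f x) -> (forall x, D x -> 0 <= g x) ->
  0 < p -> 0 < q -> p^-1 + q^-1 = 1 -> 0 < a -> 0 < c ->
  (\int[mu]_(x in D) (f x `^ p)%:E <= a%:E)%E ->
  (\int[mu]_(x in D) (g x `^ q)%:E <= c%:E)%E ->
  (\int[mu]_(x in D) (f x * g x)%:E <= (a `^ p^-1 * c `^ q^-1)%:E)%E.
Proof.
move=> mD mf mg f0 g0 p0 q0 pq a0 c0 fa gc.
pose A := a `^ p^-1; pose B := c `^ q^-1.
have A0 : 0 < A by exact: powR_gt0.
have B0 : 0 < B by exact: powR_gt0.
have Ap : A `^ p = a by rewrite -powRrM mulVf ?gt_eqF// powRr1// ltW.
have Bq : B `^ q = c by rewrite -powRrM mulVf ?gt_eqF// powRr1// ltW.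
pose k1 := A * B / (a * p); pose k2 := A * B / (c * q).
have k10 : 0 < k1 by rewrite divr_gt0 ?mulr_gt0.
have k20 : 0 < k2 by rewrite divr_gt0 ?mulr_gt0.
apply: (@le_trans _ _ (k1%:E * \int[mu]_(x in D) (f x `^ p)%:E +
                       k2%:E * \int[mu]_(x in D) (g x `^ q)%:E)%E).
  apply: lower_integral_le => // [||x Dx|x Dx|x Dx|x Dx].
  - exact: (measurableT_comp (@measurable_powR R p)).
  - exact: ltW.
  - by rewrite mulr_ge0 ?f0 ?g0.
  - exact: powR_ge0.
  - exact: powR_ge0.
  - have fA0 : 0 <= f x / A by rewrite divr_ge0 ?f0// ltW.
    have gB0 : 0 <= g x / B by rewrite divr_ge0 ?g0// ltW.
    have := conjugate_powR fA0 gB0 p0 q0 pq.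
    rewrite !powRM ?invr_ge0 ?(ltW A0) ?(ltW B0) ?f0 ?g0// !powRV// Ap Bq.
    move=> /(ler_wpM2l (ltW (mulr_gt0 A0 B0))).
    have -> : A * B * (f x / A * (g x / B)) = f x * g x.
      by field; rewrite !gt_eqF.
    move=> /le_trans; apply; rewrite le_eqVlt; apply/orP; left; apply/eqP.
    by rewrite /k1 /k2; field; rewrite !gt_eqF.
apply: (@le_trans _ _ (k1%:E * a%:E + k2%:E * c%:E)%E).
  by apply: leeD; apply: lee_wpmul2l => //; rewrite lee_fin ltW.
rewrite -!EFinM -EFinD lee_fin -/A -/B.
have -> : k1 * a + k2 * c = A * B * (p^-1 + q^-1).
  by rewrite /k1 /k2; field; rewrite !gt_eqF.
by rewrite pq mulr1.
Qed.

Section integration.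
Context {d} {T : measurableType d} {R : realType}.
Variables (mu : {measure set T -> \bar R}) (D : set T).
Hypothesis mD : measurable D.

Lemma measurable_if (b : T -> bool) (f g : T -> R) :
  measurable_fun D b -> measurable_fun D f -> measurable_fun D g ->
  measurable_fun D (fun x => if b x then f x else g x).
Proof.
by move=> mb mf mg; apply: measurable_fun_if => //;
  [exact: measurable_funS mf|exact: measurable_funS mg].
Qed.

Lemma measurable_lipschitz_comp (h : R -> R) (L : R) (f : T -> R) :
  (forall s t, `|h s - h t| <= L * `|s - t|) -> measurable_fun D f ->
  measurable_fun D (h \o f).
Proof.
move=> hL mf; apply: measurableT_comp mf; apply: continuous_measurable_fun.
move=> s; apply/cvgrPdist_lt => e e0.
have L0 : 0 < `|L| + 1 by rewrite ltr_wpDl.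
near=> t; apply: le_lt_trans (hL _ _) _.
apply: (@le_lt_trans _ _ ((`|L| + 1) * `|s - t|)).
  by rewrite ler_wpM2r// (le_trans (ler_norm _))// lerDl.
rewrite -ltr_pdivlMl//; near: t; apply: cvgr_dist_lt => //.
by rewrite mulr_gt0// invr_gt0.
Unshelve. all: by end_near. Qed.

Lemma measurable_powR_norm (f : T -> R) (p : R) :
  measurable_fun D f -> measurable_fun D (fun x => `|f x| `^ p).
Proof.
move=> mf; apply: (measurableT_comp (@measurable_powR R p)).
exact: measurableT_comp.
Qed.

Lemma integral_dominated_cvg (f_ : nat -> T -> R) (f g : T -> R) :
  (forall k, measurable_fun D (f_ k)) -> measurable_fun D f ->
  mu.-integrable D (EFin \o g) ->
  (forall k x, D x -> `|f_ k x| <= g x) ->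
  (forall x, D x -> f_ k x @[k --> \oo] --> f x) ->
  (\int[mu]_(x in D) (f_ k x)%:E)%E @[k --> \oo] --> (\int[mu]_(x in D) (f x)%:E)%E.
Proof.
move=> mf_ mf ig fg ff.
have [] := @dominated_convergence _ _ _ mu D mD
  (fun k => EFin \o f_ k) (EFin \o f) (EFin \o g) _ _ _ ig => //.
- by move=> k; exact/measurable_EFinP.
- exact/measurable_EFinP.
- by apply: aeW => x Dx; apply: cvg_EFin; [exact: nearW|exact: ff].
- by apply: aeW => x k Dx; rewrite /= lee_fin fg.
Qed.

Definition value_energy (f : T -> R) : \bar R := (\int[mu]_(x in D) (f x ^+ 2)%:E)%E.

Lemma value_energy_ge0 f : (0 <= value_energy f)%E.
Proof. by apply: integral_ge0 => x _; rewrite lee_fin sqr_ge0. Qed.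

Lemma value_energyB (f g h : T -> R) :
  measurable_fun D f -> measurable_fun D g ->
  (value_energy (f \- h)%R <=
   2%:E * value_energy (f \- g)%R + 2%:E * value_energy (g \- h)%R)%E.
Proof.
move=> mf mg; apply: lower_integral_le => // [|x _|x _|x _|x _].
- by apply: measurable_funX; exact: measurable_funB.
- exact: sqr_ge0.
- exact: sqr_ge0.
- exact: sqr_ge0.
- by have := sqr_ge0 ((f x - g x) - (g x - h x)); rewrite /=; nra.
Qed.

Lemma value_energy_le (f g : T -> R) (a : R) : measurable_fun D g -> 0 <= a ->
  (forall x, D x -> f x ^+ 2 <= a * g x ^+ 2) ->
  (value_energy f <= a%:E * value_energy g)%E.
Proof.
move=> mg a0 fg; rewrite /value_energy -ge0_integralZl_EFin//; last 2 first.
  by move=> x _; rewrite lee_fin sqr_ge0.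
  by apply/measurable_EFinP; exact: measurable_funX.
apply: le_lower_integral => x Dx; first by rewrite lee_fin sqr_ge0.
by rewrite -EFinM lee_fin fg.
Qed.

Lemma integrable_sqr (f : T -> R) : measurable_fun D f ->
  (value_energy f < +oo)%E -> mu.-integrable D (EFin \o (fun x => f x ^+ 2)).
Proof.
move=> mf ff; apply/integrableP; split.
  by apply/measurable_EFinP; exact: measurable_funX.
by under eq_integral do rewrite /= ger0_norm ?sqr_ge0//.
Qed.

(** The part of [f] where [f ^+ 2] exceeds [k]. It serves to bound products
    [a * f], where [a] is bounded and small in [L^2]: where [f ^+ 2 <= k] by
    the smallness of [a], and elsewhere by the small energy of the tail. *)
Definition tail (k : R) (f : T -> R) (x : T) : R :=
  if k < f x ^+ 2 then f x else 0.

Lemma measurable_tail k (f : T -> R) :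
  measurable_fun D f -> measurable_fun D (tail k f).
Proof.
move=> mf; apply: measurable_if => //.
by apply: measurable_fun_ltr => //; exact: measurable_funX.
Qed.

Lemma value_energy_tail (f : T -> R) (e : R) : measurable_fun D f ->
  (value_energy f < +oo)%E -> 0 < e -> exists2 k : R, 0 <= k &
  (value_energy (tail k f) < e%:E)%E.
Proof.
move=> mf ff e0.
have : (value_energy (tail k%:R f)) @[k --> \oo] --> (\int[mu]_(x in D) (0 : R)%:E)%E.
  apply: (integral_dominated_cvg _ _ (integrable_sqr mf ff)) => //.
  - by move=> k; apply: measurable_funX; exact: measurable_tail.
  - move=> k x _; rewrite ger0_norm ?sqr_ge0// /tail; case: ifP => // _.
    by rewrite expr0n sqr_ge0.
  - move=> x _; apply: cvg_near_cst; near=> k; rewrite /tail ifF ?expr0n//.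
    apply/negbTE; rewrite -leNgt; near: k; exact: nbhs_infty_ger.
rewrite integral0 => tail0.
have [k _ /(_ _ (leqnn k)) ke] : \forall k \near \oo, (value_energy (tail k%:R f) < e%:E)%E.
  by apply: cvge_near_lt tail0 _; rewrite lte_fin.
by exists k%:R.
Unshelve. all: by end_near. Qed.

(** The sum of the squared errors has a finite integral, hence is finite almost
    everywhere, and the terms of a convergent series tend to [0]. *)
Lemma fast_cvg_ae (f_ : nat -> T -> R) (f : T -> R) :
  (forall k, measurable_fun D (f_ k)) -> measurable_fun D f ->
  (forall k, value_energy (f \- f_ k)%R <= (1 / (2 ^ k.+1)%:R)%:E)%E ->
  {ae mu, forall x, D x -> f_ k x @[k --> \oo] --> f x}.
Proof.
move=> mf_ mf fast.
pose s k x : \bar R := ((f x - f_ k x) ^+ 2)%:E.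
have s0 k x : D x -> (0 <= s k x)%E by rewrite lee_fin sqr_ge0.
have ms k : measurable_fun D (s k).
  by apply/measurable_EFinP; apply: measurable_funX; exact: measurable_funB.
have sum_fin : (\int[mu]_(x in D) (\sum_(0 <= k <oo) s k x) < +oo)%E.
  rewrite integral_nneseries//.
  apply: (@le_lt_trans _ _ (\sum_(0 <= k <oo) (1 / (2 ^ k.+1)%:R)%:E)%E).
    by apply: lee_nneseries => k _; [move=> _; exact: value_energy_ge0|exact: fast].
  apply: le_lt_trans (ltry 1).
  by have := @epsilon_trick0 R 1 xpredT ler01.
have isum : mu.-integrable D (fun x => \sum_(0 <= k <oo) s k x)%E.
  apply/integrableP; split.
    apply: (@ge0_emeasurable_sum _ _ _ D s xpredT) => [k x Dx _|k _].
      exact: s0.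
    exact: ms.
  under eq_integral => x.
    rewrite inE => Dx; rewrite gee0_abs; last by apply: nneseries_ge0 => k _ _; exact: s0.
    over.
  exact: sum_fin.
have := integrable_ae mD isum; apply: filterS => x /[swap] Dx /(_ Dx) sx.
have {}sx : (\sum_(0 <= k <oo) s k x < +oo)%E by rewrite ltey_eq sx.
have tl := nneseries_tail_cvg (P := xpredT) (f := fun k => s k x) sx
  (fun k _ => s0 k x Dx).
have sq0 : (s k x @[k --> \oo] --> 0)%E.
  apply: squeeze_cvge (cvg_cst 0%E) tl; apply: nearW => k.
  rewrite s0//=; have := @nneseries_split R (fun k => s k x) k 1 (fun k _ => s0 k x Dx).
  move=> ->; rewrite addn1 big_nat1 leeDl//.
  by apply: nneseries_ge0 => j _ _; exact: s0.
apply/cvgrPdist_lt => e e0.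
have : \forall k \near \oo, (s k x < (e ^+ 2)%:E)%E.
  by apply: cvge_near_lt sq0 _; rewrite lte_fin exprn_gt0.
apply: filterS => k; rewrite /s lte_fin => lt2.
by rewrite -(@ltr_pXn2r _ 2) ?nnegrE ?(ltW e0)// real_normK ?num_real.
Qed.

Definition rintegrable (f : T -> R) := mu.-integrable D (EFin \o f).

Lemma rintegrableD (f g : T -> R) :
  rintegrable f -> rintegrable g -> rintegrable (fun x => f x + g x).
Proof. by move=> rf rg; exact: (integrableD mD rf rg). Qed.

Lemma rintegrableZ (k : R) (f : T -> R) :
  rintegrable f -> rintegrable (fun x => k * f x).
Proof. by move=> rf; exact: (integrableZl mD k rf). Qed.

Lemma rintegrable_le (f g : T -> R) : measurable_fun D f ->
  rintegrable g -> (forall x, D x -> `|f x| <= g x) -> rintegrable f.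
Proof.
move=> mf rg fg; apply: (le_integrable mD _ _ rg); first exact/measurable_EFinP.
by move=> x Dx; rewrite lee_fin (le_trans (fg _ Dx))// ler_norm.
Qed.

End integration.

(** * Completions of spaces of smooth functions *)

Section completion.
Context {d} {T : measurableType d} {R : realType} {n : nat}.
Variables (mu : {measure set T -> \bar R}) (D : set T) (Q : T -> 'M[R]_n).
Hypothesis mD : measurable D.
Hypothesis Q_ge0 : forall x, D x -> mx_nonneg (Q x).
Hypothesis mQ : forall i j, measurable_fun D (fun x => Q x i j).
Local Notation value_energy := (value_energy mu D).
Local Notation value_energy_ge0 := (value_energy_ge0 mu D).
Local Notation value_energy_le := (value_energy_le mu mD).

Definition vector_measurable (g : T -> 'rV[R]_n) :=
  forall i, measurable_fun D (fun x => g x 0 i).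

Definition slope (g : T -> 'rV[R]_n) (x : T) : R := sqrt_norm (Q x) (g x).

Lemma slope_ge0 g x : 0 <= slope g x.
Proof. exact: sqrt_norm_ge0. Qed.

Lemma measurable_dotv (B : set T) (f g : T -> 'rV[R]_n) :
  (forall i, measurable_fun B (fun x => f x 0 i)) ->
  (forall i, measurable_fun B (fun x => g x 0 i)) ->
  measurable_fun B (fun x => dotv (f x) (g x)).
Proof.
move=> mf mg; rewrite (_ : (fun x => _) = (fun x => \sum_i f x 0 i * g x 0 i)).
  by apply: measurable_sum => i; apply: measurable_funM; [exact: mf|exact: mg].
by apply/funext => x; rewrite /dotv mxE; apply: eq_bigr => i _; rewrite mxE.
Qed.

Lemma measurable_dotv_mxact (A : T -> 'M[R]_n) (f g : T -> 'rV[R]_n) :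
  (forall i j, measurable_fun D (fun x => A x i j)) ->
  vector_measurable f -> vector_measurable g ->
  measurable_fun D (fun x => dotv (f x) (mxact (A x) (g x))).
Proof.
move=> mA mf mg.
rewrite (_ : (fun x => _) =
    (fun x => \sum_i (\sum_j f x 0 j * A x j i) * g x 0 i)); last first.
  apply/funext => x; rewrite dotv_mxact mxE; apply: eq_bigr => i _.
  by rewrite !mxE.
apply: measurable_sum => i; apply: measurable_funM; last exact: mg.
by apply: measurable_sum => j; apply: measurable_funM; [exact: mf|exact: mA].
Qed.

Lemma measurable_sqr_slope (g : T -> 'rV[R]_n) :
  vector_measurable g -> measurable_fun D (fun x => slope g x ^+ 2).
Proof.
move=> mg; apply: eq_measurable_fun (measurable_dotv_mxact mQ mg mg) => x.
by rewrite inE => Dx; rewrite sqr_sqrt_norm//; exact: Q_ge0.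
Qed.

Lemma measurable_slope (g : T -> 'rV[R]_n) :
  vector_measurable g -> measurable_fun D (slope g).
Proof.
move=> mg; rewrite (_ : slope g = (fun x => Num.sqrt (slope g x ^+ 2))).
  apply: measurableT_comp (measurable_sqr_slope mg).
  exact: continuous_measurable_fun (@sqrt_continuous R).
by apply/funext => x; rewrite sqrtr_sqr ger0_norm// slope_ge0.
Qed.

Lemma vector_measurableB (f g : T -> 'rV[R]_n) :
  vector_measurable f -> vector_measurable g ->
  vector_measurable (fun x => f x - g x).
Proof.
move=> mf mg i; under eq_fun do rewrite mxE mxE.
exact: measurable_funB.
Qed.

Lemma vector_measurableZ (a : T -> R) (g : T -> 'rV[R]_n) :
  measurable_fun D a -> vector_measurable g ->
  vector_measurable (fun x => a x *: g x).
Proof.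
move=> ma mg i; under eq_fun do rewrite mxE.
exact: measurable_funM.
Qed.

Definition slope_energy (g : T -> 'rV[R]_n) : \bar R := value_energy (slope g).

Lemma slope_energyB (f g h : T -> 'rV[R]_n) :
  vector_measurable f -> vector_measurable g ->
  (slope_energy (fun x => f x - h x)%R <=
   2%:E * slope_energy (fun x => f x - g x)%R +
   2%:E * slope_energy (fun x => g x - h x)%R)%E.
Proof.
move=> mf mg; apply: lower_integral_le => // [|x _|x _|x _|x _].
- by apply: measurable_sqr_slope; exact: vector_measurableB.
- exact: sqr_ge0.
- exact: sqr_ge0.
- exact: sqr_ge0.
- have := sqr_sqrt_normD (Q x) (f x - g x) (g x - h x) ltr01.
  by rewrite addrA subrK invr1.
Qed.

Lemma slope_energy_le (f g : T -> 'rV[R]_n) (a : T -> R) (c : R) :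
  vector_measurable g -> 0 <= c -> (forall x, D x -> a x ^+ 2 <= c) ->
  (forall x, D x -> f x = a x *: g x) ->
  (slope_energy f <= c%:E * slope_energy g)%E.
Proof.
move=> mg c0 ac fg; apply: value_energy_le => // [|x Dx].
  exact: measurable_slope.
by rewrite /slope fg// sqr_sqrt_normZ ler_wpM2r ?sqr_ge0// ac.
Qed.

Definition gpair : Type := ((T -> R) * (T -> 'rV[R]_n))%type.

Implicit Types (u v w p : gpair).

Definition energy_dist u v : \bar R :=
  (value_energy (u.1 \- v.1)%R + slope_energy (fun x => u.2 x - v.2 x)%R)%E.

Definition admissible u :=
  [/\ measurable_fun D u.1, vector_measurable u.2,
      (value_energy u.1 < +oo)%E & (slope_energy u.2 < +oo)%E].

Variable S : set gpair.

(** The elements are pairs, as for the spaces [QH^1] and [QH^1_0]; the distance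
    to an approximant [p] is a lower integral, since [p.2] need not be
    measurable. *)
Definition completion u := admissible u /\
  forall e : R, 0 < e -> exists2 p, S p & (energy_dist u p < e%:E)%E.

Lemma completion_closed u : admissible u ->
  (forall e : R, 0 < e -> exists2 w, completion w & (energy_dist u w < e%:E)%E) ->
  completion u.
Proof.
move=> au cl; have [mu1 mu2 _ _] := au; split=> // e e0.
have e40 : 0 < e / (2 * 2) by rewrite divr_gt0.
have [w [[mw1 mw2 _ _] /(_ _ e40)[p Sp wp]] uw] := cl _ e40.
exists p => //; apply: ge0_adde_lt_le uw wp => //; try exact: value_energy_ge0.
  exact: (value_energyB mu mD).
exact: slope_energyB.
Qed.

Hypothesis S_measurable : forall p, S p -> measurable_fun D p.1.
Hypothesis S_comp : forall p h h' L K, C11_bounded h h' L K -> h 0 = 0 -> S p ->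
  S (h \o p.1, fun x => h' (p.1 x) *: p.2 x).

(** The difference of the gradients is [(h' u - h' p) grad u + h' p (grad u -
    grad p)]. In the first term, the factor [h' u - h' p] is at most
    [K * |u - p|] and at most [2 * L]; the former is used where the squared
    slope of [u] is at most [k], the latter on the tail. *)
Lemma C11_energy_dist (h h' : R -> R) (L K k : R) u p :
  C11_bounded h h' L K -> 0 <= k -> admissible u -> measurable_fun D p.1 ->
  (energy_dist (h \o u.1, fun x => h' (u.1 x) *: u.2 x)
               (h \o p.1, fun x => h' (p.1 x) *: p.2 x) <=
   (3 * L ^+ 2 + 2 * K ^+ 2 * k + 1)%:E * energy_dist u p +
   (8 * L ^+ 2)%:E *
     value_energy (tail k (slope u.2)))%E.
Proof.
move=> hC k0 [mu1 mu2 _ _] mp1.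
have L0 : 0 <= L := le_trans (normr_ge0 _) (C11_bound hC 0).
have K0 := C11_ge0 hC.
have h'b s : h' s ^+ 2 <= L ^+ 2 by apply: ler_sqr_norm; exact: C11_bound hC s.
pose c := 2 * K ^+ 2 * k; pose b := 2 * L ^+ 2 + 1.
have ms := measurable_slope mu2.
have mtail := measurable_tail mD k ms.
have VE : (value_energy ((h \o u.1) \- (h \o p.1))%R <=
    (L ^+ 2)%:E * value_energy (u.1 \- p.1)%R)%E.
  apply: value_energy_le => [||x _]; first exact: measurable_funB.
    exact: sqr_ge0.
  rewrite -exprMn -(real_normK (num_real (L * _))) normrM (ger0_norm L0).
  exact/ler_sqr_norm/(C11_lip hC).
have SE : (slope_energy (fun x => h' (u.1 x) *: u.2 x - h' (p.1 x) *: p.2 x)%R <=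
    (8 * L ^+ 2)%:E * value_energy (tail k (slope u.2)) + 1%:E * (\int[mu]_(x in D)
      (c * (u.1 x - p.1 x) ^+ 2 + b * slope (fun x => u.2 x - p.2 x) x ^+ 2)%:E))%E.
  apply: lower_integral_le => // [||x _|x _|x _|x _].
  - exact: measurable_funX.
  - by rewrite mulr_ge0// sqr_ge0.
  - exact: sqr_ge0.
  - exact: sqr_ge0.
  - by rewrite addr_ge0// mulr_ge0 ?sqr_ge0// ?mulr_ge0 ?sqr_ge0// addr_ge0// mulr_ge0// sqr_ge0.
  - rewrite {1}/slope (_ : _ - _ = (h' (u.1 x) - h' (p.1 x)) *: u.2 x +
        h' (p.1 x) *: (u.2 x - p.2 x)); last first.
      by rewrite scalerBl scalerBr addrA subrK.
    apply: le_trans (sqr_sqrt_normD (Q x) _ _ ltr01) _.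
    rewrite invr1 !sqr_sqrt_normZ.
    have h1 := h'b (u.1 x); have h2 := h'b (p.1 x).
    have h3 : (h' (u.1 x) - h' (p.1 x)) ^+ 2 <= K ^+ 2 * (u.1 x - p.1 x) ^+ 2.
      rewrite -exprMn -(real_normK (num_real (K * _))) normrM (ger0_norm K0).
      exact/ler_sqr_norm/(C11_lip' hC).
    have h4 : (h' (u.1 x) - h' (p.1 x)) ^+ 2 <= 4 * L ^+ 2.
      by have := sqr_ge0 (h' (u.1 x) + h' (p.1 x)); nra.
    have z2 := sqr_ge0 (u.1 x - p.1 x); have d2 := sqr_ge0 (h' (u.1 x) - h' (p.1 x)).
    have w2 := sqr_ge0 (slope u.2 x).
    have y2 := sqr_ge0 (slope (fun x => u.2 x - p.2 x) x).
    have K2 := sqr_ge0 K; rewrite -/(slope u.2 x).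
    rewrite -[sqrt_norm (Q x) (u.2 x - p.2 x)]/(slope (fun x => u.2 x - p.2 x) x).
    rewrite /b /c /tail; case: ltP => [_|Wk].
      have := mulr_ge0 (mulr_ge0 K2 k0) z2.
      have := ler_wpM2r w2 h4; have := ler_wpM2r y2 h2; lra.
    have := ler_wpM2r w2 h3; have := ler_wpM2l (mulr_ge0 K2 z2) Wk.
    have := ler_wpM2r y2 h2; lra.
have b0 : 0 < b by rewrite ltr_wpDl// mulr_ge0// sqr_ge0.
have c0 : 0 <= c by rewrite mulr_ge0// mulr_ge0// sqr_ge0.
have IE : (\int[mu]_(x in D)
      (c * (u.1 x - p.1 x) ^+ 2 + b * slope (fun x => u.2 x - p.2 x) x ^+ 2)%:E <=
    c%:E * value_energy (u.1 \- p.1)%R +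
    b%:E * slope_energy (fun x => u.2 x - p.2 x)%R)%E.
  apply: lower_integral_le => // [|x _|x _|x _].
  - by apply: measurable_funX; exact: measurable_funB.
  - by rewrite addr_ge0// mulr_ge0 ?sqr_ge0// ltW.
  - exact: sqr_ge0.
  - exact: sqr_ge0.
rewrite /energy_dist; have -> : 3 * L ^+ 2 + 2 * K ^+ 2 * k + 1 = L ^+ 2 + c + b.
  by rewrite /b /c; ring.
have x0 := value_energy_ge0 (u.1 \- p.1)%R.
have y0 := value_energy_ge0 (slope (fun x => u.2 x - p.2 x)%R).
have t0 := value_energy_ge0 (tail k (slope u.2)).
exact: (energy_arith VE SE IE x0 y0 t0 (sqr_ge0 L) b0 c0).
Qed.

(** Choose first [k] so large that the tail of the slope of [u] has small
    energy, then the approximant of [u] according to [k]. *)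
Lemma completion_comp (h h' : R -> R) (L K : R) u :
  C11_bounded h h' L K -> h 0 = 0 -> completion u ->
  completion (h \o u.1, fun x => h' (u.1 x) *: u.2 x).
Proof.
move=> hC h0 [au cu]; have [mu1 mu2 fu1 fu2] := au.
have mh : measurable_fun D (h \o u.1).
  by apply: (measurable_lipschitz_comp (C11_lip hC)).
have mh' : measurable_fun D (h' \o u.1).
  by apply: (measurable_lipschitz_comp (C11_lip' hC)).
have L0 : 0 <= L := le_trans (normr_ge0 _) (C11_bound hC 0).
have adm : admissible (h \o u.1, fun x => h' (u.1 x) *: u.2 x).
  split; [exact: mh|exact: vector_measurableZ| |].
    apply: le_lt_trans (value_energy_le mu1 (sqr_ge0 L) _) _ => [x _|].
      exact: (sqr_C11_le _ hC).
    by apply: lte_mul_pinfty; rewrite ?lee_fin ?sqr_ge0.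
  apply: le_lt_trans (slope_energy_le mu2 (sqr_ge0 L) _ (fun _ _ => erefl)) _.
    by move=> x _; apply: ler_sqr_norm; exact: C11_bound hC _.
  by apply: lte_mul_pinfty; rewrite ?lee_fin ?sqr_ge0.
split=> [|e e0]; first exact: adm.
pose m := 8 * L ^+ 2; have m0 : 0 <= m by rewrite mulr_ge0// sqr_ge0.
have [|k k0 ktail] := value_energy_tail mD (e := e / (2 * (m + 1)))
  (measurable_slope mu2) fu2; first by rewrite divr_gt0// mulr_gt0// ltr_wpDl.
pose A := 3 * L ^+ 2 + 2 * K ^+ 2 * k + 1.
have A0 : 0 < A.
  by have := sqr_ge0 L; have := mulr_ge0 (sqr_ge0 K) k0; rewrite /A; lra.
have [|p Sp up] := cu (e / (2 * A)); first by rewrite divr_gt0// mulr_gt0.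
exists (h \o p.1, fun x => h' (p.1 x) *: p.2 x); first exact: (S_comp hC h0 Sp).
apply: le_lt_trans (C11_energy_dist hC k0 au (S_measurable Sp)) _.
rewrite -/A -/m; move: up ktail.
have := value_energy_ge0 (tail k (slope u.2)).
have : (0 <= energy_dist u p)%E by rewrite adde_ge0// value_energy_ge0.
case: (energy_dist u p) => [a||] //; case: (value_energy _) => [b||] //.
rewrite -!EFinM -EFinD !lee_fin !lte_fin => a0 b0.
rewrite !ltr_pdivlMr ?mulr_gt0// ?ltr_wpDl//; nra.
Qed.

Definition truncate (c : R) u : gpair :=
  (fun x => Num.max (u.1 x - c) 0, fun x => (c < u.1 x)%R%:R *: u.2 x).

Lemma sqr_indicator_le1 (b : bool) : (b%:R : R) ^+ 2 <= 1.
Proof. by case: b; rewrite ?expr1n// expr0n. Qed.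

Lemma admissible_truncate c u : 0 <= c -> admissible u -> admissible (truncate c u).
Proof.
move=> c0 [m1 m2 f1 f2].
have mb : measurable_fun D (fun x => (c < u.1 x)%R%:R : R).
  have := @measurable_if d T R D mD (fun x => c < u.1 x) (cst 1) (cst 0).
  move=> H; apply: eq_measurable_fun (H _ _ _) => //.
  - by move=> x _; case: (_ < _).
  - exact: measurable_fun_ltr.
split=> /=.
- by apply: measurable_maxr => //; exact: measurable_funB.
- exact: vector_measurableZ.
- apply: le_lt_trans f1; rewrite -[leRHS]mul1e; apply: value_energy_le => // x _.
  rewrite mul1r; have [cu|uc] := leP c (u.1 x).
    by rewrite max_l ?subr_ge0//; nra.
  rewrite max_r; last by rewrite subr_le0 ltW.
  by rewrite expr2 mul0r sqr_ge0.
- apply: le_lt_trans f2; rewrite -[leRHS]mul1e.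
  by apply: slope_energy_le (fun _ _ => erefl) => // x _; exact: sqr_indicator_le1.
Qed.

(** The functions [h k s = k.+1^-1 * ramp (k.+1 * (s - c))] tend to the positive
    part of [s - c] uniformly, and their derivatives to the indicator of
    [s > c] pointwise. They vanish at [0] because [c >= 0]. *)
Lemma completion_truncate c u : 0 <= c -> completion u -> completion (truncate c u).
Proof.
move=> c0 cu; have [au _] := cu; have [m1 m2 f1 f2] := au.
have at_ := admissible_truncate c0 au; have [mt1 mt2 _ _] := at_.
apply: completion_closed => // e e0.
pose h k (s : R) : R := k.+1%:R^-1 * ramp (k.+1%:R * s + - (k.+1%:R * c)) + 0.
pose h' k (s : R) : R := k.+1%:R^-1 * k.+1%:R * ramp' (k.+1%:R * s + - (k.+1%:R * c)).
have hC k := C11_affine k.+1%:R^-1 k.+1%:R (- (k.+1%:R * c)) 0 (@C11_ramp R).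
have h0 k : h k 0 = 0.
  by rewrite /h mulr0 add0r addr0 /ramp oppr_le0 mulr_ge0// mulr0.
pose w k : gpair := (h k \o u.1, fun x => h' k (u.1 x) *: u.2 x).
have cw k : completion (w k) := completion_comp (hC k) (h0 k) cu.
pose a k x : R := (c < u.1 x)%R%:R - h' k (u.1 x).
have h'E k s : h' k s = ramp' (k.+1%:R * (s - c)).
  by rewrite /h' mulVf ?mul1r ?mulrBr// pnatr_eq0.
have hE k s : h k s = k.+1%:R^-1 * ramp (k.+1%:R * (s - c)).
  by rewrite /h addr0 mulrBr.
have mw k : measurable_fun D (w k).1 by have [[]] := cw k.
have mwa k : vector_measurable (w k).2 by have [[]] := cw k.
have V : (value_energy ((truncate c u).1 \- (w k).1)%R @[k --> \oo] -->
    \int[mu]_(x in D) (0 : R)%:E)%E.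
  apply: (integral_dominated_cvg mD _ _ (integrable_sqr m1 f1)) => //.
  - by move=> k; apply: measurable_funX; exact: measurable_funB.
  - move=> k x _; rewrite ger0_norm ?sqr_ge0//=.
    rewrite -[leRHS]real_normK ?num_real//; apply: ler_sqr_norm.
    have [/andP[d0 _] r0] := scaled_ramp_close (u.1 x - c) (ltr0Sn R k).
    rewrite hE (ger0_norm d0); apply: (@le_trans _ _ (Num.max (u.1 x - c) 0)).
      by rewrite gerBl.
    by rewrite ge_max normr_ge0 andbT; have := ler_norm (u.1 x); lra.
  - move=> x _ /=.
    apply: (@squeeze_cvgr _ _ _ _ (cst 0) (fun k => k.+1%:R^-1)).
    + apply: nearW => k; rewrite /cst sqr_ge0/= hE.
      have [/andP[d0 d1] _] := scaled_ramp_close (u.1 x - c) (ltr0Sn R k).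
      rewrite expr2; apply: (le_trans _ d1); rewrite -[leRHS]mul1r ler_wpM2r//.
      by apply: le_trans d1 _; rewrite invf_le1// ler1n.
    + exact: cvg_cst.
    + exact: cvg_harmonic.
have Sl : (slope_energy (fun x => (truncate c u).2 x - (w k).2 x)%R @[k --> \oo] -->
    \int[mu]_(x in D) (0 : R)%:E)%E.
  apply: (integral_dominated_cvg mD _ _ (integrable_sqr (measurable_slope m2) f2)) => //.
  - by move=> k; apply: measurable_sqr_slope; exact: vector_measurableB.
  - move=> k x _; rewrite ger0_norm ?sqr_ge0//= /slope -scalerBl sqr_sqrt_normZ.
    rewrite -[leRHS]mul1r ler_wpM2r ?sqr_ge0//.
    apply: (@le_trans _ _ (1 ^+ 2)); last by rewrite expr1n.
    apply: ler_sqr_norm; rewrite h'E ler_norml.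
    have /andP[? ?] := ramp'_01 (k.+1%:R * (u.1 x - c)).
    by case: (_ < _); apply/andP; split; rewrite /=; lra.
  - move=> x _ /=.
    apply: cvg_near_cst; suff [k _ kE] : \forall k \near \oo,
        ramp' (k.+1%:R * (u.1 x - c)) = (c < u.1 x)%R%:R.
      exists k => // m /kE E; rewrite /slope -scalerBl sqr_sqrt_normZ h'E E.
      by rewrite subrr expr0n mul0r.
    have [uc|uc] := leP (u.1 x) c.
      by apply: nearW => k; rewrite ramp'_eq0// pmulr_rle0// subr_le0.
    near=> k; rewrite ramp'_eq1//; near: k; apply: natr_gt_near.
    by rewrite subr_gt0.
have VS : (energy_dist (truncate c u) (w k) @[k --> \oo] --> 0)%E.
  rewrite integral0 in V Sl; rewrite -(adde0 0%E); exact: cvgeD.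
have [k _ /(_ _ (leqnn k)) ke] : \forall k \near \oo,
    (energy_dist (truncate c u) (w k) < e%:E)%E.
  by apply: cvge_near_lt VS _; rewrite lte_fin.
by exists (w k); [exact: cw|exact: ke].
Unshelve. all: by end_near. Qed.

Variables (sigma C : R).
Hypothesis sigma1 : 1 < sigma.
Hypothesis C_gt0 : 0 < C.
Hypothesis S_sobolev : forall p (eta : R), S p -> 0 < eta ->
  (slope_energy p.2 <= eta%:E)%E ->
  (\int[mu]_(x in D) (`|p.1 x| `^ (2 * sigma))%:E <= ((C * eta) `^ sigma)%:E)%E.

Lemma slope_energy_near u p : vector_measurable u.2 ->
  (slope_energy p.2 <= 2%:E * slope_energy u.2 + 2%:E * energy_dist u p)%E.
Proof.
move=> mu2; apply: (@le_trans _ _ (2%:E * slope_energy u.2 +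
    2%:E * slope_energy (fun x => u.2 x - p.2 x)%R)%E).
  apply: lower_integral_le => // [|x _|x _|x _|x _].
  - exact: measurable_sqr_slope.
  - exact: sqr_ge0.
  - exact: sqr_ge0.
  - exact: sqr_ge0.
  - have := sqr_sqrt_normD (Q x) (u.2 x) (-1 *: (u.2 x - p.2 x)) ltr01.
    by rewrite sqr_sqrt_normZ scaleN1r opprB addrC subrK invr1 sqrrN expr1n mul1r.
apply: leeD => //; apply: lee_wpmul2l; first by rewrite lee_fin.
by rewrite leeDr// value_energy_ge0.
Qed.

(** Fatou's lemma along approximants that converge almost everywhere; their slope
    energies are below [2 * eta] by [slope_energy_near]. *)
Lemma completion_sobolev u (eta : R) : completion u ->
  (slope_energy u.2 < eta%:E)%E ->
  (\int[mu]_(x in D) (`|u.1 x| `^ (2 * sigma))%:E <=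
   ((C * (2 * eta)) `^ sigma)%:E)%E.
Proof.
move=> [[m1 m2 f1 f2] cu] ueta.
have [E [E0 uE]] : exists E : R, 0 <= E /\ slope_energy u.2 = E%:E.
  have := value_energy_ge0 (slope u.2); move: ueta; rewrite /slope_energy.
  by case: (value_energy _) => // E _ E0; exists E.
have {ueta} Eeta : E < eta by move: ueta; rewrite uE lte_fin.
have eta0 : 0 < eta by exact: le_lt_trans Eeta.
have /choice[p pP] : forall k : nat, exists p, [/\ S p,
    (value_energy (u.1 \- p.1)%R <= (1 / (2 ^ k.+1)%:R)%:E)%E &
    (slope_energy p.2 <= (2 * eta)%:E)%E].
  move=> k.
  have e0 : 0 < Num.min (1 / (2 ^ k.+1)%:R) (eta - E).
    by rewrite lt_min subr_gt0 Eeta divr_gt0// ltr0n expn_gt0.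
  have [p Sp /ltW up] := cu _ e0; exists p; split=> //.
    apply: (@le_trans _ _ (energy_dist u p)).
      by rewrite leeDl// value_energy_ge0.
    by apply: le_trans up _; rewrite lee_fin ge_min lexx.
  apply: le_trans (slope_energy_near p m2) _.
  apply: (@le_trans _ _ (2%:E * E%:E + 2%:E * (eta - E)%:E)%E).
    rewrite uE leeD2l// lee_wpmul2l ?lee_fin//.
    by apply: le_trans up _; rewrite lee_fin ge_min lexx orbT.
  by rewrite -!EFinM -EFinD lee_fin; lra.
have mp k : measurable_fun D (p k).1 by have [/S_measurable] := pP k.
have pow0 : 0 < 2 * sigma by rewrite mulr_gt0// (lt_trans ltr01).
have ae_cvg := fast_cvg_ae mD mp m1 (fun k => let: And3 _ h _ := pP k in h).
have mpow (f : T -> R) : measurable_fun D f ->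
    measurable_fun D (fun x => (`|f x| `^ (2 * sigma))%:E).
  by move=> mf; apply/measurable_EFinP; exact: measurable_powR_norm.
pose F k x : \bar R := (`|(p k).1 x| `^ (2 * sigma))%:E.
apply: (@le_trans _ _ (\int[mu]_(x in D) limn_einf (F^~ x))%E).
  apply: ae_ge0_le_integral => //.
  - exact: mpow.
  - move=> x _; rewrite limn_einf_lim; apply: lime_ge; first exact: is_cvg_einfs.
    apply: nearW => k; apply/ereal_infP => _ [j _ <-].
    by rewrite lee_fin powR_ge0.
  - apply: measurableT_comp => //; apply: measurable_fun_limn_esup => k.
    by apply: measurableT_comp => //; exact: mpow.
  - apply: filterS ae_cvg => x /[apply] px.
    have Fx : F k x @[k --> \oo] --> (`|u.1 x| `^ (2 * sigma))%:E.
      by apply: cvg_EFin; [exact: nearW|exact: powR_norm_cvg].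
    by rewrite (cvg_limn_einf_sup Fx).1.
apply: le_trans (fatou _ _ _ _) _ => //.
- by move=> k; exact: mpow.
- by move=> k x _; rewrite lee_fin powR_ge0.
rewrite limn_einf_lim; apply: lime_le; first exact: is_cvg_einfs.
apply: nearW => k; apply: ge_ereal_inf.
exists (\int[mu]_(x in D) F k x)%E; first by exists k => /=.
have [Sp _ slp] := pP k; apply: S_sobolev => //.
by rewrite mulr_gt0.
Qed.

Let sigma_gt0 : 0 < sigma. Proof. exact: lt_trans sigma1. Qed.

Lemma slope_energy_eq0 v : completion v -> slope_energy v.2 = 0 ->
  (\int[mu]_(x in D) (`|v.1 x| `^ (2 * sigma))%:E = 0)%E.
Proof.
move=> cv sl0; set I := (integral _ _ _).
have I0 : (0 <= I)%E by apply: integral_ge0 => x _; rewrite lee_fin powR_ge0.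
have Ile (eta0 : R) : 0 < eta0 -> (I <= ((C * (2 * eta0)) `^ sigma)%:E)%E.
  by move=> eta00; apply: completion_sobolev => //; rewrite sl0 lte_fin.
have {Ile} Ile (r : R) : 0 < r -> (I <= r%:E)%E.
  move=> r0; have C20 : C * 2 != 0 by rewrite mulf_neq0// gt_eqF.
  have -> : r = (C * (2 * (r `^ sigma^-1 / (C * 2)))) `^ sigma.
    rewrite mulrA mulrCA mulfV// mulr1 -powRrM mulVf ?(gt_eqF sigma_gt0)//.
    by rewrite powRr1// ltW.
  by apply: Ile; rewrite divr_gt0 ?powR_gt0// mulr_gt0.
apply/eqP; rewrite eq_le I0 andbT; apply/lee_addgt0Pr => e e0.
by rewrite add0e; exact: Ile.
Qed.

(** Otherwise composing [v] with [plateau c^-1] would give the pair [(1, 0)],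
    whose slope energy vanishes although its value does not. *)
Lemma completion_value_lt v (c : R) : completion v -> (0 < mu D)%E -> 0 < c ->
  ~ forall x, D x -> c <= v.1 x.
Proof.
move=> cv D0 c0 cv1; pose N := c^-1.
pose w : gpair := (plateau N \o v.1, fun x => plateau' N (v.1 x) *: v.2 x).
have cw : completion w := completion_comp (C11_plateau N) (plateau0 N) cv.
have w1 x : D x -> plateau N (v.1 x) = 1 /\ plateau' N (v.1 x) = 0.
  by move=> Dx; apply: plateau_eq1; rewrite mulrC -ler_pdivrMr ?invr_gt0// mul1r invrK cv1.
have sl0 : slope_energy w.2 = 0.
  rewrite /slope_energy -[RHS](integral0 mu D); apply: eq_integral => x.
  rewrite inE => Dx; rewrite /slope /w /= (w1 x Dx).2 sqr_sqrt_normZ.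
  by rewrite expr0n mul0r.
move: (slope_energy_eq0 cw sl0).
rewrite (eq_integral (cst 1%E)); last first.
  by move=> x; rewrite inE => Dx; rewrite /w /= (w1 x Dx).1 normr1 powR1.
by rewrite integral_cst// mul1e => D00; rewrite D00 ltxx in D0.
Qed.

(** * Energy of subsolutions *)

(** [E] is the set of full measure on which the almost everywhere assumptions on
    the coefficients hold. The lower order terms enter through the vector
    fields [gam], the sum of the [G_i S_i], and [eta], the sum of the
    [H_i R_i]; subunitarity bounds them by [b] times the slope. *)
Variables (E : set T) (P : T -> 'M[R]_n) (gam eta : T -> 'rV[R]_n) (b F : T -> R).
Hypotheses (mE : measurable E) (ED : E `<=` D) (fE : (mu E < +oo)%E).
Hypotheses (mgam : forall i, measurable_fun E (fun x => gam x 0 i))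
  (meta : forall i, measurable_fun E (fun x => eta x 0 i)).
Hypotheses (mb : measurable_fun E b) (mF : measurable_fun E F).
Hypothesis gam_le : forall x xi, E x -> `|dotv (gam x) xi| <= b x * sqrt_norm (Q x) xi.
Hypothesis eta_le : forall x xi, E x -> `|dotv (eta x) xi| <= b x * sqrt_norm (Q x) xi.
Hypothesis b_ge0 : forall x, E x -> 0 <= b x.
Let sigma' := sigma / (sigma - 1).
Hypothesis ib : mu.-integrable E (fun x => (b x `^ (2 * sigma'))%:E).
Hypothesis iF : mu.-integrable E (fun x => (`|F x| `^ sigma')%:E).

Let sigma'_gt0 : 0 < sigma'. Proof. by rewrite divr_gt0// subr_gt0. Qed.
Let conj_sigma : sigma'^-1 + sigma^-1 = 1.
Proof. by rewrite /sigma' invf_div; field; rewrite gt_eqF. Qed.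
Local Notation rintegrable := (rintegrable mu E).
Local Notation rintegrableD := (rintegrableD mE).
Local Notation rintegrableZ := (rintegrableZ mE).
Local Notation rintegrable_le := (rintegrable_le mE).

Lemma young_conj (a c : R) : 0 <= a -> 0 <= c -> a * c <= a `^ sigma' + c `^ sigma.
Proof.
move=> a0 c0; apply: le_trans (conjugate_powR a0 c0 sigma'_gt0 sigma_gt0 conj_sigma) _.
apply: lerD; rewrite ler_piMr ?powR_ge0//.
  rewrite -conj_sigma lerDl invr_ge0 ltW//.
by rewrite -conj_sigma lerDr invr_ge0 ltW.
Qed.

Lemma sigma'_ge1 : 1 <= sigma'.
Proof. by rewrite /sigma' ler_pdivlMr ?subr_gt0// mul1r gerBl. Qed.

(** An integrable function above all the products that occur in the form, by
    Young's inequality with the exponents [sigma'] and [sigma]. *)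
Definition dominator v (x : T) : R :=
  1 + 2 * `|F x| `^ sigma' + 2 * b x `^ (2 * sigma') +
  `|v.1 x| `^ (2 * sigma) + slope v.2 x ^+ 2.

Lemma dominatorP v x : E x ->
  [/\ `|F x * v.1 x ^+ 2| <= dominator v x,
      b x * `|v.1 x| * slope v.2 x <= dominator v x,
      `|F x * v.1 x| <= dominator v x & b x * slope v.2 x <= dominator v x].
Proof.
move=> Ex; have b0 := b_ge0 Ex; have s0 := slope_ge0 v.2 x.
have y1 := young_conj (normr_ge0 (F x)) (sqr_ge0 (v.1 x)).
have y2 := young_conj (sqr_ge0 (b x)) (sqr_ge0 (v.1 x)).
have y3 := le_1D_powR sigma'_ge1 (normr_ge0 (F x)).
have y4 := le_1D_powR sigma'_ge1 (sqr_ge0 (b x)).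
move: y1 y2 y4; rewrite !sqr_powR (ger0_norm b0) /dominator.
have := powR_ge0 `|F x| sigma'; have := powR_ge0 (b x) (2 * sigma').
have := powR_ge0 `|v.1 x| (2 * sigma).
set Y := `|v.1 x| `^ _; set B := b x `^ _; set Fs := `|F x| `^ _ in y3 *.
move=> Y0 B0 F0 y1 y2 y4; rewrite (normrM _ (v.1 x ^+ 2)) (ger0_norm (sqr_ge0 (v.1 x))) (normrM _ (v.1 x)).
have v2 : `|v.1 x| ^+ 2 = v.1 x ^+ 2 by rewrite real_normK ?num_real.
have a0 := normr_ge0 (v.1 x); have n0 := normr_ge0 (F x).
set w := slope v.2 x in s0 *; have w2 := sqr_ge0 w.
split.
- by lra.
- have := sqr_ge0 (b x * `|v.1 x| - w); rewrite -v2 in y2; nra.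
- have : `|v.1 x| <= 1 + v.1 x ^+ 2 by rewrite -v2; nra.
  move=> /(ler_wpM2l n0); lra.
- have := sqr_ge0 (b x - w); nra.
Qed.

Lemma integrable_dominator v : completion v -> rintegrable (dominator v).
Proof.
move=> cv; have [[mv1 mv2 fv1 fv2] _] := cv.
have iD := integrable_sqr (measurable_slope mv2) fv2.
have iw : mu.-integrable E (EFin \o (fun x => slope v.2 x ^+ 2)).
  exact: integrableS iD.
have iY : mu.-integrable E (EFin \o (fun x => `|v.1 x| `^ (2 * sigma))).
  apply: (@integrableS _ _ _ mu D) => //; apply/integrableP; split.
    by apply/measurable_EFinP; exact: measurable_powR_norm.
  under eq_integral do rewrite /= ger0_norm ?powR_ge0//.
  have [eta_ uE] : exists e : R, (slope_energy v.2 < e%:E)%E.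
    have := value_energy_ge0 (slope v.2); move: fv2; rewrite /slope_energy.
    case: (value_energy _) => // r _ _; exists (r + 1); rewrite lte_fin ltrDl//.
  by apply: le_lt_trans (completion_sobolev cv uE) _; exact: ltry.
have i1 : mu.-integrable E (EFin \o cst (1 : R)).
  apply/integrableP; split; first exact/measurable_EFinP.
  by under eq_integral do rewrite /= normr1; rewrite integral_cst// mul1e.
apply: rintegrableD iw; apply: rintegrableD iY.
apply: rintegrableD; last exact: rintegrableZ ib.
by apply: rintegrableD i1 _; exact: rintegrableZ iF.
Qed.

Definition GS v (x : T) : R := dotv (gam x) (v.2 x).

Definition HR v (x : T) : R := dotv (eta x) (v.2 x).

Lemma measurable_lower_order v : completion v ->
  [/\ measurable_fun E v.1, measurable_fun E (GS v) & measurable_fun E (HR v)].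
Proof.
move=> [[mv1 mv2 _ _] _].
have mE2 i : measurable_fun E (fun x => v.2 x 0 i) by exact: measurable_funS (mv2 i).
split; [exact: measurable_funS mv1|exact: measurable_dotv|exact: measurable_dotv].
Qed.

Lemma lower_order_le v x : E x ->
  `|GS v x| <= b x * slope v.2 x /\ `|HR v x| <= b x * slope v.2 x.
Proof. by move=> Ex; split; [exact: gam_le|exact: eta_le]. Qed.

Lemma rintegrable_lower_order v : completion v ->
  [/\ rintegrable (fun x => F x * v.1 x ^+ 2), rintegrable (fun x => v.1 x * GS v x),
      rintegrable (fun x => v.1 x * HR v x), rintegrable (fun x => F x * v.1 x) &
      rintegrable (GS v)].
Proof.
move=> cv; have [m1 mG mH] := measurable_lower_order cv.
have iD := integrable_dominator cv.
split; apply: rintegrable_le iD _; try by do ?[exact: measurable_funM|exact: measurable_funX].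
- by apply: measurable_funM => //; exact: measurable_funX.
- by move=> x Ex; have [] := dominatorP v Ex.
- move=> x Ex; have [_ le _ _] := dominatorP v Ex; apply: le_trans le.
  by rewrite normrM mulrAC [leRHS]mulrC ler_wpM2l// (lower_order_le v Ex).1.
- move=> x Ex; have [_ le _ _] := dominatorP v Ex; apply: le_trans le.
  by rewrite normrM mulrAC [leRHS]mulrC ler_wpM2l// (lower_order_le v Ex).2.
- by move=> x Ex; have [] := dominatorP v Ex.
- move=> x Ex; have [_ _ _ le] := dominatorP v Ex; apply: le_trans le.
  exact: (lower_order_le v Ex).1.
Qed.

Hypothesis negativity : forall u v, completion u -> completion v ->
  (forall x, D x -> 0 <= u.1 x * v.1 x) ->
  (0 <= \int[mu]_(x in E) (F x * u.1 x * v.1 x +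
                           (u.1 x * GS v x + v.1 x * GS u x))%:E)%E.

(** The negativity condition for [v] and [w k = plateau k.+1 \o v]. As [k] grows,
    [w k] tends to the indicator of [v > 0], while
    [v GS (w k) = v * plateau' k.+1 v * GS v] tends to [0], so that the
    integrand tends to [F v + GS v]. *)
Lemma negativity_cone v : completion v -> (forall x, D x -> 0 <= v.1 x) ->
  (forall x, E x -> v.1 x = 0 -> v.2 x = 0) ->
  (0 <= \int[mu]_(x in E) (F x * v.1 x + GS v x)%:E)%E.
Proof.
move=> cv v0 vv2; have [m1 mG _] := measurable_lower_order cv.
pose w k : gpair := (plateau k.+1%:R \o v.1, fun x => plateau' k.+1%:R (v.1 x) *: v.2 x).
have cw k : completion (w k) := completion_comp (C11_plateau _) (plateau0 _) cv.
pose f k x : R := F x * v.1 x * (w k).1 x + (v.1 x * GS (w k) x + (w k).1 x * GS v x).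
have lim : (\int[mu]_(x in E) (f k x)%:E @[k --> \oo] -->
            \int[mu]_(x in E) (F x * v.1 x + GS v x)%:E)%E.
  have iD := rintegrableZ 4 (integrable_dominator cv).
  apply: (integral_dominated_cvg mE _ _ iD) => [k||k x Ex|x Ex].
  - have [mw1 mwG _] := measurable_lower_order (cw k).
    by apply: measurable_funD; [|apply: measurable_funD];
      do ?apply: measurable_funM.
  - by apply: measurable_funD => //; exact: measurable_funM.
  - have [_ _ Fv bs] := dominatorP v Ex; have [Gle _] := lower_order_le v Ex.
    have Ns : 0 <= k.+1%:R * v.1 x by rewrite mulr_ge0// v0//; exact: ED.
    have [/andP[p0 p1] /andP[q0 q2]] := plateau_01 Ns.
    have GwE : v.1 x * GS (w k) x = v.1 x * plateau' k.+1%:R (v.1 x) * GS v x.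
      by rewrite /GS /= dotvZr mulrA.
    rewrite /f GwE -[(w k).1 x]/(plateau k.+1%:R (v.1 x)).
    have d0 : 0 <= dominator v x by exact: le_trans (normr_ge0 _) Fv.
    have {Gle bs} Gle := le_trans Gle bs.
    apply: le_trans (ler_normD _ _) _.
    have : `|F x * v.1 x * plateau k.+1%:R (v.1 x)| <= dominator v x.
      rewrite normrM (ger0_norm p0) -[leRHS]mulr1; exact: ler_pM.
    have : `|v.1 x * plateau' k.+1%:R (v.1 x) * GS v x| <= 2 * dominator v x.
      by rewrite normrM (ger0_norm q0); exact: ler_pM.
    have : `|plateau k.+1%:R (v.1 x) * GS v x| <= 1 * dominator v x.
      by rewrite normrM (ger0_norm p0); exact: ler_pM.
    have := ler_normD (v.1 x * plateau' k.+1%:R (v.1 x) * GS v x)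
       (plateau k.+1%:R (v.1 x) * GS v x); lra.
  - have [vx0|vx0] := eqVneq (v.1 x) 0.
      have G0 : GS v x = 0 by rewrite /GS vv2// -(scale0r 0) dotvZr mul0r.
      apply: cvg_near_cst; apply: nearW => k.
      by rewrite /f vx0 G0 !(mulr0, mul0r, addr0).
    have {}vx0 : 0 < v.1 x by rewrite lt_neqAle eq_sym vx0 v0//; exact: ED.
    apply: cvg_near_cst; near=> k.
    have : 1 <= k.+1%:R * v.1 x by near: k; exact: natr_gt_near.
    move=> /plateau_eq1[p1 p0].
    by rewrite /f /GS /w /= p1 p0 scale0r -(scale0r 0) dotvZr !(mulr1, mul0r, mulr0, mul1r, add0r).
rewrite -(cvg_lim _ lim)//; apply: lime_ge; first by apply/cvg_ex; eexists; exact: lim.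
apply: nearW => k; apply: (negativity cv (cw k)) => x Dx.
have Ns : 0 <= k.+1%:R * v.1 x by rewrite mulr_ge0// v0.
by have [/andP[p0 p1] _] := plateau_01 Ns; rewrite mulr_ge0// v0.
Unshelve. all: by end_near. Qed.

Definition operator_form u v (x : T) : R :=
  dotv (v.2 x) (mxact (P x) (u.2 x)) + v.1 x * HR u x + u.1 x * GS v x +
  F x * u.1 x * v.1 x.

Variable c1 : R.
Hypothesis c1_gt0 : 0 < c1.
Hypothesis elliptic : forall x xi, E x ->
  c1 * sqrt_norm (Q x) xi ^+ 2 <= dotv xi (mxact (P x) xi).

(** The restriction to a nonzero slope costs nothing in the energy estimate,
    where [b * v] occurs multiplied by the slope; it makes the activity below
    vanish in the limit. *)
Definition active v (x : T) : R := if slope v.2 x != 0 then b x ^+ 2 else 0.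

(** Where [u > k] one has [u = v + k] and equal gradients, for
    [v = truncate k u]; elsewhere every term contains a factor [0]. *)
Lemma operator_form_truncate u k x :
  operator_form u (truncate k u) x =
  dotv ((truncate k u).2 x) (mxact (P x) ((truncate k u).2 x)) +
  (truncate k u).1 x * (HR (truncate k u) x - GS (truncate k u) x) +
  (F x * (truncate k u).1 x ^+ 2 + 2 * ((truncate k u).1 x * GS (truncate k u) x)) +
  k * (F x * (truncate k u).1 x + GS (truncate k u) x).
Proof.
rewrite /operator_form /HR /GS /=; have [uk|ku] := leP (u.1 x) k.
  rewrite max_r ?subr_le0// scale0r -(scale0r 0) !(dotvZr, dotvZl).
  by rewrite !(mul0r, mulr0, add0r, addr0) ?expr0n ?mulr0.
rewrite max_l ?subr_ge0 ?ltW// scale1r; ring.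
Qed.

Lemma measurable_active v : completion v -> measurable_fun E (active v).
Proof.
move=> [[_ mv2 _ _] _]; have ms := measurable_slope mv2.
have {}ms : measurable_fun E (slope v.2) by exact: measurable_funS ms.
apply: measurable_if => //; last exact: measurable_funX.
rewrite (_ : (fun x => _) = (fun x => ~~ (slope v.2 x == 0))) //.
apply: measurableT_comp => //; exact: measurable_fun_eqr.
Qed.

Lemma rintegrable_active v : completion v ->
  rintegrable (fun x => active v x * v.1 x ^+ 2).
Proof.
move=> cv; have [m1 _ _] := measurable_lower_order cv.
apply: rintegrable_le (integrable_dominator cv) _ => [|x Ex].
  by apply: measurable_funM; [exact: measurable_active|exact: measurable_funX].
have y2 := young_conj (sqr_ge0 (b x)) (sqr_ge0 (v.1 x)).
rewrite !sqr_powR (ger0_norm (b_ge0 Ex)) in y2.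
have a0 : 0 <= active v x by rewrite /active; case: ifP => // _; exact: sqr_ge0.
have ab : active v x <= b x ^+ 2 by rewrite /active; case: ifP => // _; exact: sqr_ge0.
rewrite ger0_norm; last by rewrite mulr_ge0// sqr_ge0.
apply: le_trans (ler_wpM2r (sqr_ge0 (v.1 x)) ab) _; rewrite /dominator.
have := powR_ge0 `|F x| sigma'; have := sqr_ge0 (slope v.2 x).
have := powR_ge0 (b x) (2 * sigma'); lra.
Qed.

(** The two brackets of [operator_form_truncate] have nonnegative integrals by
    the negativity condition and [negativity_cone]; here [k >= 0] matters. The
    remaining cross term is at most [2 * b * v] times the slope, and Young's
    inequality moves half of the energy to the left. *)
Lemma energy_estimate u k : 0 <= k -> completion (truncate k u) ->
  rintegrable (operator_form u (truncate k u)) ->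
  (\int[mu]_(x in E) (operator_form u (truncate k u) x)%:E <= 0)%E ->
  ((c1 / 2)%:E * \int[mu]_(x in E) (slope (truncate k u).2 x ^+ 2)%:E <=
   (2 / c1)%:E * \int[mu]_(x in E)
     (active (truncate k u) x * (truncate k u).1 x ^+ 2)%:E)%E.
Proof.
move=> k0 cv iform form0; set v := truncate k u in cv iform form0 *.
have [m1 mG mH] := measurable_lower_order cv.
have [iFv2 ivG ivH iFv iG] := rintegrable_lower_order cv.
have ia := rintegrable_active cv.
have is2 : rintegrable (fun x => slope v.2 x ^+ 2).
  have [[_ mv2 _ fv2] _] := cv.
  exact: integrableS (integrable_sqr (measurable_slope mv2) fv2).
have v0 x : 0 <= v.1 x by rewrite /v /= le_max lexx orbT.
have N1 : (0 <= \int[mu]_(x in E) (F x * v.1 x ^+ 2 + 2 * (v.1 x * GS v x))%:E)%E.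
  have := negativity cv cv (fun x _ => mulr_ge0 (v0 x) (v0 x)).
  congr (_ <= _)%E; apply: eq_integral => x _; congr EFin; ring.
have N2 : (0 <= \int[mu]_(x in E) (F x * v.1 x + GS v x)%:E)%E.
  apply: negativity_cone => // x Ex; rewrite /v /=.
  have [uk _|ku] := leP (u.1 x) k; first by rewrite scale0r.
  by rewrite max_l ?subr_ge0 ?(ltW ku)// => ?; exfalso; lra.
have iN1 := rintegrableD iFv2 (rintegrableZ 2 ivG).
have iN2 := rintegrableZ k (rintegrableD iFv iG).
have pt x : E x ->
  c1 / 2 * slope v.2 x ^+ 2 + ((F x * v.1 x ^+ 2 + 2 * (v.1 x * GS v x)) +
   k * (F x * v.1 x + GS v x)) <=
  operator_form u v x + 2 / c1 * (active v x * v.1 x ^+ 2).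
  move=> Ex; rewrite operator_form_truncate -/v; have ell := elliptic (v.2 x) Ex.
  have [Gle Hle] := lower_order_le v Ex.
  rewrite -[sqrt_norm _ _]/(slope v.2 x) in ell.
  suff : - (c1 / 2 * slope v.2 x ^+ 2 + 2 / c1 * (active v x * v.1 x ^+ 2)) <=
      v.1 x * (HR v x - GS v x) by lra.
  have : `|v.1 x * (HR v x - GS v x)| <= 2 * b x * v.1 x * slope v.2 x.
    rewrite normrM (ger0_norm (v0 x)).
    have := ler_normB (HR v x) (GS v x); have := ler_wpM2l (v0 x) Gle.
    have := ler_wpM2l (v0 x) Hle.
    move=> h1 h2 /(ler_wpM2l (v0 x)); lra.
  rewrite ler_norml => /andP[+ _]; apply: le_trans; rewrite lerN2.
  rewrite /active; case: eqP => [->|_] /=; first by rewrite mulr0 expr0n/= !mulr0 mul0r mulr0 addr0.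
  rewrite -subr_ge0.
  have -> : c1 / 2 * slope v.2 x ^+ 2 + 2 / c1 * (b x ^+ 2 * v.1 x ^+ 2) -
      2 * b x * v.1 x * slope v.2 x = (2 * c1)^-1 * (c1 * slope v.2 x - 2 * (b x * v.1 x)) ^+ 2.
    by field; rewrite gt_eqF.
  by apply: mulr_ge0 (sqr_ge0 _); rewrite invr_ge0 mulr_ge0// ltW.
have iL := rintegrableD (rintegrableZ (c1 / 2) is2) (rintegrableD iN1 iN2).
have iR := rintegrableD iform (rintegrableZ (2 / c1) ia).
have : (\int[mu]_(x in E) (c1 / 2 * slope v.2 x ^+ 2 +
    ((F x * v.1 x ^+ 2 + 2 * (v.1 x * GS v x)) + k * (F x * v.1 x + GS v x)))%:E <=
  \int[mu]_(x in E) (operator_form u v x + 2 / c1 * (active v x * v.1 x ^+ 2))%:E)%E.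
  by apply: le_integral => // x; rewrite inE => Ex; rewrite lee_fin pt.
have intD (f g : T -> R) : rintegrable f -> rintegrable g ->
    (\int[mu]_(x in E) (f x + g x)%:E =
     \int[mu]_(x in E) (f x)%:E + \int[mu]_(x in E) (g x)%:E)%E.
  by move=> rf rg; exact: (integralD mE rf rg).
have intZ (a : R) (f : T -> R) : rintegrable f ->
    (\int[mu]_(x in E) (a * f x)%:E = a%:E * \int[mu]_(x in E) (f x)%:E)%E.
  by move=> rf; exact: (integralZl mE rf).
have iF2 := rintegrableD iFv iG.
rewrite (intD _ _ (rintegrableZ _ is2) (rintegrableD iN1 iN2)) (intD _ _ iN1 iN2).
rewrite (intD _ _ iform (rintegrableZ _ ia)) (intZ _ _ iF2) (intZ _ _ is2) (intZ _ _ ia).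
move=> H; apply: (le_trans _ (le_trans H _)).
  by rewrite leeDl// adde_ge0// mule_ge0// lee_fin.
by rewrite -[leRHS]add0e leeD2r.
Qed.

Hypothesis DE0 : mu (D `\` E) = 0.

Lemma integral_full_set (f : T -> R) : measurable_fun D f -> (forall x, D x -> 0 <= f x) ->
  (\int[mu]_(x in D) (f x)%:E = \int[mu]_(x in E) (f x)%:E)%E.
Proof.
move=> mf f0; rewrite (@ge0_negligible_integral _ _ _ _ D (D `\` E))//.
- by rewrite setDD setIC; move/setIidl : ED => ->.
- exact: measurableD.
- exact/measurable_EFinP.
Qed.

Definition ae_le u (k : R) := {ae mu, forall x, E x -> u.1 x <= k}.

Lemma slope_truncate u k x :
  slope (truncate k u).2 x ^+ 2 = (k < u.1 x)%R%:R * slope u.2 x ^+ 2.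
Proof. by rewrite /slope /= sqr_sqrt_normZ; case: (_ < _); rewrite ?expr1n ?expr0n. Qed.

Lemma sqr_powR_active v x : E x ->
  active v x `^ sigma' = if slope v.2 x != 0 then b x `^ (2 * sigma') else 0.
Proof.
move=> Ex; rewrite /active; case: ifP => _.
  by rewrite sqr_powR ger0_norm// b_ge0.
by rewrite powR0// gt_eqF.
Qed.

Lemma slope_energy_eq0_ae_le u k : completion (truncate k u) ->
  slope_energy (truncate k u).2 = 0 -> ae_le u k.
Proof.
move=> cv sl0; set v := truncate k u in cv sl0.
have [[mv1 _ _ _] _] := cv.
have I0 := slope_energy_eq0 cv sl0.
pose Y x : R := `|v.1 x| `^ (2 * sigma).
have mY : measurable_fun D (EFin \o Y).
  by apply/measurable_EFinP; exact: measurable_powR_norm.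
have /(ae_eq_integral_abs mu mD mY) : (\int[mu]_(x in D) `|(EFin \o Y) x|)%E = 0%E.
  rewrite -I0; apply: eq_integral => x _; rewrite /= ger0_norm// powR_ge0//.
apply: filterS => x /= vx Ex; have /eqP := vx (ED Ex).
rewrite eqe powR_eq0 normr_eq0 mulf_eq0 (gt_eqF sigma_gt0) pnatr_eq0/= andbT.
move=> /eqP vx0; rewrite leNgt; apply/negP => ku; move: vx0.
by rewrite /v /= max_l ?subr_ge0 ?(ltW ku)// => /eqP; rewrite subr_eq0 gt_eqF.
Qed.

Definition activity u k (x : T) : R :=
  if slope (truncate k u).2 x != 0 then b x `^ (2 * sigma') else 0.

(** Hoelder's inequality bounds the right-hand side of the energy estimate by the
    activity to the power [sigma'^-1] times the norm of [v] of order
    [2 * sigma], and Sobolev's inequality bounds the latter by the energy. When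
    the activity is small, the energy is at most half of itself. *)
Lemma small_activity_ae_le : exists2 a : R, 0 < a &
  forall u k, 0 <= k -> completion (truncate k u) ->
  rintegrable (operator_form u (truncate k u)) ->
  (\int[mu]_(x in E) (operator_form u (truncate k u) x)%:E <= 0)%E ->
  (\int[mu]_(x in E) (activity u k x)%:E <= a%:E)%E -> ae_le u k.
Proof.
pose A := 2 / c1 / (c1 / 2).
have A0 : 0 < A by rewrite !divr_gt0.
have t0 : 0 < (8 * A * C)^-1 by rewrite invr_gt0 mulr_gt0// mulr_gt0.
(* [A * a^(1/sigma') * (4 * C)] is the factor in front of the energy, and it
   equals [1/2] for this value of [a] *)
exists ((8 * A * C)^-1 `^ sigma') => [|u k k0 cv iform form0 act_le].
  by rewrite powR_gt0.
have := energy_estimate k0 cv iform form0.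
set v := truncate k u in cv iform form0 act_le *.
have [[mv1 mv2 fv1 fv2] _] := cv.
have mE_active := measurable_active cv.
have SE : slope_energy v.2 = (\int[mu]_(x in E) (slope v.2 x ^+ 2)%:E)%E.
  apply: integral_full_set => [|x _]; last exact: sqr_ge0.
  exact: measurable_sqr_slope.
rewrite -SE; have := value_energy_ge0 (slope v.2); rewrite -/(slope_energy v.2).
case sle : (slope_energy v.2) fv2 => [e||]// _; rewrite lee_fin le_eqVlt.
move=> /orP[/eqP e0|e0].
  by move=> _; apply: slope_energy_eq0_ae_le => //; rewrite sle -e0.
have /(completion_sobolev cv) : (slope_energy v.2 < (2 * e)%:E)%E.
  by rewrite sle lte_fin; lra.
rewrite integral_full_set; last 2 first.
- exact: measurable_powR_norm.
- by move=> x _; exact: powR_ge0.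
move=> sob.
have hold : (\int[mu]_(x in E) (active v x * v.1 x ^+ 2)%:E <=
    (((8 * A * C)^-1 `^ sigma') `^ sigma'^-1 *
     ((C * (2 * (2 * e))) `^ sigma) `^ sigma^-1)%:E)%E.
  apply: (holder_bound mE mE_active _ _ _ sigma'_gt0 sigma_gt0 conj_sigma).
  - by apply: measurable_funX; exact: measurable_funS mv1.
  - by move=> x _; rewrite /active; case: ifP => // _; exact: sqr_ge0.
  - by move=> x _; exact: sqr_ge0.
  - by rewrite powR_gt0.
  - by rewrite powR_gt0// !mulr_gt0.
  - apply: le_trans act_le; rewrite le_eqVlt; apply/orP; left; apply/eqP.
    by apply: eq_integral => x; rewrite inE => Ex; rewrite sqr_powR_active.
  - apply: le_trans sob; rewrite le_eqVlt; apply/orP; left; apply/eqP.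
    by apply: eq_integral => x _; rewrite sqr_powR.
move=> est; exfalso; move: hold; rewrite (powRK sigma'_gt0 t0) (powRK sigma_gt0); last by rewrite !mulr_gt0.
have c20 : (0 <= (2 / c1)%:E)%E by rewrite lee_fin divr_ge0// ltW.
move=> /(lee_wpmul2l c20)/(le_trans est); rewrite -!EFinM lee_fin.
have -> : 2 / c1 * ((8 * A * C)^-1 * (C * (2 * (2 * e)))) = c1 / 2 * (e / 2).
  by rewrite /A; field; rewrite !gt_eqF.
rewrite ler_pM2l ?divr_gt0//; lra.
Qed.

Lemma truncate_truncate u k0 k : k0 <= k ->
  truncate (k - k0) (truncate k0 u) = truncate k u.
Proof.
move=> kk; rewrite /truncate /=; congr pair; apply/funext => x.
  have [uk|ku] := leP (u.1 x) k0.
    rewrite (@max_r _ _ (u.1 x - k0)) ?subr_le0// !max_r//.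
      by rewrite subr_le0 (le_trans uk).
    by rewrite sub0r oppr_le0 subr_ge0.
  rewrite (@max_l _ _ (u.1 x - k0)) ?subr_ge0 ?(ltW ku)//.
  by congr Num.max; ring.
have [uk|ku] := leP (u.1 x) k0.
  by rewrite scale0r scaler0 ltNge (le_trans uk)//= scale0r.
rewrite scale1r max_l ?subr_ge0 ?(ltW ku)//; congr (_ *: _).
by rewrite ltrD2r.
Qed.

Lemma activityE u k x : activity u k x =
  if (k < u.1 x) && (slope u.2 x != 0) then b x `^ (2 * sigma') else 0.
Proof.
rewrite /activity -sqrf_eq0 slope_truncate mulf_eq0 sqrf_eq0 negb_or.
by case: (_ < _); rewrite ?oner_eq0 ?eqxx.
Qed.

(** * Levels that bound a subsolution *)

Section maximum_principle.
Variables (u : gpair) (k0 : R).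
Hypotheses (k0_ge0 : 0 <= k0) (mu1 : measurable_fun D u.1) (mu2 : vector_measurable u.2).
Hypothesis u_le_bd : completion (truncate k0 u).
Hypothesis subsolution : forall k, k0 <= k -> completion (truncate k u) ->
  rintegrable (operator_form u (truncate k u)) /\
  (\int[mu]_(x in E) (operator_form u (truncate k u) x)%:E <= 0)%E.

Let cv k : k0 <= k -> completion (truncate k u).
Proof.
by move=> kk; rewrite -(truncate_truncate _ kk); apply: completion_truncate => //;
  rewrite subr_ge0.
Qed.

Let mE1 : measurable_fun E u.1. Proof. exact: measurable_funS mu1. Qed.
Let mEs : measurable_fun E (slope u.2).
Proof. exact: measurable_funS (measurable_slope mu2). Qed.
Let mEsn : measurable_fun E (fun x => slope u.2 x != 0).
Proof.
rewrite (_ : (fun x => _) = (fun x => ~~ (slope u.2 x == 0))) //.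
by apply: measurableT_comp => //; exact: measurable_fun_eqr.
Qed.

Let mb2 : measurable_fun E (fun x => b x `^ (2 * sigma')).
Proof. by apply/measurable_EFinP; case/integrableP: ib. Qed.

Let mact k : measurable_fun E (activity u k).
Proof.
rewrite (_ : activity u k = (fun x => if (k < u.1 x) && (slope u.2 x != 0)
  then b x `^ (2 * sigma') else 0)); last by apply/funext => x; rewrite activityE.
apply: measurable_if => //; apply: measurable_and => //.
exact: measurable_fun_ltr.
Qed.

Let act_le k x : E x -> `|activity u k x| <= b x `^ (2 * sigma').
Proof.
move=> _; rewrite activityE; case: ifP => _; rewrite ?normr0 ?powR_ge0//.
by rewrite ger0_norm ?powR_ge0.
Qed.

(** If the activity at levels that do not bound [u] tended to [0], then one of
    them would bound [u]. *)
Lemma vanishing_activity (k : nat -> R) (f : T -> R) :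
  (forall m, k0 <= k m) -> (forall m, ~ ae_le u (k m)) ->
  measurable_fun E f ->
  (forall x, E x -> activity u (k m) x @[m --> \oo] --> f x) ->
  (\int[mu]_(x in E) (f x)%:E = 0)%E -> False.
Proof.
move=> kk0 bad mf af f0; have [a a0 small] := small_activity_ae_le.
have act0 : (\int[mu]_(x in E) (activity u (k m) x)%:E @[m --> \oo] --> 0)%E.
  rewrite -f0; apply: (integral_dominated_cvg mE _ mf ib) => // m x Ex.
  exact: act_le.
have [m _ /(_ _ (leqnn m)) am] : \forall m \near \oo,
    (\int[mu]_(x in E) (activity u (k m) x)%:E < a%:E)%E.
  by apply: cvge_near_lt act0 _; rewrite lte_fin.
have [iform form0] := subsolution (kk0 m) (cv (kk0 m)).
apply: (bad m); apply: small (cv (kk0 m)) iform form0 (ltW am).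
exact: le_trans k0_ge0 (kk0 m).
Qed.

Let A := 2 / c1 / (c1 / 2).

(** Where [u <= M], the truncation at [k] takes values in [[0, M - k]]. *)
Lemma slope_energy_level k M : k0 <= k -> k <= M -> ae_le u M ->
  (\int[mu]_(x in E) (slope (truncate k u).2 x ^+ 2)%:E <=
   (A * (M - k) ^+ 2)%:E * \int[mu]_(x in E) (b x ^+ 2)%:E)%E.
Proof.
move=> kk0 kM uM; have cvk := cv kk0; have [iform form0] := subsolution kk0 cvk.
have est := energy_estimate (le_trans k0_ge0 kk0) cvk iform form0.
have [m1 _ _] := measurable_lower_order cvk.
have cc : 0 < c1 / 2 by rewrite divr_gt0.
have : (\int[mu]_(x in E) (active (truncate k u) x * (truncate k u).1 x ^+ 2)%:E <=
    ((M - k) ^+ 2)%:E * \int[mu]_(x in E) (b x ^+ 2)%:E)%E.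
  rewrite -ge0_integralZl_EFin//; last 3 first.
  - by move=> x _; rewrite lee_fin sqr_ge0.
  - by apply/measurable_EFinP; exact: measurable_funX.
  - exact: sqr_ge0.
  apply: ae_ge0_le_integral => //.
  - move=> x _; rewrite lee_fin mulr_ge0 ?sqr_ge0// /active.
    by case: ifP => // _; exact: sqr_ge0.
  - apply/measurable_EFinP; apply: measurable_funM; last exact: measurable_funX.
    exact: measurable_active.
  - by move=> x _; rewrite -EFinM lee_fin; apply: mulr_ge0; exact: sqr_ge0.
  - apply: measurable_funeM; apply/measurable_EFinP; exact: measurable_funX.
  - apply: filterS uM => x uxM Ex; rewrite -EFinM lee_fin mulrC.
    apply: ler_pM; rewrite ?sqr_ge0//.
    + by rewrite /active; case: ifP => // _; exact: sqr_ge0.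
    + apply: ler_sqr_norm; rewrite ger0_norm /= ?le_max ?lexx ?orbT//.
      by rewrite ge_max subr_ge0 kM andbT lerD2r; exact: uxM.
    + by rewrite /active; case: ifP => // _; exact: sqr_ge0.
have c20 : (0 <= (2 / c1)%:E)%E by rewrite lee_fin divr_ge0// ltW.
move=> /(lee_wpmul2l c20)/(le_trans est).
have V0 : (0 <= ((c1 / 2)^-1)%:E)%E by rewrite lee_fin invr_ge0 ltW.
move=> /(lee_wpmul2l V0); rewrite !muleA -!EFinM mulVf ?gt_eqF// mul1e.
by rewrite /A (mulrC (2 / c1)).
Qed.

(** On the set [M <= u] the slope of [u] is that of its truncation at every
    [k < M], whose energy is of order [(M - k) ^+ 2]. *)
Lemma slope_eq0_at_max M : k0 < M -> ae_le u M ->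
  (\int[mu]_(x in E) (if M <= u.1 x then slope u.2 x ^+ 2 else 0)%:E = 0)%E.
Proof.
move=> kM uM.
have [B B0 bB] : exists2 B : R, 0 <= B & (\int[mu]_(x in E) (b x ^+ 2)%:E = B%:E)%E.
  have : (\int[mu]_(x in E) (b x ^+ 2)%:E < +oo)%E.
    have ic : rintegrable (fun x => 1 + b x `^ (2 * sigma')).
      apply: rintegrableD ib.
      apply/integrableP; split; first exact/measurable_EFinP.
      by under eq_integral do rewrite /= normr1; rewrite integral_cst// mul1e.
    have : rintegrable (fun x => b x ^+ 2).
      apply: rintegrable_le ic _ => [|x Ex]; first exact: measurable_funX.
      rewrite ger0_norm ?sqr_ge0//; have := le_1D_powR sigma'_ge1 (sqr_ge0 (b x)).
      by rewrite sqr_powR (ger0_norm (b_ge0 Ex)).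
    move=> /integrableP[_]; under eq_integral do rewrite /= ger0_norm ?sqr_ge0//.
    by [].
  have : (0 <= \int[mu]_(x in E) (b x ^+ 2)%:E)%E.
    by apply: integral_ge0 => x _; rewrite lee_fin sqr_ge0.
  by case: (integral _ _ _) => // B B0 _; exists B.
have A0 : 0 < A by rewrite !divr_gt0.
apply/eqP; rewrite eq_le; apply/andP; split; last first.
  by apply: integral_ge0 => x _; case: ifP => // _; rewrite lee_fin sqr_ge0.
apply/lee_addgt0Pr => e e0; rewrite add0e.
have [m _ /(_ _ (leqnn m)) me] : \forall m \near \oo,
    A * (M - k0) ^+ 2 * B <= m.+1%:R * e by exact: natr_gt_near.
pose k := M - (M - k0) / m.+1%:R.
have dM : 0 < (M - k0) / m.+1%:R by rewrite divr_gt0// subr_gt0.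
have kkM : k < M by rewrite /k ltrBlDr ltrDl.
have k0k : k0 <= k.
  by rewrite /k lerBrDl -lerBrDr ler_pdivrMr// ler_peMr ?subr_ge0 ?(ltW kM)// ler1n.
apply: (@le_trans _ _ (\int[mu]_(x in E) (slope (truncate k u).2 x ^+ 2)%:E)%E).
  apply: le_lower_integral => x _.
    by case: ifP => // _; rewrite lee_fin sqr_ge0.
  rewrite lee_fin slope_truncate; case: ifPn => [Mu|_].
    by rewrite (lt_le_trans kkM Mu) mul1r.
  by rewrite mulr_ge0// sqr_ge0.
apply: le_trans (slope_energy_level k0k (ltW kkM) uM) _.
rewrite bB -EFinM lee_fin /k opprB addrCA subrr addr0.
have -> : A * ((M - k0) / m.+1%:R) ^+ 2 * B = (A * (M - k0) ^+ 2 * B) / m.+1%:R ^+ 2.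
  by rewrite exprMn exprVn; ring.
rewrite ler_pdivrMr ?exprn_gt0//; apply: le_trans me _.
by rewrite mulrC ler_wpM2l ?(ltW e0)// expr2 ler_peMr// ler1n.
Qed.

(** In both cases the activity tends to [0] along levels that do not bound [u]:
    if no level bounds [u], along levels tending to infinity; otherwise along
    levels increasing to the least bound [M], with limit the activity on the
    set where [u] is at least [M] and the slope is nonzero, which is null. *)
Lemma ae_le_boundary_level : ae_le u k0.
Proof.
apply: contrapT => bad.
pose K := [set k | k0 <= k /\ ae_le u k].
have [K0|/set0P/negP] := pselect (K !=set0); last first.
  rewrite negbK => /eqP K0.
  apply: (@vanishing_activity (fun m => k0 + m%:R) (cst 0)) => //.
  - by move=> m; rewrite lerDl.
  - move=> m um; have : K (k0 + m%:R) by split=> //; rewrite lerDl.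
    by rewrite K0.
  - move=> x Ex; apply: cvg_near_cst; near=> m; rewrite activityE ltNge.
    rewrite (_ : u.1 x <= k0 + m%:R)// -lerBlDl; near: m; exact: nbhs_infty_ger.
  - exact: integral0.
have infK : has_inf K by split=> //; exists k0 => k [].
pose M := inf K.
have k0M : k0 <= M by apply: lb_le_inf => // k [].
have uM : ae_le u M.
  have : {ae mu, forall x, forall m : nat, E x -> u.1 x <= M + m.+1%:R^-1}.
    apply: ae_foralln => m; have m0 : 0 < m.+1%:R^-1 :> R by rewrite invr_gt0.
    have [k [_ uk] kM] := inf_adherent m0 infK.
    by apply: filterS uk => x ux Ex; rewrite (le_trans (ux Ex))// ltW.
  apply: filterS => x ux Ex; apply/ler_addgt0Pr => e e0.
  have [m _ /(_ _ (leqnn m)) me] : \forall m \near \oo, 1 <= m.+1%:R * e by exact: natr_gt_near.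
  apply: le_trans (ux m Ex) _; rewrite lerD2l -(mul1r _^-1) ler_pdivrMr//.
  by rewrite mulrC.
have {}k0M : k0 < M.
  by rewrite lt_neqAle k0M andbT; apply/eqP => kM; apply: bad; rewrite kM.
pose k (m : nat) := M - (M - k0) / m.+1%:R.
have dM m : 0 < (M - k0) / m.+1%:R by rewrite divr_gt0// subr_gt0.
have kM m : k m < M by rewrite /k ltrBlDr ltrDl.
pose f x := if (M <= u.1 x) && (slope u.2 x != 0) then b x `^ (2 * sigma') else 0.
have mf : measurable_fun E f.
  apply: measurable_if => //; apply: measurable_and => //.
  exact: measurable_fun_ler.
have k0k m : k0 <= k m.
  by rewrite /k lerBrDl -lerBrDr ler_pdivrMr// ler_peMr ?subr_ge0 ?(ltW k0M)// ler1n.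
apply: (@vanishing_activity k f) => //.
- move=> m um; have : M <= k m by apply: ge_inf => //; exists k0 => ? [].
  by rewrite leNgt kM.
- move=> x Ex; apply: cvg_near_cst; rewrite /f.
  have [Mu|uM'] := leP M (u.1 x).
    by apply: nearW => m; rewrite activityE (lt_le_trans (kM m) Mu).
  suff [N _ NP] : \forall m \near \oo, u.1 x <= k m.
    by exists N => // m /NP um; rewrite /= activityE ltNge um.
  have Mu : 0 < M - u.1 x by rewrite subr_gt0.
  have [N _ NP] := natr_gt_near (M - k0) Mu; exists N => // m /NP /= H.
  by rewrite /k lerBrDr -lerBrDl ler_pdivrMr// mulrC.
- pose g x := if M <= u.1 x then slope u.2 x ^+ 2 else 0.
  have mg : measurable_fun E (EFin \o g).
    apply/measurable_EFinP; apply: measurable_if => //.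
      exact: measurable_fun_ler.
    exact: measurable_funX.
  have /(ae_eq_integral_abs mu mE mg) g0 : (\int[mu]_(x in E) `|(EFin \o g) x| = 0)%E.
    rewrite -(slope_eq0_at_max k0M uM); apply: eq_integral => x _.
    by rewrite /= ger0_norm// /g; case: ifP => // _; exact: sqr_ge0.
  rewrite -(integral0 mu E); apply: ae_eq_integral => //.
    exact/measurable_EFinP.
  apply: filterS g0 => x gx Ex; have /eqP := gx Ex; rewrite /= eqe /g /f.
  by case: (M <= _) => //=; rewrite sqrf_eq0 => /eqP ->; rewrite eqxx.
Unshelve. all: by end_near. Qed.
End maximum_principle.

End completion.

(** * Integrability of the coefficients *)

Lemma powR_le1D {R : realType} (a r p : R) : 0 <= a -> 0 < r -> r <= p ->
  a `^ r <= 1 + a `^ p.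
Proof.
move=> a0 r0 rp; have [a1|a1] := leP a 1.
  apply: ler_wpDr; first exact: powR_ge0.
  have := @ge0_ler_powR R r (ltW r0) a 1; rewrite powR1 !nnegrE; exact.
by rewrite ler_wpDl// ler_powR// ltW.
Qed.

(** On a set of finite measure, a function of order [p] is of every order
    [r < p], because [a `^ r <= 1 + a `^ p]. *)
Lemma integrable_powR_Lnorm {d} {T : measurableType d} {R : realType}
    (mu : {measure set T -> \bar R}) (D : set T) (f : T -> R) (r : R) (p : \bar R) :
  measurable D -> (0 < mu D)%E -> (mu D < +oo)%E -> measurable_fun D f ->
  0 < r -> (r%:E < p)%E -> ('N[mu]_p[EFin \o (f \_ D)] < +oo)%E ->
  mu.-integrable D (fun x => (`|f x| `^ r)%:E).
Proof.
move=> mD D0 Doo mf r0 rp fp.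
have mfr (s : R) : measurable_fun D (fun x => (`|f x| `^ s)%:E).
  by apply/measurable_EFinP; exact: measurable_powR_norm.
apply/integrableP; split=> //.
rewrite (eq_integral (fun x => (`|f x| `^ r)%:E)); last first.
  by move=> x _; rewrite gee0_abs// lee_fin powR_ge0.
case: p rp fp => [p|_|//]; first rewrite lte_fin => rp fp.
  have p0 : 0 < p by exact: lt_trans rp.
  have foo : (\int[mu]_(x in D) (`|f x| `^ p)%:E < +oo)%E.
    rewrite (_ : (\int[mu]_(x in D) _)%E = ('N[mu]_p%:E[EFin \o (f \_ D)] `^ p)%E).
      by rewrite poweR_lty.
    rewrite (powR_Lnorm _ _ (lt0r_neq0 p0)).
    rewrite [LHS]integral_mkcond.
    apply: eq_integral => x _.
    by rewrite /= !patchE; case: ifPn => //; rewrite normr0 powR0 ?gt_eqF.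
  apply: (@le_lt_trans _ _ (\int[mu]_(x in D) (1%:E + (`|f x| `^ p)%:E))%E).
    apply: ge0_le_integral => //.
    - by apply: emeasurable_funD.
    - by move=> x _; rewrite -EFinD lee_fin; apply: powR_le1D => //; exact: ltW.
  rewrite ge0_integralD// integral_cst// mul1e.
  exact: lte_add_pinfty.
rewrite unlock ifT; last first.
  by apply: lt_le_trans D0 _; apply: le_measure; rewrite ?inE.
move=> fp; have [M fM] : exists M : R, \forall x \ae mu, (`|(f \_ D) x|%:E <= M%:E)%E.
  case fE : (ess_sup mu _) fp => [y| |] // _.
    by exists y; apply/ess_supP; rewrite fE.
  by exists 0; apply/ess_supP; rewrite fE leNye.
apply: (@le_lt_trans _ _ (\int[mu]_(x in D) (`|M| `^ r)%:E)%E).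
  apply: ae_ge0_le_integral => //.
  apply: filterS fM => x /[swap] Dx; rewrite patchE mem_set// !lee_fin => fM.
  apply: ge0_ler_powR; rewrite ?nnegrE ?(ltW r0)//.
  exact: le_trans fM (ler_norm M).
by rewrite integral_cst// lte_mul_pinfty// lee_fin powR_ge0.
Qed.

(** The larger of [a] and [b] is at least half of [a + b], so that
    [(a + b) `^ r <= 2 `^ r * (a `^ r + b `^ r)]. *)
Lemma integrable_powR_add {d} {T : measurableType d} {R : realType}
    (mu : {measure set T -> \bar R}) (D : set T) (f g : T -> R) (r : R) :
  measurable D -> measurable_fun D f -> measurable_fun D g ->
  0 < r -> (forall x, 0 <= f x) -> (forall x, 0 <= g x) ->
  mu.-integrable D (fun x => (f x `^ r)%:E) ->
  mu.-integrable D (fun x => (g x `^ r)%:E) ->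
  mu.-integrable D (fun x => ((f x + g x) `^ r)%:E).
Proof.
move=> mD mf mg r0 f0 g0 fr gr.
have ifg := rintegrableZ mD (2 `^ r) (rintegrableD mD fr gr).
apply: (rintegrable_le mD _ ifg) => [|x Dx].
  rewrite (_ : (fun x => _) = (fun x => `|f x + g x| `^ r)).
    by apply: measurable_powR_norm; exact: measurable_funD.
  by apply/funext => x; rewrite ger0_norm ?addr_ge0.
rewrite ger0_norm ?powR_ge0//.
have [fg|gf] := leP (f x) (g x).
  apply: (@le_trans _ _ ((2 * g x) `^ r)).
    by rewrite ge0_ler_powR ?nnegrE ?mulr_ge0 ?addr_ge0 ?(ltW r0)//; lra.
  by rewrite powRM// ler_wpM2l ?powR_ge0// lerDr powR_ge0.
apply: (@le_trans _ _ ((2 * f x) `^ r)).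
  by rewrite ge0_ler_powR ?nnegrE ?mulr_ge0 ?addr_ge0 ?(ltW r0)//; lra.
by rewrite powRM// ler_wpM2l ?powR_ge0// lerDl powR_ge0.
Qed.

Lemma integrable_powR_sum {d} {T : measurableType d} {R : realType}
    (mu : {measure set T -> \bar R}) (D : set T) (r : R) (I : Type)
    (s : seq I) (f : I -> T -> R) :
  measurable D -> 0 < r -> (forall i, measurable_fun D (f i)) ->
  (forall i x, 0 <= f i x) ->
  (forall i, mu.-integrable D (fun x => (f i x `^ r)%:E)) ->
  mu.-integrable D (fun x => ((\sum_(i <- s) f i x) `^ r)%:E).
Proof.
move=> mD r0 mf f0 fr; elim: s => [|i s IHs].
  under eq_fun do rewrite big_nil powR0 ?gt_eqF//.
  exact: integrable0.
under eq_fun do rewrite big_cons.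
apply: integrable_powR_add => //; first exact: measurable_sum.
by move=> x; exact: sumr_ge0.
Qed.

Lemma integral_setD_null {d} {T : measurableType d} {R : realType}
    (mu : {measure set T -> \bar R}) (D N : set T) (f : T -> R) :
  measurable D -> measurable N -> mu N = 0 -> measurable_fun D f ->
  (\int[mu]_(x in D) (f x)%:E = \int[mu]_(x in D `\` N) (f x)%:E)%E.
Proof.
move=> mD mN N0 /measurable_EFinP mf; rewrite integralE [RHS]integralE.
congr (_ - _)%E; apply: ge0_negligible_integral => //.
- exact: measurable_funepos.
- exact: measurable_funeneg.
Qed.

Lemma poweR_half_lt {R : realType} (x : \bar R) (e : R) : (0 <= x)%E -> 0 < e ->
  (x `^ 2^-1 < e%:E)%E = (x < (e ^+ 2)%:E)%E.
Proof.
case: x => [r| |//] x0 e0; last by rewrite poweRyr// invr_neq0.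
rewrite poweR_EFin !lte_fin powR12_sqrt// -[in LHS](ger0_norm (ltW e0)) -sqrtr_sqr.
by rewrite ltr_sqrt// exprn_gt0.
Qed.

(** * The Sobolev spaces as completions *)

Section Sobolev_completion.
Context {R : realType} {n : nat}.
Variables (Q : 'rV[R]_n -> 'M[R]_n) (Theta : set 'rV[R]_n).

(** Pairs rather than functions, so that the class is stable under composition
    although the chain rule for [grad] is only available in [Theta]. *)
Definition compact_pair : set (@gpair _ 'rV[R]_n R n) :=
  [set p | Lip_0 Theta p.1 /\ forall x, Theta x -> p.2 x = grad p.1 x].

Local Notation compl := (completion lebesgue_rV Theta Q compact_pair).

Lemma QH1_normE (u : fpair) : QH1_norm Q Theta u =
  ((value_energy lebesgue_rV Theta u.1 + slope_energy lebesgue_rV Theta Q u.2) `^ 2^-1)%E.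
Proof.
congr ((_ + _) `^ _)%E; apply: eq_integral => x _.
by rewrite real_normK// num_real.
Qed.

Lemma QH1_norm_lt (u : fpair) (e : R) : 0 < e ->
  (QH1_norm Q Theta u < e%:E)%E =
  (value_energy lebesgue_rV Theta u.1 + slope_energy lebesgue_rV Theta Q u.2 < (e ^+ 2)%:E)%E.
Proof.
move=> e0; rewrite QH1_normE poweR_half_lt//.
by apply: adde_ge0; exact: value_energy_ge0.
Qed.

Lemma QH1_norm_lty (u : fpair) : (QH1_norm Q Theta u < +oo)%E <->
  (value_energy lebesgue_rV Theta u.1 < +oo)%E /\
  (slope_energy lebesgue_rV Theta Q u.2 < +oo)%E.
Proof.
rewrite QH1_normE.
have v0 := value_energy_ge0 lebesgue_rV Theta u.1.
have s0 : (0 <= slope_energy lebesgue_rV Theta Q u.2)%E := value_energy_ge0 _ _ _.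
split=> [uoo|[voo soo]]; last by rewrite poweR_lty// lte_add_pinfty.
suff : (value_energy lebesgue_rV Theta u.1 + slope_energy lebesgue_rV Theta Q u.2 < +oo)%E.
  by move=> voo; split; apply: le_lt_trans voo; rewrite (leeDl, leeDr).
rewrite ltNge leye_eq; apply/negP => /eqP voo.
by move: uoo; rewrite voo poweRyr ?ltxx// invr_neq0.
Qed.

Lemma QH1_0_completion (u : fpair) : QH1_0 Q Theta u -> compl u.
Proof.
move=> [mu1 mu2 /QH1_norm_lty[voo soo] [phi phiL phiu]]; split=> // e e0.
have se0 : (0 < (Num.sqrt e)%:E)%E by rewrite lte_fin sqrtr_gt0.
have [k _ /(_ k (leqnn k))] : \forall k \near \oo,
    (QH1_norm Q Theta (fpair_sub u (with_grad (phi k))) < (Num.sqrt e)%:E)%E.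
  exact: cvge_near_lt phiu se0.
rewrite QH1_norm_lt ?sqrtr_gt0// sqr_sqrtr ?ltW// => uk.
exists (with_grad (phi k)); last exact: uk.
by split; first exact: (phiL k).
Qed.

Lemma completion_QH1_0 (u : fpair) : compl u -> QH1_0 Q Theta u.
Proof.
move=> [[mu1 mu2 voo soo] ucl].
have ek k : 0 < (k.+1%:R^-1 : R) ^+ 2 by rewrite exprn_gt0.
have /choice[p pP] : forall k, exists p, compact_pair p /\
    (energy_dist lebesgue_rV Theta Q u p < (k.+1%:R^-1 ^+ 2)%:E)%E.
  by move=> k; have [p ? ?] := ucl _ (ek k); exists p.
split=> //; first exact/QH1_norm_lty.
exists (fun k => (p k).1) => [k|]; first exact: (pP k).1.1.
apply: (@squeeze_cvge _ _ _ _ (cst 0%E) _ (fun k => (k.+1%:R^-1 : R)%:E)).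
- apply: nearW => k; apply/andP; split; first exact: poweR_ge0.
  apply: ltW; rewrite QH1_norm_lt//.
  have [[_ pk] up] := pP k.
  have sl : slope_energy lebesgue_rV Theta Q (fun x => u.2 x - (p k).2 x) =
      slope_energy lebesgue_rV Theta Q (fpair_sub u (with_grad (p k).1)).2.
    apply: eq_integral => x; rewrite inE => Tx.
    by rewrite /slope (pk _ Tx).
  by move: up; rewrite /energy_dist sl; apply: le_lt_trans.
- exact: cvg_cst.
- by apply: cvg_EFin; [exact: nearW|exact: cvg_harmonic].
Qed.

End Sobolev_completion.

Section compact_pairs.
Context {R : realType} {n : nat}.
Variables (Q : 'rV[R]_n -> 'M[R]_n) (Theta : set 'rV[R]_n).
Hypothesis oT : open Theta.

Lemma measurable_compact_pair p : compact_pair Theta p -> measurable_fun Theta p.1.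
Proof. by move=> [[fL _ _] _]; exact: measurable_lipschitz. Qed.

Lemma compact_pair_comp p (h h' : R -> R) (L K : R) : C11_bounded h h' L K -> h 0 = 0 ->
  compact_pair Theta p ->
  compact_pair Theta (h \o p.1, fun x => h' (p.1 x) *: p.2 x).
Proof.
move=> hC h0 [fL pg]; split=> [|x Tx /=]; first exact: Lip_0_comp_C11 hC h0 fL.
by case: fL => fL _ _; rewrite pg// (grad_comp_C11 hC oT Tx fL).
Qed.

Lemma compact_pair_sobolev (sigma C3 : R) p (a : R) : 1 < sigma -> 0 < C3 ->
  (forall f, Lip_0 Theta f ->
    ((\int[lebesgue_rV]_(x in Theta) (`|f x| `^ (2 * sigma))%:E)
        `^ (2 * sigma)^-1 <=
     C3%:E * (\int[lebesgue_rV]_(x in Theta) (Qnorm Q (grad f) x ^+ 2)%:E)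
        `^ 2^-1)%E) ->
  compact_pair Theta p -> 0 < a ->
  (slope_energy lebesgue_rV Theta Q p.2 <= a%:E)%E ->
  (\int[lebesgue_rV]_(x in Theta) (`|p.1 x| `^ (2 * sigma))%:E <=
    ((C3 ^+ 2 * a) `^ sigma)%:E)%E.
Proof.
move=> s1 C30 sob [pL pg] a0; have s0 : 0 < sigma by exact: lt_trans s1.
have s20 : 0 < 2 * sigma by rewrite mulr_gt0.
have -> : slope_energy lebesgue_rV Theta Q p.2 =
    (\int[lebesgue_rV]_(x in Theta) (Qnorm Q (grad p.1) x ^+ 2)%:E)%E.
  by apply: eq_integral => x; rewrite inE => Tx; rewrite /slope pg.
move=> pa; have := sob _ pL.
set I := (\int[_]_(_ in _) _)%E; set J := (\int[_]_(_ in _) _)%E in pa *.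
have I0 : (0 <= I)%E by apply: integral_ge0 => x _; rewrite lee_fin powR_ge0.
have J0 : (0 <= J)%E by apply: integral_ge0 => x _; rewrite lee_fin sqr_ge0.
have mono (r : R) (x y : \bar R) : 0 < r -> (0 <= x)%E -> (x <= y)%E -> (x `^ r <= y `^ r)%E.
  move=> r0 x0 xy; apply: gt0_ler_poweR; rewrite ?(ltW r0)// in_itv/= leey andbT//.
  exact: le_trans xy.
move=> IJ.
have {IJ} IJ : (I `^ (2 * sigma)^-1 <= (C3 * a `^ 2^-1)%:E)%E.
  apply: le_trans IJ _; rewrite EFinM; apply: lee_pmul.
  - by rewrite lee_fin ltW.
  - exact: poweR_ge0.
  - exact: lexx.
  - by rewrite -poweR_EFin; exact: mono.
have := mono _ _ _ s20 (poweR_ge0 _ _) IJ.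
rewrite -poweRrM mulVf ?gt_eqF// poweRe1// poweR_EFin.
rewrite powRrM (powR_mulrn 2) ?mulr_ge0 ?powR_ge0 ?(ltW C30)//.
by rewrite exprMn powR12_sqrt ?(ltW a0)// sqr_sqrtr ?(ltW a0).
Qed.

End compact_pairs.

(** * The lower order terms *)

Section vector_field_combination.
Context {R : realType} {n N : nat}.
Implicit Types (K : 'I_N -> 'rV[R]_n -> R) (W : 'I_N -> 'rV[R]_n -> 'rV[R]_n).

Definition combine K W (x : 'rV[R]_n) : 'rV[R]_n := \sum_i K i x *: W i x.

Definition total_norm K (x : 'rV[R]_n) : R := \sum_i `|K i x|.

Lemma dotv_combine K W x xi :
  dotv (combine K W x) xi = \sum_i K i x * dotv (W i x) xi.
Proof.
rewrite /combine; elim/big_rec2: _ => [|i a v _ <-].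
  by rewrite -(scale0r 0) dotvZl mul0r.
by rewrite dotvDl dotvZl.
Qed.

Lemma tuple_applyE K W (u : fpair) x :
  tuple_apply K W u x = dotv (combine K W x) (u.2 x).
Proof. by rewrite dotv_combine. Qed.

Lemma measurable_combine (D : set 'rV[R]_n) K W :
  (forall i, measurable_fun D (K i)) -> (forall i, vec_measurable D (W i)) ->
  vec_measurable D (combine K W).
Proof.
move=> mK mW j.
rewrite (_ : (fun x => _) = (fun x => \sum_i K i x * W i x 0 j)).
  by apply: measurable_sum => i; apply: measurable_funM; [exact: mK|exact: mW].
by apply/funext => x; rewrite summxE; apply: eq_bigr => i _; rewrite mxE.
Qed.

Lemma measurable_total_norm (D : set 'rV[R]_n) K :
  (forall i, measurable_fun D (K i)) -> measurable_fun D (total_norm K).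
Proof.
move=> mK; apply: measurable_sum => i.
by apply: measurableT_comp => //; exact: mK.
Qed.

Lemma dotv_combine_le (A : 'M[R]_n) K W x xi : mx_nonneg A ->
  (forall i, dotv (W i x) xi ^+ 2 <= dotv xi (mxact A xi)) ->
  `|dotv (combine K W x) xi| <= total_norm K x * sqrt_norm A xi.
Proof.
move=> nA WA; rewrite dotv_combine (le_trans (ler_norm_sum _ _ _))//.
rewrite /total_norm mulr_suml; apply: ler_sum => i _; rewrite normrM ler_wpM2l//.
rewrite -[leRHS]ger0_norm ?sqrt_norm_ge0// -ler_sqr ?nnegrE//.
by rewrite !real_normK ?num_real// sqr_sqrt_norm.
Qed.

Lemma GS_productE (X : operator_coefs R n N) (u v : fpair) x :
  GS_product X u v x =
  u.1 x * dotv (combine (coefG X) (coefS X) x) (v.2 x) +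
  v.1 x * dotv (combine (coefG X) (coefS X) x) (u.2 x).
Proof.
rewrite !dotv_combine !mulr_sumr -big_split; apply: eq_bigr => i _ /=.
by rewrite mulrDr !(mulrCA (coefG X i x)).
Qed.

End vector_field_combination.

Lemma ae_restrictP {d} {T : measurableType d} {R : realType}
    (mu : {measure set T -> \bar R}) (D : set T) (A : T -> Prop) :
  (\forall x \ae mu, D x -> A x) <->
  exists2 N, measurable N /\ mu N = 0 & forall x, (D `\` N) x -> A x.
Proof.
split=> [[N [mN N0 AN]]|[N [mN N0] NA]].
  by exists N => // x [Dx Nx]; apply: contrapT => nA; apply: Nx; apply: AN => /(_ Dx).
exists N; split=> // x /=; apply: contra_notP => Nx Dx.
exact: NA.
Qed.

(** * The weak maximum principle *)

Section boundary_level.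
Context {R : realType} {n N : nat}.
Variables (Q : 'rV[R]_n -> 'M[R]_n) (Theta : set 'rV[R]_n) (sigma : R) (t q : \bar R).
Variables (X : operator_coefs R n N) (u : @fpair R n).
Hypotheses (oT : open Theta) (T0 : Theta !=set0) (bT : bounded_set Theta).
Hypothesis Q_ge0 : forall x, Theta x -> mx_nonneg (Q x).
Hypothesis mQ : mx_measurable Theta Q.
Hypotheses (sigma1 : 1 < sigma) (sobolev : global_Sobolev Q Theta sigma).

Let mT : measurable Theta. Proof. exact: measurable_open_rV. Qed.
Let Too : (lebesgue_rV Theta < +oo)%E. Proof. exact: lebesgue_rV_bounded. Qed.
Let T_gt0 : (0 < lebesgue_rV Theta)%E. Proof. exact: lebesgue_rV_open_gt0. Qed.

(** This excludes negative levels on the boundary. *)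
Lemma QH1_0_value_lt (v : fpair) (c : R) : QH1_0 Q Theta v -> 0 < c ->
  ~ forall x, Theta x -> c <= v.1 x.
Proof.
move=> /QH1_0_completion cv c0; have [C3 C30 sob] := sobolev.
have C320 : 0 < C3 ^+ 2 by rewrite exprn_gt0.
exact: (completion_value_lt mT Q_ge0 mQ (measurable_compact_pair oT)
  (compact_pair_comp oT) sigma1 C320
  (fun p a => @compact_pair_sobolev R n Q Theta sigma C3 p a sigma1 C30 sob) cv T_gt0 c0).
Qed.

Hypothesis elliptic : rough_elliptic_operator Q Theta X.
Hypothesis negative : negativity_condition Q Theta X.
Hypotheses (t_gt : ((sigma / (sigma - 1))%:E < t)%E) (Ft : in_Lp Theta t (coefF X)).
Hypothesis q_gt : ((2 * (sigma / (sigma - 1)))%:E < q)%E.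
Hypothesis GHq : forall i, in_Lp Theta q (coefG X i) /\ in_Lp Theta q (coefH X i).
Hypothesis subsolution : weak_subsolution Q Theta X u.

Let gam := combine (coefG X) (coefS X).
Let eta := combine (coefH X) (coefR X).
Let b x := total_norm (coefG X) x + total_norm (coefH X) x.

Let mgam : vec_measurable Theta gam.
Proof.
have [_ RS GH _] := elliptic; apply: measurable_combine => i.
  exact: (GH i).1.
exact: (RS i).2.1.
Qed.

Let meta : vec_measurable Theta eta.
Proof.
have [_ RS GH _] := elliptic; apply: measurable_combine => i.
  exact: (GH i).2.
exact: (RS i).1.1.
Qed.

Let mG : measurable_fun Theta (total_norm (coefG X)).
Proof. by apply: measurable_total_norm => i; exact: (GHq i).1.1. Qed.
Let mH : measurable_fun Theta (total_norm (coefH X)).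
Proof. by apply: measurable_total_norm => i; exact: (GHq i).2.1. Qed.
Let mb : measurable_fun Theta b.
Proof. exact: measurable_funD. Qed.

Let sigma'_gt0 : 0 < sigma / (sigma - 1).
Proof. by rewrite divr_gt0 ?subr_gt0// (lt_trans _ sigma1). Qed.

Let ib : lebesgue_rV.-integrable Theta
  (fun x => (b x `^ (2 * (sigma / (sigma - 1))))%:E).
Proof.
have s0 : 0 < 2 * (sigma / (sigma - 1)) by rewrite mulr_gt0.
have tot (K : 'I_N -> 'rV[R]_n -> R) : (forall i, in_Lp Theta q (K i)) ->
    lebesgue_rV.-integrable Theta
      (fun x => (total_norm K x `^ (2 * (sigma / (sigma - 1))))%:E).
  move=> Kq; have mK i : measurable_fun Theta (fun x => `|K i x|).
    by apply: measurableT_comp => //; exact: (Kq i).1.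
  exact: (@integrable_powR_sum _ _ _ lebesgue_rV _ _ _ (index_enum _)
    (fun i x => `|K i x|) mT s0 mK (fun i x => normr_ge0 _)
    (fun i => integrable_powR_Lnorm mT T_gt0 Too (Kq i).1 s0 q_gt (Kq i).2)).
have tot_ge0 (K : 'I_N -> 'rV[R]_n -> R) x : 0 <= total_norm K x by exact: sumr_ge0.
exact: (integrable_powR_add mT mG mH s0 (tot_ge0 _) (tot_ge0 _)
  (tot _ (fun i => (GHq i).1)) (tot _ (fun i => (GHq i).2))).
Qed.

Let iF : lebesgue_rV.-integrable Theta
  (fun x => (`|coefF X x| `^ (sigma / (sigma - 1)))%:E).
Proof. exact: (integrable_powR_Lnorm mT T_gt0 Too Ft.1 sigma'_gt0 t_gt Ft.2). Qed.

Local Notation compl := (completion lebesgue_rV Theta Q (compact_pair Theta)).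
Local Notation formE := (operator_form (coefP X) gam eta (coefF X)).

Let form_integrandE (v w : fpair) x : form_integrand X v w x = formE v w x.
Proof. by rewrite /form_integrand !tuple_applyE. Qed.

Let coefficients_ae : exists2 c1 : R, 0 < c1 &
  \forall x \ae lebesgue_rV, Theta x ->
    [/\ forall i xi, dotv (coefR X i x) xi ^+ 2 <= dotv xi (mxact (Q x) xi),
        forall i xi, dotv (coefS X i x) xi ^+ 2 <= dotv xi (mxact (Q x) xi) &
        forall xi, c1 * dotv xi (mxact (Q x) xi) <= dotv xi (mxact (coefP X x) xi)].
Proof.
have [[_ _ _ [c1 [C1 [c10 _ Pae]]]] RS _ _] := elliptic; exists c1 => //.
have Rae : \forall x \ae lebesgue_rV, forall i, Theta x ->
    forall xi, dotv (coefR X i x) xi ^+ 2 <= dotv xi (mxact (Q x) xi).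
  by apply: filter_forall => i; exact: (RS i).1.2.
have Sae : \forall x \ae lebesgue_rV, forall i, Theta x ->
    forall xi, dotv (coefS X i x) xi ^+ 2 <= dotv xi (mxact (Q x) xi).
  by apply: filter_forall => i; exact: (RS i).2.2.
apply: (filterS3 _ _ Pae Rae Sae) => x Px Rx Sx Tx; split.
- by move=> i; exact: Rx.
- by move=> i; exact: Sx.
- by move=> xi; exact: (Px Tx xi).1.
Qed.

Let negativity (N0 : set 'rV[R]_n) : measurable N0 -> lebesgue_rV N0 = 0 ->
  forall v w : fpair, compl v -> compl w ->
  (forall x, Theta x -> 0 <= v.1 x * w.1 x) ->
  (0 <= \int[lebesgue_rV]_(x in Theta `\` N0) (coefF X x * v.1 x * w.1 x +
     (v.1 x * GS gam w x + w.1 x * GS gam v x))%:E)%E.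
Proof.
move=> mN N00 v w cv cw vw0.
have fge0 := negative (completion_QH1_0 cv) (completion_QH1_0 cw) (aeW _ vw0).
have [[mv1 mv2 _ _] _] := cv; have [[mw1 mw2 _ _] _] := cw.
pose f x := coefF X x * v.1 x * w.1 x + (v.1 x * GS gam w x + w.1 x * GS gam v x).
have fE : (fun x => coefF X x * v.1 x * w.1 x + GS_product X v w x) = f.
  by apply/funext => x; rewrite GS_productE.
have mGS (g : @fpair R n) : vec_measurable Theta g.2 -> measurable_fun Theta (GS gam g).
  by move=> mg; exact: (measurable_dotv mgam mg).
have mf : measurable_fun Theta f.
  have mFvw := measurable_funM (measurable_funM Ft.1 mv1) mw1.
  have mvw := measurable_funM mv1 (mGS _ mw2).
  exact: (measurable_funD mFvw (measurable_funD mvw (measurable_funM mw1 (mGS _ mv2)))).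
have fge0' : (0 <= \int[lebesgue_rV]_(x in Theta) (f x)%:E)%E.
  by rewrite -fE; exact: fge0.
exact: (eq_ind _ (fun z => (0 <= z)%E) fge0' _ (integral_setD_null mT mN N00 mf)).
Qed.

(** The exceptional sets of the conditions on the coefficients are removed from
    [Theta] once and for all; what remains has full measure, and there the
    conditions hold at every point. *)
Lemma ae_le_level (k : R) : 0 <= k -> QH1_0 Q Theta (truncate k u) ->
  \forall x \ae lebesgue_rV, Theta x -> u.1 x <= k.
Proof.
move=> k0 /QH1_0_completion ck.
have [C3 C30 sob] := sobolev; have C320 : 0 < C3 ^+ 2 by rewrite exprn_gt0.
have [c1 c10 /ae_restrictP[N0 [mN N00] NP]] := coefficients_ae.
have [[mu1 mu2 _ _] wsub] := subsolution.
pose E := Theta `\` N0; have mE : measurable E by exact: measurableD.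
have ET : E `<=` Theta by exact: subDsetl.
have Eoo : (lebesgue_rV E < +oo)%E.
  by apply: le_lt_trans Too; apply: le_measure; rewrite ?inE.
have TE0 : lebesgue_rV (Theta `\` E) = 0.
  apply: (subset_measure0 _ mN) => //; first exact: measurableD.
  by move=> x [Tx nEx]; apply: contrapT => Nx; apply: nEx.
have tot_ge0 (K : 'I_N -> 'rV[R]_n -> R) x : 0 <= total_norm K x by exact: sumr_ge0.
have gam_le x xi : E x -> `|dotv (gam x) xi| <= b x * sqrt_norm (Q x) xi.
  move=> Ex; have [_ Sx _] := NP x Ex.
  apply: le_trans (dotv_combine_le _ (Q_ge0 (ET _ Ex)) (Sx^~ xi)) _.
  by rewrite ler_wpM2r ?sqrt_norm_ge0// lerDl tot_ge0.
have eta_le x xi : E x -> `|dotv (eta x) xi| <= b x * sqrt_norm (Q x) xi.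
  move=> Ex; have [Rx _ _] := NP x Ex.
  apply: le_trans (dotv_combine_le _ (Q_ge0 (ET _ Ex)) (Rx^~ xi)) _.
  by rewrite ler_wpM2r ?sqrt_norm_ge0// lerDr tot_ge0.
have b0 x : E x -> 0 <= b x by move=> _; rewrite addr_ge0.
have ell x xi : E x ->
    c1 * sqrt_norm (Q x) xi ^+ 2 <= dotv xi (mxact (coefP X x) xi).
  move=> Ex; have [_ _ Px] := NP x Ex.
  by rewrite sqr_sqrt_norm//; exact: Q_ge0 (ET _ Ex).
have mES (f : 'rV[R]_n -> R) : measurable_fun Theta f -> measurable_fun E f.
  exact: measurable_funS.
have sub (l : R) : k <= l -> compl (truncate l u) ->
    rintegrable lebesgue_rV E (formE u (truncate l u)) /\
    (\int[lebesgue_rV]_(x in E) (formE u (truncate l u) x)%:E <= 0)%E.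
  move=> kl cl; have v0 x : Theta x -> 0 <= (truncate l u).1 x.
    by move=> _; rewrite /= le_max lexx orbT.
  have [ifm le0] := wsub _ (completion_QH1_0 cl) (aeW _ v0).
  have fE : form_integrand X u (truncate l u) = formE u (truncate l u).
    by apply/funext => x; exact: form_integrandE.
  rewrite /bilinear_form fE in ifm le0; split; first exact: integrableS ifm.
  by rewrite -(negligible_integral mN mT ifm N00).
have := @ae_le_boundary_level _ _ R n lebesgue_rV Theta Q mT Q_ge0 mQ
  (compact_pair Theta) (measurable_compact_pair oT) (compact_pair_comp oT)
  sigma (C3 ^+ 2) sigma1 C320
  (fun p a => @compact_pair_sobolev R n Q Theta sigma C3 p a sigma1 C30 sob)
  E (coefP X) gam eta b (coefF X) mE ET Eoo (fun i => mES _ (mgam i))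
  (fun i => mES _ (meta i)) (mES _ mb) (mES _ Ft.1) gam_le eta_le b0
  (integrableS mT mE ET ib) (integrableS mT mE ET iF) (negativity mN N00)
  c1 c10 ell TE0 u k k0 mu1 mu2 ck sub.
move=> /ae_restrictP[N1 [mN1 N10] uN1].
apply/ae_restrictP; exists (N0 `|` N1).
  split; first exact: measurableU.
  exact: null_set_setU.
by move=> x [Tx /not_orP[x0 x1]]; apply: uN1; split.
Qed.

End boundary_level.

Lemma fpair_pos_sub_cst {R : realType} {n : nat} (u : @fpair R n) (k : R) : 0 <= k ->
  fpair_pos (fpair_sub (fpair_pos u) (fpair_cst k)) = truncate k u.
Proof.
move=> k0; congr pair; apply/funext => x /=.
  by rewrite /Num.max; do !case: ifPn; rewrite -?leNgt; lra.
rewrite subr0 subr_gt0; have [ku|uk] := ltP k (u.1 x).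
  by rewrite scale1r (lt_le_trans ku) ?le_max ?lexx// (le_lt_trans k0 ku).
by rewrite scale0r ifF// lt_max; apply/negbTE; rewrite negb_or -!leNgt uk.
Qed.

Theorem theorem4p3 (R : realType) (n N : nat)
    (Omega : set 'rV[R]_n) (rho : 'rV[R]_n -> 'rV[R]_n -> R)
    (Q : 'rV[R]_n -> 'M[R]_n) (Theta : set 'rV[R]_n)
    (r1 : 'rV[R]_n -> R) (sigma : R) (t q : \bar R)
    (X : operator_coefs R n N) (u : fpair) :
  (0 < n)%N ->
  geometric_homogeneous_space Omega rho ->
  degenerate_matrix Omega Q ->
  bounded_domain Theta -> closure Theta `<=` Omega ->
  {within Omega, continuous r1} -> (forall x, Omega x -> 0 < r1 x) ->
  local_Poincare Omega rho Q r1 2 ->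
  1 < sigma -> global_Sobolev Q Theta sigma ->
  rough_elliptic_operator Q Theta X ->
  negativity_condition Q Theta X ->
  ((sigma / (sigma - 1))%:E < t)%E -> in_Lp Theta t (coefF X) ->
  ((2 * (sigma / (sigma - 1)))%:E < q)%E ->
  (forall i, in_Lp Theta q (coefG X i) /\ in_Lp Theta q (coefH X i)) ->
  weak_subsolution Q Theta X u ->
  (ess_sup_in Theta u.1 <= sup_boundary Q Theta (fpair_pos u))%E.
Proof.
move=> _ [[oO _ _] _] [Q_ge0 mQ _] [oT _ T0 bT] TO _ _ _ s1 sob ell neg tt Ft qq GH sub.
have TOmega : Theta `<=` Omega by exact: subset_trans (@subset_closure _ Theta) TO.
have QT x (Tx : Theta x) : mx_nonneg (Q x) := Q_ge0 x (TOmega x Tx).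
have mQT : mx_measurable Theta Q.
  by move=> i j; exact: (measurable_funS (measurable_open_rV oO) TOmega (mQ i j)).
apply/ereal_infP => _ [k /= kb <-].
apply/ess_supP; have [k0|k0] := ltP k 0.
  have := @QH1_0_value_lt R n Q Theta sigma oT T0 QT mQT s1 sob _ (- k) kb.
  case; first by rewrite oppr_gt0.
  by move=> x _; rewrite /= le_max lerDr le_max lexx orbT.
move: kb; rewrite /le_on_boundary /nonpos_on_boundary fpair_pos_sub_cst// => ck.
have := @ae_le_level R n N Q Theta sigma t q X u oT T0 bT QT mQT s1 sob ell neg
  tt Ft qq GH sub k k0 ck.
apply: filterS => x ux; rewrite /patch; case: ifPn => [|_]; last by rewrite leNye.
by rewrite inE lee_fin => /ux.
Qed.
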